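(* For $(p,p')=(3,7)$ (level $N=1/3$) and $r\in\{0,1,2\}$, \begin{align*} (q)_{\infty}^3\,\mathcal{C}_{0,2r}^{1/3}(q) &=(-q)^{-r}\frac{(q)_{\infty}^3}{J_{2}}\cdot\frac{j(-q^{1+2r};q^{14})\,j(q^{16+4r};q^{28})}{j(-1;q)J_{28}} \\ &\quad -q^{2-2r}\frac{j(q^{6-2r};q^{14})\,j(q^{26-4r};q^{28})}{J_{28}}\, \omega_3(-q) + \frac{q^{-r}}{2}\, \frac{j(q^{1+2r};q^{14})\,j(q^{16+4r};q^{28})}{J_{28}}\, f_{3}(q^2). \end{align*}
   Context: Throughout $q=e^{2\pi i\tau}$ with $\operatorname{Im}\tau>0$, $q^{a}:=e^{2\pi i a\tau}$ for rational $a$, and $z=e^{2\pi i w}$, $z^{a}:=e^{2\pi i a w}$. Notation: $(x;q)_n=\prod_{i=0}^{n-1}(1-q^ix)$, $(x)_n=(x;q)_n$, $(q)_\infty=\prod_{n\ge1}(1-q^n)$, $J_a=\prod_{i\ge1}(1-q^{ai})$, and $j(x;q):=\sum_{n\in\mathbb{Z}}(-1)^nq^{n(n-1)/2}x^n$. Ramanujan's third-order mock theta functions are $$f_3(q)=\sum_{n\ge0}\frac{q^{n^2}}{(-q)_n^2},\qquad \omega_3(q)=\sum_{n\ge0}\frac{q^{2n(n+1)}}{(q;q^2)_{n+1}^2}.$$ Characters: for coprime integers $p\ge1$, $p'\ge 2$ put $N=p'/p-2$, and let $0\le\ell\le p'-2$. The character of the admissible irreducible highest weight $A_1^{(1)}$-module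 of level $N$ and spin $\ell$ is (Weyl–Kac formula) $$\chi_{\ell}^{N}(z;q)=\chi_{\ell}^{(p,p')}(z;q)=\frac{\Theta_{\ell+1,p'}(z;q^p)-\Theta_{-(\ell+1),p'}(z;q^p)}{\Theta_{1,2}(z;q)-\Theta_{-1,2}(z;q)},\qquad \Theta_{n,m}(z;q)=\sum_{k\in\mathbb{Z}+n/(2m)}q^{mk^2}z^{-mk}.$$ It is holomorphic in the annulus $|q|<|z|<|q|^{-1}$. String functions: for $N\neq0$ and $m\in2\mathbb{Z}+\ell$, $C^N_{m,\ell}(q)$ is defined by the expansion in that annulus $$\chi_\ell^{N}(z;q)=\sum_{m\in2\mathbb{Z}+\ell}C_{m,\ell}^{N}(q)\,q^{\frac{m^2}{4N}}z^{-\frac m2},$$ and the normalized string function is $$\mathcal{C}_{m,\ell}^{N}(q):=q^{-s_{\lambda,\mu}}C_{m,\ell}^{N}(q),\qquad s_{\lambda,\mu}=-\frac18+\frac{p(\ell+1)^2}{4p'}-\frac{m^2}{4N}.$$ *)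

(* Defs.v *)
From Stdlib Require Import Reals ZArith ClassicalEpsilon.
From Coquelicot Require Import Coquelicot.

Open Scope C_scope.

(** * Limits, series and powers in C *)

(* Coquelicot's [Lim_seq] is total and real-valued.  The limit of a complex
   sequence is taken componentwise; it is the actual limit whenever the
   sequence converges. *)
Definition Clim_seq (u : nat -> C) : C :=
  (real (Lim_seq (fun n => Re (u n))), real (Lim_seq (fun n => Im (u n)))).

Definition CSeries (a : nat -> C) : C := Clim_seq (sum_n a).

(* A bilateral series is split as [k >= 0] and [k = -1, -2, ...]; it converges
   when both halves do. *)
Definition ZSeries (a : Z -> C) : C :=
  CSeries (fun n => a (Z.of_nat n)) + CSeries (fun n => a (- Z.of_nat n - 1)%Z).

Definition is_Zseries (a : Z -> C) (l : C) : Prop :=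
  exists l1 l2 : C,
    is_series (fun n => a (Z.of_nat n)) l1 /\
    is_series (fun n => a (- Z.of_nat n - 1)%Z) l2 /\
    l = l1 + l2.

Definition Czpow (x : C) (n : Z) : C :=
  match n with
  | Z0 => 1
  | Zpos k => x ^ Pos.to_nat k
  | Zneg k => / x ^ Pos.to_nat k
  end.

Definition Cexp (x : C) : C := (exp (Re x) * cos (Im x), exp (Re x) * sin (Im x))%R.

(* [e a] is exp (2 pi i a): with q = e tau and z = e w, the fractional powers
   q^a and z^a mean e (a * tau) and e (a * w). *)
Definition e (a : C) : C := Cexp (2 * PI * Ci * a).

(** * q-series *)

(* (x; q)_n *)
Fixpoint qpoch (x q : C) (n : nat) : C :=
  match n with
  | O => 1
  | S k => qpoch x q k * (1 - q ^ k * x)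
  end.

(* (q)_infinity *)
Definition qinf (q : C) : C := Clim_seq (qpoch q q).

(* J_a = prod_(i >= 1) (1 - q^(a i)) *)
Definition J (a : nat) (q : C) : C := qinf (q ^ a).

(* j(x; q); the integer division is exact. *)
Definition j (x q : C) : C :=
  ZSeries (fun n => Czpow (-1) n * Czpow q (n * (n - 1) / 2)%Z * Czpow x n).

Definition f3 (q : C) : C :=
  CSeries (fun n => q ^ (n * n) / (qpoch (- q) q n) ^ 2).

Definition omega3 (q : C) : C :=
  CSeries (fun n => q ^ (2 * n * (n + 1)) / (qpoch q (q ^ 2) (n + 1)) ^ 2).

(** * Characters and string functions of admissible A_1^(1)-modules *)

(* Theta_{n,m}(z; q) with z = e w, q = e tau; the summation variable
   k in Z + n/(2m) is written k = i + n/(2m) with i in Z.  Replacing q by q^p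
   amounts to replacing tau by p * tau. *)
Definition Theta (n m : Z) (w tau : C) : C :=
  ZSeries (fun i =>
    let k := (IZR i + IZR n / (2 * IZR m))%R in
    e (RtoC (IZR m * k ^ 2)%R * tau) * e (RtoC (- (IZR m * k))%R * w)).

Definition chi_num (p p' l : Z) (w tau : C) : C :=
  Theta (l + 1) p' w (RtoC (IZR p) * tau) - Theta (- (l + 1)) p' w (RtoC (IZR p) * tau).

Definition chi_den (w tau : C) : C := Theta 1 2 w tau - Theta (-1) 2 w tau.

Definition chi (p p' l : Z) (w tau : C) : C := chi_num p p' l w tau / chi_den w tau.

Definition level (p p' : Z) : R := (IZR p' / IZR p - 2)%R.

(* [c m], for m in 2Z + l, are the coefficients of the expansion of chi in the
   annulus |q| < |z| < |q|^-1.  The only zero of the denominator there is the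
   removable singularity z = 1 of chi; the quotient has no meaning at that
   point, which is therefore left out.  The values of [c] at m outside 2Z + l
   are irrelevant. *)
Definition is_string_expansion (p p' l : Z) (tau : C) (c : Z -> C) : Prop :=
  forall w : C,
    (Cmod (e tau) < Cmod (e w) < / Cmod (e tau))%R ->
    chi_den w tau <> 0 ->
    is_Zseries
      (fun k => let m := (2 * k + l)%Z in
         c m * e (RtoC (IZR m ^ 2 / (4 * level p p'))%R * tau)
             * e (RtoC (- (IZR m / 2))%R * w))
      (chi p p' l w tau).

(* C^N_{m,l} at q = e tau, for N <> 0 and m in 2Z + l: the coefficient in the
   expansion above, which determines it uniquely. *)
Definition string_function (p p' m l : Z) (tau : C) : C :=
  epsilon (inhabits (fun _ : Z => RtoC 0)) (is_string_expansion p p' l tau) m.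

Definition s_exponent (p p' m l : Z) : R :=
  (- (1 / 8) + IZR p * (IZR l + 1) ^ 2 / (4 * IZR p')
   - IZR m ^ 2 / (4 * level p p'))%R.

Definition normalized_string_function (p p' m l : Z) (tau : C) : C :=
  e (RtoC (- s_exponent p p' m l)%R * tau) * string_function p p' m l tau.

(* Main.v *)
(** With q = e(tau) and z = e(w), the character is, up to a power of q, num(z) / j(z;q) with
    num(z) = sum_t q^(21 t^2 + 3 (2r+1) t) (z^(-r-7t) - z^(r+1+7t)).  Finite partial fractions
    and the triple product give P(z) := (q)_inf^3 / j(z;q) = sum_n (-1)^n q^(n(n+1)/2) / (1 - q^n z),
    so (q)_inf^3 C_{0,2r} is the constant coefficient A_0 of num(z) P(z) = sum_k A_k z^k.

    The Laurent coefficients of P satisfy a_l = 1 - q^(l+1) a_(l+1).  Six steps of this recurrence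
    and the quasi-periodicity of num under z -> q^6 z yield
      A_k = q^(6k-3) A_(k-1) + num(q) (q^k - q^(5k-2)) - num(q^2) (q^(2k+1) - q^(4k)).
    By Watson's Appell sums for f_3 and omega_3, the numbers J_2 f_3(q^2) / 2 and J_2 omega_3(-q)
    are the values at k = 0 of two explicit sequences X_k, Y_k such that
    D_k := J_2 A_k - num(q) X_k + q^2 num(q^2) Y_k satisfies D_k = q^(6k-3) D_(k-1), that is
    D_k = q^(3k^2) D_0.  To find D_0, sum (-q)^k (D_k - q D_(k+1)) over k: the pentagonal number
    theorem gives 2 J_2 D_0, the X and Y parts vanish by antisymmetry, and the A part is
    2 J_2 num(-q) P(-1).  The quintuple product identity turns num(-q), num(q) and num(q^2) into
    the theta products of the statement. *)

Require Import Defs.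
From Stdlib Require Import Reals ZArith Lra Lia List Permutation.
From Stdlib Require Import Classical ClassicalEpsilon FunctionalExtensionality.
From Coquelicot Require Import Coquelicot.

Open Scope C_scope.

(** * Unordered sums *)

(** The recurrence fixes A_k only up to a multiple of q^(3k^2), which is also the factor
    q^(m^2/(4N)) of the string expansion for m = 2k at level 1/3. The mock behaviour sits in two
    particular solutions, and one linear functional has to fix the multiple. Evaluation at z = -q
    does so: there the kernels of X and Y become odd under m -> -1 - m, while q^(3k^2) gives a
    nonzero theta series. The price is that -q lies on the boundary of the annulus, whence the
    factor 1 - q/z, equal to 2 there. Six steps are forced by the ratio of 42 t, the increment of
    the quadratic exponent of num, to the increment 7 of its shift in z. Of the values num(q^i) with
    i from 0 to 5, those at 0 and 3 vanish by symmetry and those at 4 and 5 are multiples of those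
    at 2 and 1: hence exactly two mock theta functions. Nearly every step reindexes or exchanges a
    double series, so summation is developed over arbitrary index types without any order; the
    ordered limits of the definitions are met only where a defined series enters or leaves. *)

Fixpoint lsum {T : Type} (f : T -> C) (L : list T) : C :=
  match L with nil => 0 | t :: L' => f t + lsum f L' end.

Fixpoint rsum {T : Type} (f : T -> R) (L : list T) : R :=
  match L with nil => 0%R | t :: L' => (f t + rsum f L')%R end.

Definition eqdec {T : Type} (x y : T) : {x = y} + {x <> y} :=
  excluded_middle_informative (x = y).

Definition bounded_sums {T : Type} (g : T -> R) : Prop :=
  exists M : R, forall L, NoDup L -> (rsum g L <= M)%R.

Definition abs_summable {T : Type} (f : T -> C) : Prop :=
  bounded_sums (fun t => Cmod (f t)).

Definition uncond {T : Type} (f : T -> C) (S : C) : Prop :=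
  forall eps : R, (0 < eps)%R -> exists L, forall L', NoDup L' -> incl L L' ->
    (Cmod (lsum f L' - S) < eps)%R.

(** Absolute summability feeds the domination and exchange arguments; the limit over finite sets
    fixes a value on any index type, so that no enumeration is chosen and bijective reindexing is
    immediate. *)
Definition sums {T : Type} (f : T -> C) (S : C) : Prop :=
  abs_summable f /\ uncond f S.

Lemma lsum_ext {T} (f g : T -> C) L :
  (forall t, In t L -> f t = g t) -> lsum f L = lsum g L.
Proof.
  induction L as [|t L IH]; simpl; intros H; auto.
  rewrite H by auto. rewrite IH; auto.
Qed.

Lemma lsum_plus {T} (f g : T -> C) L :
  lsum (fun t => f t + g t) L = lsum f L + lsum g L.
Proof. induction L as [|t L IH]; simpl; [|rewrite IH]; ring. Qed.

Lemma lsum_scal {T} (c : C) (f : T -> C) L :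
  lsum (fun t => c * f t) L = c * lsum f L.
Proof. induction L as [|t L IH]; simpl; [|rewrite IH]; ring. Qed.

Lemma lsum_app {T} (f : T -> C) L L' : lsum f (L ++ L') = lsum f L + lsum f L'.
Proof. induction L as [|t L IH]; simpl; [|rewrite IH]; ring. Qed.

Lemma lsum_map {T U} (g : U -> T) (f : T -> C) L :
  lsum f (map g L) = lsum (fun u => f (g u)) L.
Proof. induction L as [|t L IH]; simpl; [|rewrite IH]; ring. Qed.

Lemma lsum_perm {T} (f : T -> C) L L' : Permutation L L' -> lsum f L = lsum f L'.
Proof.
  induction 1; simpl; try congruence; ring.
Qed.

Lemma lsum_prod {T U} (f : T * U -> C) L M :
  lsum f (list_prod L M) = lsum (fun t => lsum (fun u => f (t, u)) M) L.
Proof.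
  induction L as [|t L IH]; simpl; auto.
  rewrite lsum_app, lsum_map, IH. reflexivity.
Qed.

Lemma Cmod_lsum {T} (f : T -> C) L :
  (Cmod (lsum f L) <= rsum (fun t => Cmod (f t)) L)%R.
Proof.
  induction L as [|t L IH]; simpl.
  - rewrite Cmod_0; lra.
  - eapply Rle_trans; [apply Cmod_triangle|lra].
Qed.

Lemma rsum_nonneg {T} (f : T -> R) L :
  (forall t, 0 <= f t)%R -> (0 <= rsum f L)%R.
Proof.
  intros H; induction L as [|t L IH]; simpl; [lra|specialize (H t); lra].
Qed.

Lemma rsum_le {T} (f g : T -> R) L :
  (forall t, In t L -> f t <= g t)%R -> (rsum f L <= rsum g L)%R.
Proof.
  induction L as [|t L IH]; simpl; intros H; [lra|].
  assert (f t <= g t)%R by auto. assert (rsum f L <= rsum g L)%R by auto. lra.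
Qed.

Lemma rsum_scal {T} c (f : T -> R) L :
  rsum (fun t => c * f t)%R L = (c * rsum f L)%R.
Proof. induction L as [|t L IH]; simpl; [|rewrite IH]; ring. Qed.

Lemma rsum_app {T} (f : T -> R) L L' : rsum f (L ++ L') = (rsum f L + rsum f L')%R.
Proof. induction L as [|t L IH]; simpl; [|rewrite IH]; ring. Qed.

Lemma rsum_map {T U} (g : U -> T) (f : T -> R) L :
  rsum f (map g L) = rsum (fun u => f (g u)) L.
Proof. induction L as [|t L IH]; simpl; [|rewrite IH]; ring. Qed.

Lemma rsum_perm {T} (f : T -> R) L L' : Permutation L L' -> rsum f L = rsum f L'.
Proof. induction 1; simpl; try congruence; ring. Qed.

Lemma rsum_prod {T U} (f : T -> R) (g : U -> R) L M :
  rsum (fun p => f (fst p) * g (snd p))%R (list_prod L M) = (rsum f L * rsum g M)%R.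
Proof.
  induction L as [|t L IH]; simpl; [ring|].
  rewrite rsum_app, rsum_map, IH. simpl. rewrite rsum_scal. ring.
Qed.

Lemma incl_perm {T} (L L' : list T) :
  NoDup L -> NoDup L' -> incl L L' ->
  exists D, NoDup D /\ Permutation L' (L ++ D) /\ (forall t, In t D -> ~ In t L).
Proof.
  revert L'; induction L as [|t L IH]; intros L' HL HL' Hi.
  - exists L'; split; auto.
  - inversion HL as [|? ? Hn HL1]; subst.
    assert (Ht : In t L') by (apply Hi; left; auto).
    destruct (in_split _ _ Ht) as (A & B & ->).
    assert (P : Permutation (A ++ t :: B) (t :: A ++ B)) by (symmetry; apply Permutation_middle).
    assert (N : NoDup (t :: A ++ B)) by (eapply Permutation_NoDup; eauto).
    inversion N as [|? ? Hn' N']; subst.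
    destruct (IH (A ++ B)) as (D & HD & PD & HD'); auto.
    { intros x Hx. assert (In x (t :: A ++ B)).
      { eapply Permutation_in; [exact P|]. apply Hi; right; auto. }
      destruct H; auto. subst; contradiction. }
    exists D; split; auto. split.
    + rewrite P. simpl. constructor. exact PD.
    + intros x Hx [->|Hl]; [|eapply HD'; eauto].
      apply Hn'. eapply Permutation_in; [symmetry; exact PD|]. apply in_or_app; auto.
Qed.

Lemma rsum_incl {T} (f : T -> R) L L' :
  (forall t, 0 <= f t)%R -> NoDup L -> NoDup L' -> incl L L' ->
  (rsum f L <= rsum f L')%R.
Proof.
  intros Hf HL HL' Hi. destruct (incl_perm L L') as (D & _ & P & _); auto.
  rewrite (rsum_perm f _ _ P), rsum_app. pose proof (rsum_nonneg f D Hf). lra.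
Qed.

Lemma NoDup_list_prod {T U} (L : list T) (M : list U) :
  NoDup L -> NoDup M -> NoDup (list_prod L M).
Proof.
  intros HL HM; induction HL as [|t L Hn HL IH]; simpl; [constructor|].
  apply NoDup_app; auto.
  - apply FinFun.Injective_map_NoDup; auto. intros x y E; congruence.
  - intros [a b] H1 H2. apply in_map_iff in H1. destruct H1 as (u & E & _).
    apply in_prod_iff in H2. inversion E; subst. tauto.
Qed.

Lemma nodup_cover {T} (L : list T) : exists L', NoDup L' /\ incl L L'.
Proof.
  exists (nodup eqdec L); split; [apply NoDup_nodup|].
  intros x; apply nodup_In.
Qed.

Lemma uncond_unique {T} (f : T -> C) S S' : uncond f S -> uncond f S' -> S = S'.
Proof.
  intros H H'. apply NNPP; intros E.
  assert (P : (0 < Cmod (S - S') / 2)%R).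
  { assert (0 < Cmod (S - S'))%R; [|lra]. apply Cmod_gt_0. intros Z; apply E.
    replace S with (S - S' + S') by ring. rewrite Z; ring. }
  destruct (H _ P) as (L & HL). destruct (H' _ P) as (L' & HL').
  destruct (nodup_cover (L ++ L')) as (M & NM & IM).
  assert (A := HL M NM (fun x h => IM x (in_or_app _ _ _ (or_introl h)))).
  assert (B := HL' M NM (fun x h => IM x (in_or_app _ _ _ (or_intror h)))).
  assert (Cmod (S - S') <= Cmod (lsum f M - S') + Cmod (lsum f M - S))%R; [|lra].
  replace (S - S') with ((lsum f M - S') + - (lsum f M - S)) by ring.
  eapply Rle_trans; [apply Cmod_triangle|]. rewrite Cmod_opp; lra.
Qed.

Lemma sums_unique {T} (f : T -> C) S S' : sums f S -> sums f S' -> S = S'.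
Proof. intros [_ H] [_ H']; eapply uncond_unique; eauto. Qed.

Lemma sums_ext {T} (f g : T -> C) S : (forall t, f t = g t) -> sums f S -> sums g S.
Proof. intros H Hs. replace g with f; auto. apply functional_extensionality; auto. Qed.

Lemma sums_eq {T} (f : T -> C) S S' : sums f S -> S = S' -> sums f S'.
Proof. intros; subst; auto. Qed.

Lemma bounded_sums_le {T} (f g : T -> R) :
  (forall t, f t <= g t)%R -> bounded_sums g -> bounded_sums f.
Proof.
  intros H (M & HM); exists M; intros L HL.
  eapply Rle_trans; [apply rsum_le; intros; apply H|auto].
Qed.

Lemma bounded_sums_scal {T} (c : R) (g : T -> R) :
  (0 <= c)%R -> bounded_sums g -> bounded_sums (fun t => c * g t)%R.
Proof.
  intros Hc (M & HM). exists (c * M)%R. intros L HL. rewrite rsum_scal.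
  apply Rmult_le_compat_l; auto.
Qed.

Lemma rsum_plus {T} (f g : T -> R) L :
  rsum (fun t => f t + g t)%R L = (rsum f L + rsum g L)%R.
Proof. induction L as [|t L IH]; simpl; [|rewrite IH]; ring. Qed.

Lemma bounded_sums_plus {T} (f g : T -> R) :
  bounded_sums f -> bounded_sums g -> bounded_sums (fun t => f t + g t)%R.
Proof.
  intros (M & HM) (M' & HM'). exists (M + M')%R. intros L HL. rewrite rsum_plus.
  specialize (HM L HL); specialize (HM' L HL); lra.
Qed.

Lemma bounded_sums_inj {T U} (h : U -> T) (f : T -> R) :
  (forall u v, h u = h v -> u = v) -> bounded_sums f -> bounded_sums (fun u => f (h u)).
Proof.
  intros Hh (M & HM). exists M. intros L HL. rewrite <- rsum_map.
  apply HM, FinFun.Injective_map_NoDup; auto.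
Qed.

Lemma bounded_sums_prod {T U} (f : T -> R) (g : U -> R) :
  (forall t, 0 <= f t)%R -> (forall u, 0 <= g u)%R ->
  bounded_sums f -> bounded_sums g ->
  bounded_sums (fun p : T * U => f (fst p) * g (snd p))%R.
Proof.
  intros Hf Hg (M & HM) (N & HN). exists (M * N)%R. intros L HL.
  destruct (nodup_cover (map fst L)) as (A & NA & IA).
  destruct (nodup_cover (map snd L)) as (B & NB & IB).
  eapply Rle_trans; [apply (rsum_incl _ L (list_prod A B))|].
  - intros [t u]; simpl; apply Rmult_le_pos; auto.
  - auto.
  - apply NoDup_list_prod; auto.
  - intros [t u] H. apply in_prod.
    + apply IA. change t with (fst (t, u)). apply in_map; auto.
    + apply IB. change u with (snd (t, u)). apply in_map; auto.
  - rewrite rsum_prod. apply Rmult_le_compat; auto using rsum_nonneg.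
Qed.

Lemma sums_plus {T} (f g : T -> C) S S' :
  sums f S -> sums g S' -> sums (fun t => f t + g t) (S + S').
Proof.
  intros [A H] [A' H']; split.
  - eapply bounded_sums_le; [|apply (bounded_sums_plus _ _ A A')].
    intros; apply Cmod_triangle.
  - intros eps He. destruct (H (eps / 2)%R) as (L & HL); [lra|].
    destruct (H' (eps / 2)%R) as (L' & HL'); [lra|].
    exists (L ++ L'). intros M NM IM.
    assert (B := HL M NM (fun x h => IM x (in_or_app _ _ _ (or_introl h)))).
    assert (B' := HL' M NM (fun x h => IM x (in_or_app _ _ _ (or_intror h)))).
    rewrite lsum_plus.
    replace (lsum f M + lsum g M - (S + S')) with ((lsum f M - S) + (lsum g M - S')) by ring.
    eapply Rle_lt_trans; [apply Cmod_triangle|lra].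
Qed.

Lemma sums_scal {T} (c : C) (f : T -> C) S :
  sums f S -> sums (fun t => c * f t) (c * S).
Proof.
  intros [A H]; split.
  - eapply bounded_sums_le; [|apply (bounded_sums_scal (Cmod c) _ (Cmod_ge_0 c) A)].
    intros; simpl; rewrite Cmod_mult; lra.
  - intros eps He. pose proof (Cmod_ge_0 c) as Hc.
    destruct (H (eps / (Cmod c + 1))%R) as (L & HL).
    { apply Rdiv_lt_0_compat; lra. }
    exists L. intros M NM IM. specialize (HL M NM IM). rewrite lsum_scal.
    replace (c * lsum f M - c * S) with (c * (lsum f M - S)) by ring.
    rewrite Cmod_mult. apply (Rle_lt_trans _ ((Cmod c) * (eps / (Cmod c + 1)))%R).
    + apply Rmult_le_compat_l; lra.
    + apply (Rlt_le_trans _ ((Cmod c + 1) * (eps / (Cmod c + 1)))%R).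
      * apply Rmult_lt_compat_r; [apply Rdiv_lt_0_compat|]; lra.
      * right; field; lra.
Qed.

Lemma sums_opp {T} (f : T -> C) S : sums f S -> sums (fun t => - f t) (- S).
Proof.
  intros H. replace (- S) with (- (1) * S) by ring.
  eapply sums_ext; [|apply (sums_scal (- (1)) f S H)]. intros; simpl; ring.
Qed.

Lemma sums_minus {T} (f g : T -> C) S S' :
  sums f S -> sums g S' -> sums (fun t => f t - g t) (S - S').
Proof. intros H H'. apply sums_plus; [|apply sums_opp]; auto. Qed.

Lemma sums_reindex {T U} (h : U -> T) (k : T -> U) (f : T -> C) S :
  (forall u, k (h u) = u) -> (forall t, h (k t) = t) ->
  sums f S -> sums (fun u => f (h u)) S.
Proof.
  intros Hkh Hhk [A H].
  assert (Ih : forall u v, h u = h v -> u = v)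
    by (intros u v E; rewrite <- (Hkh u), E; auto).
  split.
  - apply (bounded_sums_inj h (fun t => Cmod (f t))); auto.
  - intros eps He. destruct (H eps He) as (L & HL). exists (map k L).
    intros M NM IM. rewrite <- (lsum_map h f). apply HL.
    + apply FinFun.Injective_map_NoDup; auto.
    + intros x Hx. rewrite <- (Hhk x). apply in_map, IM, in_map; auto.
Qed.

Lemma uncond_nonneg {T} (g : T -> R) :
  (forall t, 0 <= g t)%R -> bounded_sums g -> exists S : R, uncond (fun t => RtoC (g t)) S.
Proof.
  intros Hg (M & HM).
  destruct (completeness (fun x => exists L, NoDup L /\ x = rsum g L)) as (S & HS1 & HS2).
  - exists M. intros x (L & HL & ->); auto.
  - exists 0%R, nil; split; [constructor|auto].
  - exists S. intros eps He.
    assert (E : exists L, NoDup L /\ (S - eps < rsum g L)%R).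
    { apply NNPP; intros N. assert (S <= S - eps)%R; [|lra].
      apply HS2. intros x (L & HL & ->). apply Rnot_lt_le; intros Hl.
      apply N; exists L; auto. }
    destruct E as (L & NL & HL). exists L. intros L' NL' IL.
    assert (EQ : lsum (fun t => RtoC (g t)) L' = RtoC (rsum g L')).
    { clear. induction L' as [|t L' IH]; simpl; auto. rewrite IH, RtoC_plus; auto. }
    rewrite EQ, <- RtoC_minus, Cmod_R.
    assert (rsum g L' <= S)%R by (apply HS1; exists L'; auto).
    assert (rsum g L <= rsum g L')%R by (apply rsum_incl; auto).
    apply Rabs_def1; lra.
Qed.

(** Real and imaginary parts are dominated by |f|. A real family g dominated by |f| is the
    difference of the nonnegative families g + |f| and |f|, whose bounded finite sums converge to
    their supremum. *)
Lemma sums_exists {T} (f : T -> C) : abs_summable f -> exists S, sums f S.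
Proof.
  intros A.
  assert (B : forall g : T -> R, (forall t, Rabs (g t) <= Cmod (f t))%R ->
              exists S, sums (fun t => RtoC (g t)) S).
  { intros g Hg.
    assert (A1 : bounded_sums (fun t => g t + Cmod (f t))%R).
    { eapply bounded_sums_le; [|apply (bounded_sums_scal 2 _ ltac:(lra) A)].
      intros t; specialize (Hg t). apply Rabs_le_between in Hg. simpl; lra. }
    destruct (uncond_nonneg (fun t => g t + Cmod (f t))%R) as (S1 & H1); auto.
    { intros t; specialize (Hg t). apply Rabs_le_between in Hg. lra. }
    destruct (uncond_nonneg (fun t => Cmod (f t))) as (S2 & H2); auto.
    { intros; apply Cmod_ge_0. }
    exists (S1 - S2).
    assert (Hs1 : sums (fun t => RtoC (g t + Cmod (f t))) S1).
    { split; auto. eapply bounded_sums_le; [|exact A1].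
      intros t; simpl; rewrite Cmod_R, Rabs_pos_eq; [lra|].
      specialize (Hg t). apply Rabs_le_between in Hg. lra. }
    assert (Hs2 : sums (fun t => RtoC (Cmod (f t))) S2).
    { split; auto. eapply bounded_sums_le; [|exact A].
      intros t; simpl; rewrite Cmod_R, Rabs_pos_eq; [lra|apply Cmod_ge_0]. }
    eapply sums_ext; [|apply (sums_minus _ _ _ _ Hs1 Hs2)].
    intros t; simpl. rewrite RtoC_plus; ring. }
  destruct (B (fun t => Re (f t))) as (S1 & H1).
  { intros; apply re_le_Cmod. }
  destruct (B (fun t => Im (f t))) as (S2 & H2).
  { intros t. eapply Rle_trans; [|apply Rmax_Cmod]. apply Rmax_r. }
  exists (S1 + Ci * S2).
  eapply sums_ext; [|apply (sums_plus _ _ _ _ H1 (sums_scal Ci _ _ H2))].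
  intros t; simpl. destruct (f t) as [x y]; simpl. unfold Cplus, Cmult, Ci, RtoC; simpl.
  f_equal; ring.
Qed.

Lemma sums_single {T} (t0 : T) (f : T -> C) :
  (forall t, t <> t0 -> f t = 0) -> sums f (f t0).
Proof.
  intros H.
  assert (B : forall L, NoDup L -> (~ In t0 L -> lsum f L = 0 /\ rsum (fun t => Cmod (f t)) L = 0%R)
      /\ (In t0 L -> lsum f L = f t0 /\ rsum (fun t => Cmod (f t)) L = Cmod (f t0))).
  { intros L HL; induction HL as [|t L Hn HL [IH1 IH2]]; simpl; [tauto|]. split.
    - intros N. rewrite (H t) by (intros ->; tauto).
      destruct IH1 as [-> ->]; [tauto|]. rewrite Cmod_0. split; [ring|lra].
    - intros [->|Hi].
      + destruct IH1 as [-> ->]; auto. split; [ring|lra].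
      + rewrite (H t) by (intros ->; tauto). destruct IH2 as [-> ->]; [tauto|].
        rewrite Cmod_0. split; [ring|lra]. }
  split.
  - exists (Cmod (f t0)). intros L HL. destruct (B L HL) as [B1 B2].
    destruct (classic (In t0 L)) as [i|i].
    + destruct (B2 i) as [_ ->]; lra.
    + destruct (B1 i) as [_ ->]. apply Cmod_ge_0.
  - intros eps He. exists (t0 :: nil). intros L HL Hi.
    destruct (B L HL) as [_ B2]. destruct B2 as [-> _]; [apply Hi; left; auto|].
    replace (f t0 - f t0) with (RtoC 0) by ring. rewrite Cmod_0; auto.
Qed.

Lemma sums_delta (a : Z) (c : C) : sums (fun n => if Z.eq_dec n a then c else 0) c.
Proof.
  eapply sums_eq; [apply (sums_single a)|].
  - intros t Ht. destruct (Z.eq_dec t a); [contradiction|reflexivity].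
  - destruct (Z.eq_dec a a); [reflexivity|contradiction].
Qed.

Lemma sums_zero {T} (f : T -> C) : (forall t, f t = 0) -> sums f 0.
Proof.
  intros H. split.
  - exists 0%R. intros L _. induction L as [|t L IH]; simpl; [lra|].
    rewrite H, Cmod_0; lra.
  - intros eps He; exists nil. intros L _ _.
    assert (E : lsum f L = 0).
    { induction L as [|t L IH]; simpl; [ring|]. rewrite H, IH. ring. }
    rewrite E. replace (0 - 0) with (RtoC 0) by ring. rewrite Cmod_0; auto.
Qed.

(** Reindexing along an injection whose range contains the support: a finite set of indices may
    stick out of the range of [h], but only at zeros of [f]. *)
Lemma sums_support {T U} (h : U -> T) (k : T -> U) (f : T -> C) S :
  (forall u, k (h u) = u) -> (forall t, f t = 0 \/ h (k t) = t) ->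
  sums f S -> sums (fun u => f (h u)) S.
Proof.
  intros Hkh Hf [A H].
  assert (Ih : forall u v, h u = h v -> u = v)
    by (intros u v E; rewrite <- (Hkh u), E; auto).
  split; [apply (bounded_sums_inj h (fun t => Cmod (f t))); auto|].
  intros eps He. destruct (H eps He) as (L & HL). exists (map k L).
  intros M NM IM. rewrite <- (lsum_map h f).
  set (L1 := nodup eqdec (map h M ++ L)).
  assert (N1 : NoDup L1) by apply NoDup_nodup.
  assert (NhM : NoDup (map h M)) by (apply FinFun.Injective_map_NoDup; auto).
  destruct (incl_perm (map h M) L1) as (D & ND & P & HD); auto.
  { intros x Hx. apply nodup_In, in_or_app; auto. }
  replace (lsum f (map h M)) with (lsum f L1).
  - apply HL; auto. intros x Hx. apply nodup_In, in_or_app; auto.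
  - rewrite (lsum_perm f _ _ P), lsum_app.
    assert (E : lsum f D = 0); [|rewrite E; ring].
    assert (HD0 : forall x, In x D -> f x = 0).
    { intros x Hx. assert (Hx1 : In x L1).
      { eapply Permutation_in; [symmetry; exact P|]. apply in_or_app; auto. }
      apply nodup_In, in_app_or in Hx1. destruct Hx1 as [Hx1|Hx1].
      - destruct (HD x Hx Hx1).
      - destruct (Hf x) as [|E]; auto. destruct (HD x Hx). rewrite <- E.
        apply in_map, IM, in_map; auto. }
    clear - HD0. induction D as [|x D IH]; simpl; auto.
    rewrite HD0 by (left; auto). rewrite IH; [ring|].
    intros y Hy; apply HD0; right; auto.
Qed.

(** Compare with a finite rectangle [L'] times [M']. Choosing [M'] after [L'] allows it both to
    contain the second coordinates of [L] and to make each of the finitely many rows accurate. *)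
Lemma uncond_iterated {T U} (f : T * U -> C) (g : T -> C) S :
  uncond f S -> (forall t, uncond (fun u => f (t, u)) (g t)) -> uncond g S.
Proof.
  intros H Hr eps He. destruct (H (eps / 2)%R) as (L & HL); [lra|].
  exists (map fst L). intros L' NL' IL'.
  set (N := INR (length L')).
  assert (HN : (0 <= N)%R) by apply pos_INR.
  (* Each of the N rows may err by [d], which adds up to less than eps/2; N + 1 keeps the
     denominator nonzero. *)
  set (d := (eps / (2 * (N + 1)))%R).
  assert (Hd : (0 < d)%R) by (apply Rdiv_lt_0_compat; lra).
  assert (HM : forall K, exists M, forall t, In t K -> forall M', NoDup M' -> incl M M' ->
            (Cmod (lsum (fun u => f (t, u)) M' - g t) < d)%R).
  { induction K as [|t K (M & HM)]; [exists nil; simpl; tauto|].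
    destruct (Hr t d Hd) as (M1 & HM1). exists (M1 ++ M).
    intros t' [->|Ht'] M' NM' IM'.
    - apply HM1; auto. intros x Hx; apply IM', in_or_app; auto.
    - apply HM; auto. intros x Hx; apply IM', in_or_app; auto. }
  destruct (HM L') as (M & HM'). destruct (nodup_cover (M ++ map snd L)) as (M' & NM' & IM').
  assert (E1 : (Cmod (lsum f (list_prod L' M') - S) < eps / 2)%R).
  { apply HL; [apply NoDup_list_prod; auto|]. intros [t u] Htu. apply in_prod.
    - apply IL'. change t with (fst (t, u)). apply in_map; auto.
    - apply IM', in_or_app; right. change u with (snd (t, u)). apply in_map; auto. }
  assert (E2 : (Cmod (lsum g L' - lsum f (list_prod L' M')) <= N * d)%R).
  { rewrite lsum_prod. unfold N. clearbody d.
    assert (HK : forall t, In t L' -> (Cmod (lsum (fun u => f (t, u)) M' - g t) < d)%R).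
    { intros t Ht. apply HM'; auto. intros x Hx; apply IM', in_or_app; auto. }
    clear - HK. induction L' as [|t K IH].
    - simpl. replace (0 - 0) with (RtoC 0) by ring. rewrite Cmod_0; lra.
    - change (lsum g (t :: K)) with (g t + lsum g K).
      change (lsum (fun t => lsum (fun u => f (t, u)) M') (t :: K)) with
        (lsum (fun u => f (t, u)) M' + lsum (fun t => lsum (fun u => f (t, u)) M') K).
      change (length (t :: K)) with (S (length K)). rewrite S_INR.
      match goal with |- (Cmod ?x <= _)%R => replace x with
        (- (lsum (fun u => f (t, u)) M' - g t) +
         (lsum g K - lsum (fun t => lsum (fun u => f (t, u)) M') K)) by ring end.
      eapply Rle_trans; [apply Cmod_triangle|]. rewrite Cmod_opp.
      assert (A := HK t (or_introl eq_refl)).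
      assert (B := IH (fun t h => HK t (or_intror h))). lra. }
  replace (lsum g L' - S) with
    ((lsum g L' - lsum f (list_prod L' M')) + (lsum f (list_prod L' M') - S)) by ring.
  eapply Rle_lt_trans; [apply Cmod_triangle|].
  assert (N * d < eps / 2)%R; [|lra]. unfold d.
  replace (N * (eps / (2 * (N + 1))))%R with ((eps / 2) * (N / (N + 1)))%R by (field; lra).
  rewrite <- (Rmult_1_r (eps / 2)) at 2. apply Rmult_lt_compat_l; [lra|].
  apply Rmult_lt_reg_r with (N + 1)%R; [lra|]. field_simplify; lra.
Qed.

Lemma sums_tail {T} (f : T -> C) (B : T -> R) S L d :
  sums f S -> NoDup L -> (forall t, Cmod (f t) <= B t)%R ->
  (forall L', NoDup L' -> incl L L' -> rsum B L' <= rsum B L + d)%R ->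
  (Cmod (S - lsum f L) <= d)%R.
Proof.
  intros [_ H] NL HB HL. apply le_epsilon. intros eps He.
  destruct (H eps He) as (M & HM). destruct (nodup_cover (M ++ L)) as (M' & NM' & IM').
  assert (IL : incl L M') by (intros x Hx; apply IM', in_or_app; auto).
  assert (IM : incl M M') by (intros x Hx; apply IM', in_or_app; auto).
  assert (A := HM M' NM' IM). assert (A' := HL M' NM' IL).
  destruct (incl_perm L M') as (D & ND & P & _); auto.
  rewrite (lsum_perm f _ _ P), lsum_app in A. rewrite (rsum_perm B _ _ P), rsum_app in A'.
  replace (S - lsum f L) with (- (lsum f L + lsum f D - S) + lsum f D) by ring.
  eapply Rle_trans; [apply Cmod_triangle|]. rewrite Cmod_opp.
  assert (Cmod (lsum f D) <= rsum B D)%R; [|lra].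
  eapply Rle_trans; [apply Cmod_lsum|]. apply rsum_le; auto.
Qed.

Lemma sums_bound {T} (f : T -> C) (B : T -> R) (M : R) S :
  sums f S -> (forall t, Cmod (f t) <= B t)%R ->
  (forall L, NoDup L -> rsum B L <= M)%R -> (Cmod S <= M)%R.
Proof.
  intros H HB HM. replace S with (S - lsum f nil) by (simpl; ring).
  apply (sums_tail f B); auto; [constructor|]. intros L' N _. simpl. rewrite Rplus_0_l; auto.
Qed.

Lemma bounded_sums_tail {T} (B : T -> R) d :
  (0 < d)%R -> bounded_sums B ->
  exists L, NoDup L /\ forall L', NoDup L' -> (rsum B L' <= rsum B L + d)%R.
Proof.
  intros Hd (M & HM).
  destruct (completeness (fun x => exists L, NoDup L /\ x = rsum B L)) as (S & HS1 & HS2).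
  - exists M. intros x (L & HL & ->); auto.
  - exists 0%R, nil; split; [constructor|auto].
  - assert (E : exists L, NoDup L /\ (S - d < rsum B L)%R).
    { apply NNPP; intros N. assert (S <= S - d)%R; [|lra].
      apply HS2. intros x (L & HL & ->). apply Rnot_lt_le; intros Hl.
      apply N; exists L; auto. }
    destruct E as (L & NL & HL). exists L; split; auto. intros L' NL'.
    assert (rsum B L' <= S)%R by (apply HS1; exists L'; auto). lra.
Qed.

Lemma sums_iterated {T U} (f : T * U -> C) (g : T -> C) S :
  sums f S -> (forall t, sums (fun u => f (t, u)) (g t)) -> sums g S.
Proof.
  intros [A H] Hr. split; [|apply (uncond_iterated f); auto; intros; apply Hr].
  destruct A as (M & HM). exists M. intros L HL.
  apply le_epsilon. intros eps He.
  set (N := INR (length L)). assert (HN : (0 <= N)%R) by apply pos_INR.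
  assert (HK : forall K, exists J, forall t, In t K -> forall M', NoDup M' -> incl J M' ->
            (Cmod (g t) <= rsum (fun u => Cmod (f (t, u))) M' + eps / (N + 1))%R).
  { induction K as [|t K0 (J & HJ)]; [exists nil; simpl; tauto|].
    destruct (Hr t) as [_ Ht]. destruct (Ht (eps / (N + 1))%R) as (J1 & HJ1).
    { apply Rdiv_lt_0_compat; lra. }
    exists (J1 ++ J). intros t' [->|Ht'] M' NM' IM'.
    - assert (X := HJ1 M' NM' (fun x h => IM' x (in_or_app _ _ _ (or_introl h)))).
      replace (g t') with (lsum (fun u => f (t', u)) M' + - (lsum (fun u => f (t', u)) M' - g t')) by ring.
      eapply Rle_trans; [apply Cmod_triangle|]. rewrite Cmod_opp.
      pose proof (Cmod_lsum (fun u => f (t', u)) M'). lra.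
    - apply HJ; auto. intros x Hx; apply IM', in_or_app; auto. }
  destruct (HK L) as (J & HJ). destruct (nodup_cover J) as (M' & NM' & IM').
  specialize (HM (list_prod L M') (NoDup_list_prod _ _ HL NM')).
  assert (E : (rsum (fun t => Cmod (g t)) L <=
               rsum (fun p => Cmod (f p)) (list_prod L M') + N * (eps / (N + 1)))%R).
  { assert (HJ' := fun t h => HJ t h M' NM' IM'). unfold N at 1.
    set (d := (eps / (N + 1))%R) in *. clearbody d. clear - HJ'.
    induction L as [|t L0 IH]; [simpl; lra|].
    change (length (t :: L0)) with (S (length L0)). rewrite S_INR. simpl.
    rewrite rsum_app, rsum_map.
    assert (A := HJ' t (or_introl eq_refl)).
    assert (B := IH (fun t h => HJ' t (or_intror h))). lra. }
  assert (N * (eps / (N + 1)) <= eps)%R; [|lra].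
  apply Rmult_le_reg_r with (N + 1)%R; [lra|]. field_simplify; nra.
Qed.

(** Fubini in the form used throughout: evaluating a double family by rows and by columns yields two
    expressions for one number. *)
Lemma sums_exchange {T U} (f : T * U -> C) (g : T -> C) (h : U -> C) :
  abs_summable f ->
  (forall t, sums (fun u => f (t, u)) (g t)) ->
  (forall u, sums (fun t => f (t, u)) (h u)) ->
  exists S, sums g S /\ sums h S.
Proof.
  intros A Hg Hh. destruct (sums_exists f A) as (S & HS). exists S; split.
  - apply (sums_iterated f); auto.
  - apply (sums_iterated (fun p => f (snd p, fst p))); auto.
    apply (sums_reindex (fun p => (snd p, fst p)) (fun p => (snd p, fst p)) f); auto;
    intros []; auto.
Qed.

(** * Sequential limits and dominated convergence *)

Definition Clim (u : nat -> C) (l : C) : Prop :=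
  forall eps : R, (0 < eps)%R -> exists N, forall n, (N <= n)%nat -> (Cmod (u n - l) < eps)%R.

Lemma lsum_Clim {T} (f : nat -> T -> C) (g : T -> C) L :
  (forall t, Clim (fun n => f n t) (g t)) -> Clim (fun n => lsum (f n) L) (lsum g L).
Proof.
  intros H; induction L as [|t L IH]; simpl; intros eps He.
  - exists O. intros. replace (0 - 0) with (RtoC 0) by ring. rewrite Cmod_0; auto.
  - destruct (IH (eps / 2)%R) as (N & HN); [lra|].
    destruct (H t (eps / 2)%R) as (N' & HN'); [lra|].
    exists (max N N'). intros n Hn.
    replace (f n t + lsum (f n) L - (g t + lsum g L)) with
      ((f n t - g t) + (lsum (f n) L - lsum g L)) by ring.
    eapply Rle_lt_trans; [apply Cmod_triangle|].
    assert (Cmod (f n t - g t) < eps / 2)%R by (apply HN'; lia).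
    assert (Cmod (lsum (f n) L - lsum g L) < eps / 2)%R by (apply HN; lia). lra.
Qed.

Lemma Clim_bound u l M : Clim u l -> (forall n, Cmod (u n) <= M)%R -> (Cmod l <= M)%R.
Proof.
  intros H HM. apply le_epsilon. intros eps He. destruct (H eps He) as (N & HN).
  specialize (HN N (le_n N)). specialize (HM N).
  replace l with (u N + - (u N - l)) by ring.
  eapply Rle_trans; [apply Cmod_triangle|]. rewrite Cmod_opp. lra.
Qed.

(** Tannery's theorem. It carries the finite triple product and the finite partial fractions to
    their limits, evaluates the limiting Durfee sum, and isolates a Laurent coefficient at the
    end. *)
Lemma sums_dominated {T} (f : nat -> T -> C) (S : nat -> C) (g : T -> C) (B : T -> R) :
  (forall n, sums (f n) (S n)) -> (forall n t, Cmod (f n t) <= B t)%R -> bounded_sums B ->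
  (forall t, Clim (fun n => f n t) (g t)) ->
  exists S', sums g S' /\ Clim S S'.
Proof.
  intros Hs HB AB Hl.
  assert (Hg : forall t, (Cmod (g t) <= B t)%R)
    by (intros t; apply (Clim_bound _ _ _ (Hl t)); auto).
  destruct (sums_exists g) as (S' & HS').
  { eapply bounded_sums_le; [exact Hg|exact AB]. }
  exists S'; split; auto. intros eps He.
  destruct (bounded_sums_tail B (eps / 3)%R) as (L & NL & HL); [lra|auto|].
  destruct (lsum_Clim f g L Hl (eps / 3)%R) as (N & HN); [lra|].
  exists N. intros n Hn. specialize (HN n Hn).
  assert (A := sums_tail g B S' L _ HS' NL Hg (fun L' h _ => HL L' h)).
  assert (A' := sums_tail (f n) B (S n) L _ (Hs n) NL (HB n) (fun L' h _ => HL L' h)).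
  replace (S n - S') with ((S n - lsum (f n) L) + ((lsum (f n) L - lsum g L) + - (S' - lsum g L))) by ring.
  eapply Rle_lt_trans; [apply Cmod_triangle|].
  assert (B1 := Cmod_triangle (lsum (f n) L - lsum g L) (- (S' - lsum g L))).
  rewrite Cmod_opp in B1. lra.
Qed.

Lemma Clim_unique u l l' : Clim u l -> Clim u l' -> l = l'.
Proof.
  intros H H'. apply NNPP; intros E.
  assert (P : (0 < Cmod (l - l') / 2)%R).
  { assert (0 < Cmod (l - l'))%R; [|lra]. apply Cmod_gt_0. intros Z; apply E.
    replace l with (l - l' + l') by ring. rewrite Z; ring. }
  destruct (H _ P) as (N & HN). destruct (H' _ P) as (N' & HN').
  specialize (HN (max N N') ltac:(lia)). specialize (HN' (max N N') ltac:(lia)).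
  set (x := u (max N N')) in *.
  assert (Cmod (l - l') <= Cmod (x - l') + Cmod (x - l))%R; [|lra].
  replace (l - l') with ((x - l') + - (x - l)) by ring.
  eapply Rle_trans; [apply Cmod_triangle|]. rewrite Cmod_opp; lra.
Qed.

Lemma Clim_const c : Clim (fun _ => c) c.
Proof.
  intros eps He; exists O; intros. replace (c - c) with (RtoC 0) by ring. rewrite Cmod_0; auto.
Qed.

Lemma Clim_ext u v l : (forall n, u n = v n) -> Clim u l -> Clim v l.
Proof. intros E H. replace v with u; auto. apply functional_extensionality; auto. Qed.

Lemma Clim_mult u v l l' : Clim u l -> Clim v l' -> Clim (fun n => u n * v n) (l * l').
Proof.
  intros H H' eps He.
  pose proof (Cmod_ge_0 l) as P. pose proof (Cmod_ge_0 l') as P'.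
  set (d := Rmin 1 (eps / (Cmod l + Cmod l' + 2))%R).
  assert (Hd : (0 < d)%R).
  { apply Rmin_glb_lt; [lra|]. apply Rdiv_lt_0_compat; lra. }
  assert (Hd1 : (d <= 1)%R) by apply Rmin_l.
  assert (Hd2 : (d * (Cmod l + Cmod l' + 2) <= eps)%R).
  { apply Rle_trans with (eps / (Cmod l + Cmod l' + 2) * (Cmod l + Cmod l' + 2))%R.
    - apply Rmult_le_compat_r; [lra|apply Rmin_r].
    - right; field; lra. }
  destruct (H d Hd) as (N & HN). destruct (H' d Hd) as (N' & HN').
  exists (max N N'). intros n Hn. specialize (HN n ltac:(lia)). specialize (HN' n ltac:(lia)).
  replace (u n * v n - l * l') with ((u n - l) * (v n - l') + ((u n - l) * l' + l * (v n - l'))) by ring.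
  eapply Rle_lt_trans; [apply Cmod_triangle|].
  eapply Rle_lt_trans; [apply Rplus_le_compat_l, Cmod_triangle|].
  rewrite !Cmod_mult.
  pose proof (Cmod_ge_0 (u n - l)). pose proof (Cmod_ge_0 (v n - l')). nra.
Qed.

Lemma Clim_subseq u l (k : nat -> nat) :
  (forall n, (n <= k n)%nat) -> Clim u l -> Clim (fun n => u (k n)) l.
Proof.
  intros Hk H eps He. destruct (H eps He) as (N & HN). exists N. intros n Hn.
  apply HN. specialize (Hk n). lia.
Qed.

Lemma Clim_Clim_seq u l : Clim u l -> Clim_seq u = l.
Proof.
  intros H. unfold Clim_seq.
  assert (E : forall p : C -> R, (forall x y : C, p (x - y)%C = p x - p y)%R ->
     (forall x, Rabs (p x) <= Cmod x)%R -> real (Lim_seq (fun n => p (u n))) = p l).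
  { intros p Hp Hb. rewrite (is_lim_seq_unique _ (Finite (p l))); auto.
    apply is_lim_seq_spec. intros eps. destruct (H eps (cond_pos eps)) as (N & HN).
    exists N. intros n Hn. specialize (HN n Hn). simpl. rewrite <- Hp.
    eapply Rle_lt_trans; [apply Hb|auto]. }
  rewrite (E Re), (E Im).
  - destruct l; reflexivity.
  - intros [] []; reflexivity.
  - intros x. eapply Rle_trans; [|apply Rmax_Cmod]. apply Rmax_r.
  - intros [] []; reflexivity.
  - apply re_le_Cmod.
Qed.

(** * Unordered sums and ordered series *)

Lemma sum_n_lsum (f : nat -> C) n : sum_n f n = lsum f (seq 0 (S n)).
Proof.
  induction n as [|n IH].
  - rewrite sum_O. simpl. ring.
  - rewrite sum_Sn, IH. rewrite (seq_S (S n)), lsum_app. simpl.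
    change plus with Cplus. ring.
Qed.

Lemma sums_Clim (f : nat -> C) S : sums f S -> Clim (sum_n f) S.
Proof.
  intros [_ H] eps He. destruct (H eps He) as (L & HL).
  exists (list_max L). intros n Hn. rewrite sum_n_lsum. apply HL; [apply seq_NoDup|].
  intros x Hx. apply in_seq. assert (x <= list_max L)%nat; [|lia].
  assert (F := proj1 (list_max_le L (list_max L)) (le_n _)).
  rewrite Forall_forall in F; auto.
Qed.

Lemma sums_CSeries (f : nat -> C) S : sums f S -> CSeries f = S.
Proof. intros H. apply Clim_Clim_seq, sums_Clim; auto. Qed.

Lemma Clim_filterlim u l : Clim u l -> filterlim u eventually (locally l).
Proof.
  intros H. apply (filterlim_locally (U := C_NormedModule) u l). intros eps.
  destruct (H eps (cond_pos eps)) as (N & HN). exists N. intros n Hn.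
  apply C_NormedModule_mixin_compat1. apply HN; auto.
Qed.

Lemma sums_is_series (f : nat -> C) S : sums f S -> is_series f S.
Proof. intros H. apply Clim_filterlim, sums_Clim; auto. Qed.

Lemma sums_ZtoN (f : Z -> C) S :
  sums f S -> (forall k, (k < 0)%Z -> f k = 0) -> sums (fun n : nat => f (Z.of_nat n)) S.
Proof.
  intros H H0. apply (sums_support Z.of_nat Z.to_nat); auto; intros.
  - lia.
  - destruct (Z_lt_dec t 0); [left; auto|right; lia].
Qed.

Lemma sums_halves (f : Z -> C) S : sums f S ->
  exists S1 S2 : C, sums (fun n : nat => f (Z.of_nat n)) S1 /\ sums (fun n : nat => f (- Z.of_nat n - 1)%Z) S2 /\ S = S1 + S2.
Proof.
  intros H. destruct H as [A H].
  set (g1 := fun k => if Z_lt_dec k 0 then RtoC 0 else f k).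
  set (g2 := fun k => if Z_lt_dec k 0 then f k else RtoC 0).
  destruct (sums_exists g1) as (S1 & H1).
  { eapply bounded_sums_le; [|exact A]. intros k; unfold g1.
    destruct (Z_lt_dec k 0); [rewrite Cmod_0; apply Cmod_ge_0|simpl; lra]. }
  destruct (sums_exists g2) as (S2 & H2).
  { eapply bounded_sums_le; [|exact A]. intros k; unfold g2.
    destruct (Z_lt_dec k 0); [simpl; lra|rewrite Cmod_0; apply Cmod_ge_0]. }
  exists S1, S2. split; [|split].
  - eapply sums_ext; [|apply (sums_ZtoN g1 S1 H1)].
    + intros n; unfold g1; simpl. destruct (Z_lt_dec (Z.of_nat n) 0); [lia|auto].
    + intros k Hk; unfold g1; destruct (Z_lt_dec k 0); [auto|lia].
  - eapply sums_ext; [|apply (sums_support (fun n => (- Z.of_nat n - 1)%Z)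
       (fun k => Z.to_nat (- k - 1)) g2 S2); auto].
    + intros n; unfold g2; simpl. destruct (Z_lt_dec _ 0); [auto|lia].
    + intros; lia.
    + intros t; unfold g2; destruct (Z_lt_dec t 0); [right; lia|auto].
  - apply (uncond_unique f); auto.
    apply (sums_ext (fun k => g1 k + g2 k)); [|apply sums_plus; auto].
    intros k; unfold g1, g2; destruct (Z_lt_dec k 0); ring.
Qed.

Lemma sums_ZSeries (f : Z -> C) S : sums f S -> ZSeries f = S.
Proof.
  intros H. destruct (sums_halves f S H) as (S1 & S2 & H1 & H2 & ->).
  unfold ZSeries. rewrite (sums_CSeries _ _ H1), (sums_CSeries _ _ H2). reflexivity.
Qed.

Lemma sums_is_Zseries (f : Z -> C) S : sums f S -> is_Zseries f S.
Proof.
  intros H. destruct (sums_halves f S H) as (S1 & S2 & H1 & H2 & ->).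
  exists S1, S2; auto using sums_is_series.
Qed.

Lemma is_series_Clim (f : nat -> C) (l : C) : is_series f l -> Clim (sum_n f) l.
Proof.
  intros H eps He.
  destruct (H (fun y : C => (Cmod (y - l) < eps)%R)) as (N & HN).
  (* Halving eps absorbs the factor sqrt 2 between the componentwise balls of C and the balls of
     [Cmod]. *)
  - assert (He2 : (0 < eps / 2)%R) by lra. exists (mkposreal _ He2). intros y Hy.
    apply C_NormedModule_mixin_compat2 in Hy. simpl in Hy.
    eapply Rlt_trans; [exact Hy|].
    assert (sqrt 2 < 2)%R; [|nra].
    rewrite <- (sqrt_pow2 2) at 2 by lra. apply sqrt_lt_1; lra.
  - exists N. exact HN.
Qed.

Lemma is_Zseries_sums (f : Z -> C) S :
  abs_summable f -> is_Zseries f S -> sums f S.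
Proof.
  intros A (l1 & l2 & H1 & H2 & ->). destruct (sums_exists f A) as (S & HS).
  destruct (sums_halves f S HS) as (S1 & S2 & K1 & K2 & ->).
  rewrite <- (Clim_unique _ _ _ (sums_Clim _ _ K1) (is_series_Clim _ _ H1)).
  rewrite <- (Clim_unique _ _ _ (sums_Clim _ _ K2) (is_series_Clim _ _ H2)).
  exact HS.
Qed.

(** * Integer powers and geometric domination *)

Lemma Czpow_succ (x : C) (n : Z) : x <> 0 -> Czpow x (n + 1) = Czpow x n * x.
Proof.
  intros Hx. destruct n as [|p|p].
  - simpl. ring.
  - change (Z.pos p + 1)%Z with (Z.pos (p + 1)). simpl. rewrite Pos2Nat.inj_add, Cpow_add_r.
    simpl. ring.
  - destruct (Pos.eq_dec p 1) as [->|N].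
    + simpl. field; auto.
    + replace (Z.neg p + 1)%Z with (Z.neg (p - 1)) by lia.
      simpl. replace (Pos.to_nat p) with (S (Pos.to_nat (p - 1))) by lia.
      simpl. field; split; auto. apply Cpow_nz; auto.
Qed.

Lemma Czpow_nz (x : C) n : x <> 0 -> Czpow x n <> 0.
Proof.
  intros Hx. destruct n; simpl.
  - intros E; inversion E; lra.
  - apply Cpow_nz; auto.
  - intros E. assert (F : x ^ Pos.to_nat p * / x ^ Pos.to_nat p = 0) by (rewrite E; ring).
    rewrite Cinv_r in F by (apply Cpow_nz; auto). inversion F; lra.
Qed.

Lemma Czpow_add (x : C) (m n : Z) : x <> 0 -> Czpow x (m + n) = Czpow x m * Czpow x n.
Proof.
  intros Hx. revert n. apply Z.peano_ind.
  - rewrite Z.add_0_r. simpl; ring.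
  - intros n IH. replace (m + Z.succ n)%Z with (m + n + 1)%Z by lia.
    unfold Z.succ. rewrite !Czpow_succ, IH by auto. ring.
  - intros n IH. assert (E := Czpow_succ x (m + Z.pred n) Hx).
    replace (m + Z.pred n + 1)%Z with (m + n)%Z in E by lia.
    assert (F := Czpow_succ x (Z.pred n) Hx).
    replace (Z.pred n + 1)%Z with n in F by lia. rewrite F in IH. rewrite IH in E.
    assert (G : Czpow x (m + Z.pred n) * x * / x = Czpow x m * (Czpow x (Z.pred n) * x) * / x)
      by (rewrite E; auto).
    rewrite <- !Cmult_assoc, Cinv_r, !Cmult_1_r in G; auto.
Qed.

Lemma Czpow_opp (x : C) n : x <> 0 -> Czpow x (- n) = / Czpow x n.
Proof.
  intros Hx. assert (E := Czpow_add x n (- n) Hx). rewrite Z.add_opp_diag_r in E. simpl in E.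
  assert (N := Czpow_nz x n Hx).
  replace (Czpow x (- n)) with (Czpow x n * Czpow x (- n) * / Czpow x n) by (field; auto).
  rewrite <- E. field; auto.
Qed.

Lemma Czpow_0 x : Czpow x 0 = 1.
Proof. reflexivity. Qed.

Lemma Czpow_1 x : Czpow x 1 = x.
Proof. simpl. ring. Qed.

Lemma Czpow_nat x n : Czpow x (Z.of_nat n) = x ^ n.
Proof. destruct n; auto. simpl. rewrite SuccNat2Pos.id_succ. auto. Qed.

Lemma Czpow_base_mul (x y : C) n : x <> 0 -> y <> 0 -> Czpow (x * y) n = Czpow x n * Czpow y n.
Proof.
  intros Hx Hy. destruct n; simpl; [ring|apply Cpow_mult_l|].
  rewrite Cpow_mult_l. field; split; apply Cpow_nz; auto.
Qed.

Lemma Czpow_mult (x : C) m n : x <> 0 -> Czpow (Czpow x m) n = Czpow x (m * n).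
Proof.
  intros Hx. revert n. apply Z.peano_ind.
  - rewrite Z.mul_0_r; auto.
  - intros n IH. unfold Z.succ. rewrite Czpow_succ, IH by (apply Czpow_nz; auto).
    rewrite Z.mul_add_distr_l, Z.mul_1_r, Czpow_add; auto.
  - intros n IH. replace (m * Z.pred n)%Z with (m * n + - m)%Z by lia.
    rewrite Czpow_add, <- IH, Czpow_opp by auto.
    replace n with (Z.pred n + 1)%Z at 2 by lia.
    rewrite Czpow_succ by (apply Czpow_nz; auto).
    field. apply Czpow_nz; auto.
Qed.

Lemma Czpow_pow (x : C) (m : nat) n : x <> 0 -> Czpow (x ^ m) n = Czpow x (Z.of_nat m * n).
Proof. intros Hx. rewrite <- Czpow_nat, Czpow_mult; auto. Qed.

Lemma Czpow_1_l n : Czpow 1 n = 1.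
Proof.
  destruct n; simpl; auto; rewrite Cpow_1_l; auto. field.
Qed.

Definition sgz (n : Z) : C := Czpow (-1) n.

Lemma m1_nz : RtoC (-1) <> 0.
Proof. intros E; inversion E; lra. Qed.

Lemma sgz_succ n : sgz (n + 1) = - sgz n.
Proof. unfold sgz. rewrite Czpow_succ by apply m1_nz. ring. Qed.

Lemma sgz_pred n : sgz (n - 1) = - sgz n.
Proof.
  replace n with (n - 1 + 1)%Z at 2 by lia. rewrite sgz_succ. ring.
Qed.

Lemma sgz_add m n : sgz (m + n) = sgz m * sgz n.
Proof. apply Czpow_add, m1_nz. Qed.

Lemma sgz_sq n : sgz n * sgz n = 1.
Proof.
  unfold sgz. rewrite <- Czpow_base_mul by apply m1_nz.
  replace (-1 * -1) with (RtoC 1) by ring. apply Czpow_1_l.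
Qed.

Lemma sgz_opp n : sgz (- n) = sgz n.
Proof.
  unfold sgz. rewrite Czpow_opp by apply m1_nz. fold (sgz n).
  assert (E := sgz_sq n). assert (N : sgz n <> 0) by (apply Czpow_nz, m1_nz).
  replace (sgz n) with (sgz n * sgz n * / sgz n) at 2 by (field; auto). rewrite E. field; auto.
Qed.

Lemma sgz_double n : sgz (2 * n) = 1.
Proof. replace (2 * n)%Z with (n + n)%Z by lia. rewrite sgz_add. apply sgz_sq. Qed.

Lemma Czpow_neg (x : C) n : x <> 0 -> Czpow (- x) n = sgz n * Czpow x n.
Proof.
  intros Hx. replace (- x) with (-1 * x) by ring. apply Czpow_base_mul; auto. apply m1_nz.
Qed.

Lemma Cmod_Czpow (x : C) n : x <> 0 -> Cmod (Czpow x n) = powerRZ (Cmod x) n.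
Proof.
  intros Hx. destruct n; simpl.
  - apply Cmod_1.
  - apply Cmod_pow.
  - rewrite Cmod_inv, Cmod_pow; auto. apply Cpow_nz; auto.
Qed.

Lemma Cmod_sgz n : Cmod (sgz n) = 1.
Proof.
  unfold sgz. rewrite Cmod_Czpow by apply m1_nz.
  replace (Cmod (-1)) with 1%R; [apply powerRZ_R1|].
  rewrite Cmod_R. rewrite Rabs_left; lra.
Qed.

Definition nome (q : C) : Prop := (0 < Cmod q < 1)%R.

Lemma nome_nz q : nome q -> q <> 0.
Proof. intros H. apply Cmod_gt_0, H. Qed.

Lemma nome_pow q n : nome q -> nome (q ^ S n).
Proof.
  intros [H1 H2]. unfold nome. rewrite Cmod_pow. split; [apply pow_lt; auto|].
  simpl. assert (Cmod q ^ n <= 1)%R.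
  { rewrite <- (pow1 n). apply pow_incr; lra. }
  assert (0 < Cmod q ^ n)%R by (apply pow_lt; auto). nra.
Qed.

Lemma powerRZ_anti (r : R) m n : (0 < r < 1)%R -> (m <= n)%Z -> (powerRZ r n <= powerRZ r m)%R.
Proof.
  intros Hr Hmn. replace n with (m + Z.of_nat (Z.to_nat (n - m)))%Z by lia.
  rewrite powerRZ_add, <- pow_powerRZ by lra.
  assert (0 < powerRZ r m)%R by (apply powerRZ_lt; lra).
  assert (r ^ Z.to_nat (n - m) <= 1)%R.
  { rewrite <- (pow1 (Z.to_nat (n - m))). apply pow_incr; lra. }
  nra.
Qed.

Lemma powerRZ_le1 (r : R) n : (0 < r < 1)%R -> (0 <= n)%Z -> (powerRZ r n <= 1)%R.
Proof. intros Hr Hn. change 1%R with (powerRZ r 0). apply powerRZ_anti; auto. Qed.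

Lemma rsum_geom (r : R) n : (0 < r < 1)%R ->
  (rsum (fun k => r ^ k)%R (seq 0 n) = (1 - r ^ n) / (1 - r))%R.
Proof.
  intros Hr. induction n as [|n IH].
  - simpl. field; lra.
  - rewrite seq_S, rsum_app, IH. simpl. field; lra.
Qed.

Lemma bounded_sums_geom (r : R) : (0 < r < 1)%R ->
  bounded_sums (fun k : Z => powerRZ r (Z.abs k)).
Proof.
  intros Hr. exists (2 / (1 - r))%R. intros L HL.
  set (N := S (list_max (map Z.abs_nat L))).
  set (K := map Z.of_nat (seq 0 N) ++ map (fun n => (- Z.of_nat n - 1)%Z) (seq 0 N)).
  eapply Rle_trans; [apply (rsum_incl _ L K)|]; auto.
  - intros; apply powerRZ_le; lra.
  - apply NoDup_app.
    + apply FinFun.Injective_map_NoDup; [intros x y; lia|apply seq_NoDup].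
    + apply FinFun.Injective_map_NoDup; [intros x y; lia|apply seq_NoDup].
    + intros x H1 H2. apply in_map_iff in H1. apply in_map_iff in H2.
      destruct H1 as (a & <- & _), H2 as (b & E & _). lia.
  - intros x Hx. assert (Hm : (Z.abs_nat x < N)%nat).
    { unfold N. assert (F := proj1 (list_max_le (map Z.abs_nat L) _) (le_n _)).
      rewrite Forall_forall in F. specialize (F _ (in_map Z.abs_nat _ _ Hx)). lia. }
    apply in_or_app. destruct (Z_le_dec 0 x).
    + left. apply in_map_iff. exists (Z.abs_nat x). split; [lia|apply in_seq; lia].
    + right. apply in_map_iff. exists (Z.abs_nat (x + 1)). split; [lia|apply in_seq; lia].
  - unfold K. rewrite rsum_app, !rsum_map.
    assert (G : (rsum (fun k => r ^ k)%R (seq 0 N) <= 1 / (1 - r))%R).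
    { rewrite rsum_geom by auto. apply Rmult_le_compat_r.
      - left; apply Rinv_0_lt_compat; lra.
      - assert (0 < r ^ N)%R by (apply pow_lt; lra). lra. }
    assert (E1 : (rsum (fun u => powerRZ r (Z.abs (Z.of_nat u))) (seq 0 N)
             <= rsum (fun k => r ^ k) (seq 0 N))%R).
    { apply rsum_le; intros k _. rewrite Z.abs_eq, <- pow_powerRZ by lia. lra. }
    assert (E2 : (rsum (fun u => powerRZ r (Z.abs (- Z.of_nat u - 1))) (seq 0 N)
             <= rsum (fun k => r ^ k) (seq 0 N))%R).
    { apply rsum_le; intros k _. rewrite pow_powerRZ. apply powerRZ_anti; auto. lia. }
    assert (2 / (1 - r) = 1 / (1 - r) + 1 / (1 - r))%R by (field; lra). lra.
Qed.

Lemma abs_geom (r M : R) (f : Z -> C) : (0 < r < 1)%R -> (0 <= M)%R ->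
  (forall n, Cmod (f n) <= M * powerRZ r (Z.abs n))%R -> abs_summable f.
Proof.
  intros Hr HM H. eapply bounded_sums_le; [exact H|].
  apply bounded_sums_scal; auto. apply bounded_sums_geom; auto.
Qed.

Lemma powerRZ_shift (r : R) n k : (0 < r < 1)%R ->
  powerRZ r (n - k) = (powerRZ r (- k) * powerRZ r n)%R.
Proof. intros. rewrite <- powerRZ_add by lra. f_equal; lia. Qed.

(** The common majorant of all theta-like series: a positive quadratic exponent is at least |n| - K
    for a suitable constant K. *)
Lemma bounded_sums_quad (r M : R) (K : Z) : (0 < r < 1)%R -> (0 <= M)%R ->
  bounded_sums (fun n => M * powerRZ r (Z.abs n - K))%R.
Proof.
  intros Hr HM.
  apply (bounded_sums_le _ (fun n => (M * powerRZ r (- K)) * powerRZ r (Z.abs n))%R).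
  - intros n. rewrite powerRZ_shift by auto. lra.
  - apply bounded_sums_scal; [|apply bounded_sums_geom; auto].
    apply Rmult_le_pos; auto. apply powerRZ_le, Hr.
Qed.

Lemma abs_quad (q : C) (M : R) (K : Z) (f : Z -> C) : nome q -> (0 <= M)%R ->
  (forall n, Cmod (f n) <= M * powerRZ (Cmod q) (Z.abs n - K))%R -> abs_summable f.
Proof.
  intros Hq HM H. eapply bounded_sums_le; [exact H|apply bounded_sums_quad; auto].
Qed.

Lemma abs_quad2 {T} (q : C) (r M : R) (K : Z) (i : T -> Z) (f : Z * T -> C) :
  nome q -> (0 < r < 1)%R -> (0 <= M)%R -> (forall t u, i t = i u -> t = u) ->
  (forall n t, Cmod (f (n, t)) <=
     M * (powerRZ (Cmod q) (Z.abs n - K) * powerRZ r (Z.abs (i t))))%R ->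
  abs_summable f.
Proof.
  intros Hq Hr HM Hi H. apply (bounded_sums_le _ (fun p => M *
    (1 * powerRZ (Cmod q) (Z.abs (fst p) - K) * powerRZ r (Z.abs (i (snd p)))))%R).
  - intros [n k]; simpl. rewrite Rmult_1_l. apply H.
  - apply bounded_sums_scal; auto.
    apply (bounded_sums_prod (fun t => 1 * powerRZ (Cmod q) (Z.abs t - K))%R
      (fun t => powerRZ r (Z.abs (i t)))).
    + intros; rewrite Rmult_1_l; apply powerRZ_le, Hq.
    + intros; apply powerRZ_le, Hr.
    + apply bounded_sums_quad; auto; lra.
    + apply (bounded_sums_inj i (fun k => powerRZ r (Z.abs k))); auto.
      apply bounded_sums_geom, Hr.
Qed.

(** * Lower bounds for quadratic exponents and distance to the poles *)

Definition tri (n : Z) : Z := (n * (n - 1) / 2)%Z.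

Lemma tri_spec n : (2 * tri n = n * (n - 1))%Z.
Proof.
  unfold tri. symmetry. apply Z_div_exact_full_2; [lia|].
  rewrite Zmod_even, Z.even_mul, Z.even_sub. simpl. destruct (Z.even n); auto.
Qed.

Lemma tri_succ n : (tri (n + 1) = tri n + n)%Z.
Proof. pose proof (tri_spec n). pose proof (tri_spec (n + 1)). lia. Qed.

(** With x = |n| this is x^2 - B x + B^2 >= 0: a square beats every slope B at a constant cost,
    which is how a theta series absorbs any factor z^n. *)
Lemma sq_lb (B n : Z) : (0 <= B -> n * n >= B * Z.abs n - B * B)%Z.
Proof.
  intros HB. rewrite <- (Z.abs_square n). assert (0 <= Z.abs n)%Z by lia.
  set (x := Z.abs n) in *. assert (0 <= B * x)%Z by (apply Z.mul_nonneg_nonneg; auto).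
  assert (0 <= (x - B) * (x - B))%Z by apply Z.square_nonneg. nia.
Qed.

Lemma tri_lb (B n : Z) : (0 <= B)%Z -> (tri n >= B * Z.abs n - (2 * B + 1) * (2 * B + 1))%Z.
Proof.
  intros HB. pose proof (tri_spec n). pose proof (sq_lb (2 * B + 1) n ltac:(lia)).
  assert (2 * tri n >= 2 * (B * Z.abs n) - (2 * B + 1) * (2 * B + 1))%Z by lia.
  assert (0 <= (2 * B + 1) * (2 * B + 1))%Z by nia. lia.
Qed.

(** Measures the growth of z^n on the scale of powers of |q|, so that convergence questions become
    inequalities between integer exponents. B is any N with |q|^N below both |z| and 1/|z|. *)
Lemma Czpow_bound (q z : C) : nome q -> z <> 0 ->
  exists B, (0 <= B)%Z /\ forall n, (Cmod (Czpow z n) <= powerRZ (Cmod q) (- (B * Z.abs n)))%R.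
Proof.
  intros Hq Hz. assert (Hz' : (0 < Cmod z)%R) by (apply Cmod_gt_0; auto).
  set (m := Rmin (Cmod z) (/ Cmod z)).
  assert (Hm : (0 < m)%R).
  { apply Rmin_glb_lt; auto. apply Rinv_0_lt_compat; auto. }
  destruct (pow_lt_1_zero (Cmod q)) with (y := m) as (N & HN); auto.
  { rewrite Rabs_pos_eq; [apply Hq|left; apply Hq]. }
  specialize (HN N (le_n _)). rewrite Rabs_pos_eq in HN by (apply pow_le; left; apply Hq).
  exists (Z.of_nat N). split; [lia|]. intros n. rewrite Cmod_Czpow by auto.
  rewrite pow_powerRZ in HN. set (b := powerRZ (Cmod q) (Z.of_nat N)) in *.
  assert (Hb : (0 < b)%R) by (apply powerRZ_lt, Hq).
  assert (E : forall k : nat, powerRZ (Cmod q) (- (Z.of_nat N * Z.of_nat k)) = ((/ b) ^ k)%R).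
  { intros k. unfold b. rewrite powerRZ_neg'. rewrite pow_inv. f_equal.
    induction k; [rewrite Z.mul_0_r; auto|].
    replace (Z.of_nat N * Z.of_nat (S k))%Z with (Z.of_nat N * Z.of_nat k + Z.of_nat N)%Z by lia.
    rewrite powerRZ_add, IHk by (destruct Hq; lra). rewrite <- !pow_powerRZ. simpl. ring. }
  assert (B1 : (Cmod z <= / b)%R).
  { apply (Rmult_le_reg_l b); auto. rewrite Rinv_r by lra.
    assert (b < / Cmod z)%R by (eapply Rlt_le_trans; [exact HN|apply Rmin_r]).
    assert (b * Cmod z < / Cmod z * Cmod z)%R by (apply Rmult_lt_compat_r; auto).
    rewrite Rinv_l in H0 by lra. lra. }
  assert (B2 : (/ Cmod z <= / b)%R).
  { apply Rinv_le_contravar; auto. left; eapply Rlt_le_trans; [exact HN|apply Rmin_l]. }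
  destruct (Z_le_dec 0 n).
  - replace (Z.abs n) with (Z.of_nat (Z.to_nat n)) by lia. rewrite E.
    replace n with (Z.of_nat (Z.to_nat n)) at 1 by lia. rewrite <- pow_powerRZ.
    apply pow_incr; lra.
  - replace (Z.abs n) with (Z.of_nat (Z.to_nat (- n))) by lia. rewrite E.
    replace n with (- Z.of_nat (Z.to_nat (- n)))%Z at 1 by lia.
    rewrite powerRZ_neg', <- pow_powerRZ, <- pow_inv.
    apply pow_incr. split; auto. left; apply Rinv_0_lt_compat; auto.
Qed.

Lemma Cmod_ge_diff x y : (Cmod x - Cmod y <= Cmod (x - y))%R.
Proof.
  assert (Cmod x <= Cmod (x - y) + Cmod y)%R; [|lra].
  replace x with ((x - y) + y) at 1 by ring. apply Cmod_triangle.
Qed.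

Lemma Czpow_small q (d : R) : nome q -> (0 < d)%R ->
  exists N, (0 <= N)%Z /\ forall m, (N <= m)%Z -> (Cmod (Czpow q m) < d)%R.
Proof.
  intros Hq Hd. destruct (pow_lt_1_zero (Cmod q)) with (y := d) as (N & HN); auto.
  { rewrite Rabs_pos_eq; [apply Hq|left; apply Hq]. }
  exists (Z.of_nat N). split; [lia|]. intros m Hm.
  specialize (HN (Z.to_nat m) ltac:(lia)).
  rewrite Cmod_Czpow by (apply nome_nz; auto).
  replace m with (Z.of_nat (Z.to_nat m)) by lia. rewrite <- pow_powerRZ.
  rewrite Rabs_pos_eq in HN; auto. apply pow_le; left; apply Hq.
Qed.

Lemma finite_lower_bound (f : Z -> R) (N : nat) :
  (forall m, 0 < f m)%R -> exists d, (0 < d)%R /\ forall m, (Z.abs m <= Z.of_nat N)%Z -> (d <= f m)%R.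
Proof.
  intros Hf. induction N as [|N (d & Hd & H)].
  - exists (f 0%Z). split; auto. intros m Hm. replace m with 0%Z by lia. lra.
  - exists (Rmin d (Rmin (f (Z.of_nat (S N))) (f (- Z.of_nat (S N))%Z))). split.
    + repeat apply Rmin_glb_lt; auto.
    + intros m Hm. destruct (Z_le_dec (Z.abs m) (Z.of_nat N)).
      * eapply Rle_trans; [apply Rmin_l|auto].
      * eapply Rle_trans; [apply Rmin_r|].
        assert (m = Z.of_nat (S N) \/ m = - Z.of_nat (S N))%Z as [->| ->] by lia;
        [apply Rmin_l|apply Rmin_r].
Qed.

(** For large m the product z q^m has modulus below 1/2, for large -m above 2; only finitely many m
    remain, and at each of them the factor is nonzero. *)
Lemma pole_distance (q z : C) : nome q -> (forall m, 1 - z * Czpow q m <> 0) ->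
  exists d, (0 < d)%R /\ forall m, (d <= Cmod (1 - z * Czpow q m))%R.
Proof.
  intros Hq H. destruct (classic (z = 0)) as [->|Hz].
  { exists 1%R; split; [lra|]. intros m. replace (1 - 0 * Czpow q m) with (RtoC 1) by ring.
    rewrite Cmod_1; lra. }
  assert (Hz' : (0 < Cmod z)%R) by (apply Cmod_gt_0; auto).
  assert (Hq0 := nome_nz q Hq).
  destruct (Czpow_small q (/ (2 * Cmod z))%R Hq) as (N1 & _ & H1).
  { apply Rinv_0_lt_compat; lra. }
  destruct (Czpow_small q (Cmod z / 2)%R Hq) as (N2 & P2 & H2); [lra|].
  destruct (finite_lower_bound (fun m => Cmod (1 - z * Czpow q m)) (Z.to_nat (Z.max N1 N2)))
    as (d & Hd & H3).
  { intros m. apply Cmod_gt_0, H. }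
  exists (Rmin d (1 / 2)%R). split; [apply Rmin_glb_lt; lra|]. intros m.
  destruct (Z_le_dec (Z.abs m) (Z.of_nat (Z.to_nat (Z.max N1 N2)))) as [h|h].
  { eapply Rle_trans; [apply Rmin_l|auto]. }
  eapply Rle_trans; [apply Rmin_r|].
  destruct (Z_le_dec 0 m).
  - specialize (H1 m ltac:(lia)).
    assert (A := Cmod_ge_diff 1 (z * Czpow q m)). rewrite Cmod_1, Cmod_mult in A.
    assert (Cmod z * Cmod (Czpow q m) <= Cmod z * / (2 * Cmod z))%R
      by (apply Rmult_le_compat_l; lra).
    replace (Cmod z * / (2 * Cmod z))%R with (1 / 2)%R in H0 by (field; lra). lra.
  - specialize (H2 (- m)%Z ltac:(lia)).
    assert (A := Cmod_ge_diff (z * Czpow q m) 1). rewrite Cmod_1, Cmod_mult in A.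
    replace (Cmod (1 - z * Czpow q m)) with (Cmod (z * Czpow q m - 1)).
    2:{ rewrite <- Cmod_opp. f_equal; ring. }
    rewrite Czpow_opp, Cmod_inv in H2 by (auto using Czpow_nz).
    assert (P : (0 < Cmod (Czpow q m))%R) by (apply Cmod_gt_0, Czpow_nz; auto).
    assert (2 <= Cmod z * Cmod (Czpow q m))%R; [|lra].
    apply (Rmult_le_reg_r (/ Cmod (Czpow q m))); [apply Rinv_0_lt_compat; auto|].
    rewrite Rmult_assoc, Rinv_r by lra. lra.
Qed.

Lemma C1_nz : RtoC 1 <> 0.
Proof. intros E; inversion E; lra. Qed.

(** * The products (q)_n *)

Lemma Copp_nz (x : C) : x <> 0 -> - x <> 0.
Proof. intros Hx E. apply Hx. replace x with (- - x) by ring. rewrite E; ring. Qed.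

Lemma C2_nz : RtoC 2 <> 0.
Proof. intros E; inversion E; lra. Qed.

Lemma Cinv_nz (x : C) : x <> 0 -> / x <> 0.
Proof.
  intros Hx E. apply C1_nz. rewrite <- (Cinv_r x Hx), E. ring.
Qed.

Lemma Czpow_inv_base (x : C) n : x <> 0 -> Czpow (/ x) n = / Czpow x n.
Proof.
  intros Hx. assert (E : Czpow (/ x) n * Czpow x n = 1).
  { rewrite <- Czpow_base_mul by (auto using Cinv_nz). rewrite Cinv_l by auto. apply Czpow_1_l. }
  assert (N := Czpow_nz x n Hx). rewrite <- (Cmult_1_r (Czpow (/ x) n)), <- (Cinv_r _ N).
  rewrite Cmult_assoc, E. ring.
Qed.

Lemma one_minus_neq (x : C) : x <> 1 -> 1 - x <> 0.
Proof.
  intros H E. apply H. replace x with (1 - (1 - x)) by ring. rewrite E; ring.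
Qed.

Lemma one_minus_nz (x : C) : (Cmod x < 1)%R -> 1 - x <> 0.
Proof.
  intros H. apply one_minus_neq. intros ->. rewrite Cmod_1 in H. lra.
Qed.

Lemma Cmod_qpow_lt1 q n : nome q -> (0 < n)%Z -> (Cmod (Czpow q n) < 1)%R.
Proof.
  intros Hq Hn. rewrite Cmod_Czpow by (apply nome_nz; auto).
  eapply Rle_lt_trans; [apply (powerRZ_anti _ 1)|]; auto; [lia|].
  rewrite powerRZ_1. apply Hq.
Qed.

Lemma one_minus_qpow_nz q n : nome q -> (n <> 0)%Z -> 1 - Czpow q n <> 0.
Proof.
  intros Hq Hn. assert (Hq0 := nome_nz q Hq). destruct (Z_lt_dec 0 n).
  - apply one_minus_nz, Cmod_qpow_lt1; auto.
  - replace n with (- - n)%Z by lia. rewrite Czpow_opp by auto.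
    assert (N := one_minus_nz _ (Cmod_qpow_lt1 q (- n) Hq ltac:(lia))).
    assert (N' := Czpow_nz q (- n) Hq0). intros E. apply N.
    replace (1 - Czpow q (- n)) with (- Czpow q (- n) * (1 - / Czpow q (- n))) by (field; auto).
    rewrite E; ring.
Qed.

Lemma qpoch_S x q n : qpoch x q (S n) = qpoch x q n * (1 - x * Czpow q (Z.of_nat n)).
Proof. simpl. rewrite Czpow_nat. ring. Qed.

Lemma qpoch_qS q n : nome q ->
  qpoch q q (S n) = qpoch q q n * (1 - Czpow q (Z.of_nat n + 1)).
Proof.
  intros Hq. rewrite qpoch_S, Czpow_succ by (apply nome_nz; auto). ring.
Qed.

Lemma qpoch_nz q n : nome q -> qpoch q q n <> 0.
Proof.
  intros Hq. induction n as [|n IH]; [apply C1_nz|].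
  rewrite qpoch_qS by auto. apply Cmult_neq_0; auto.
  apply one_minus_qpow_nz; auto. lia.
Qed.

Lemma qpoch_1 q n : (0 < n)%nat -> qpoch 1 q n = 0.
Proof.
  destruct n as [|n]; [lia|intros _]. induction n as [|n IH].
  - simpl. ring.
  - change (qpoch 1 q (S n) * (1 - q ^ S n * 1) = 0). rewrite IH. ring.
Qed.

(* 1/(q)_k, extended by 0 to negative k; with this convention the recurrence
   [iq_pred] holds for every integer. *)
Definition iq (q : C) (k : Z) : C :=
  if Z_lt_dec k 0 then 0 else / qpoch q q (Z.to_nat k).

Lemma iq_neg q k : (k < 0)%Z -> iq q k = 0.
Proof. intros; unfold iq; destruct (Z_lt_dec k 0); [auto|lia]. Qed.

Lemma iq_nat q n : iq q (Z.of_nat n) = / qpoch q q n.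
Proof. unfold iq; destruct (Z_lt_dec _ 0); [lia|rewrite Nat2Z.id; auto]. Qed.

Lemma iq_0 q : iq q 0 = 1.
Proof. change 0%Z with (Z.of_nat 0). rewrite iq_nat. simpl. field. Qed.

Lemma iq_pred q k : nome q -> iq q (k - 1) = (1 - Czpow q k) * iq q k.
Proof.
  intros Hq. destruct (Z_lt_dec k 0); [rewrite !iq_neg by lia; ring|].
  destruct (Z.eq_dec k 0) as [->|Hk].
  - rewrite iq_neg by lia. simpl. ring.
  - replace k with (Z.of_nat (S (Z.to_nat (k - 1)))) at 2 3 by lia.
    replace (k - 1)%Z with (Z.of_nat (Z.to_nat (k - 1))) at 1 by lia.
    rewrite !iq_nat, qpoch_qS by auto.
    replace (Z.of_nat (Z.to_nat (k - 1)) + 1)%Z with (Z.of_nat (S (Z.to_nat (k - 1)))) by lia.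
    field. split; [apply one_minus_qpow_nz; auto; lia|apply qpoch_nz; auto].
Qed.

Lemma geom_partial_bound (r : R) n : (0 < r < 1)%R ->
  (rsum (fun k => r ^ k)%R (seq 0 n) <= 1 / (1 - r))%R.
Proof.
  intros Hr. rewrite rsum_geom by auto. apply Rmult_le_compat_r.
  - left; apply Rinv_0_lt_compat; lra.
  - assert (0 < r ^ n)%R by (apply pow_lt; lra). lra.
Qed.

(** With r = |q| and y = |q|^(n+1) <= r, each new factor is at most 1/(1 - y) <= 1 + y/(1 - r) <=
    exp(y/(1 - r)), and the exponents form a geometric series. *)
Lemma iq_bound q : nome q -> exists M, (0 <= M)%R /\ forall k, (Cmod (iq q k) <= M)%R.
Proof.
  intros Hq. set (r := Cmod q). assert (Hr : (0 < r < 1)%R) by apply Hq.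
  assert (B : forall n, (Cmod (/ qpoch q q n) <=
             exp (r / (1 - r) * rsum (fun k => r ^ k)%R (seq 0 n)))%R).
  { induction n as [|n IH].
    - simpl. replace (/ 1) with (RtoC 1) by field. rewrite Cmod_1, Rmult_0_r, exp_0. lra.
    - rewrite qpoch_qS, seq_S, rsum_app by auto. simpl. rewrite Rplus_0_r.
      rewrite Rmult_plus_distr_l, exp_plus.
      assert (N : 1 - Czpow q (Z.of_nat n + 1) <> 0) by (apply one_minus_qpow_nz; auto; lia).
      replace (/ (qpoch q q n * (1 - Czpow q (Z.of_nat n + 1)))) with
        (/ qpoch q q n * / (1 - Czpow q (Z.of_nat n + 1)))
        by (field; split; auto; apply qpoch_nz; auto).
      rewrite Cmod_mult. apply Rmult_le_compat; try apply Cmod_ge_0; auto.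
      rewrite Cmod_inv by auto. set (y := (r ^ S n)%R).
      assert (Hy : (0 < y <= r)%R).
      { unfold y; split; [apply pow_lt; lra|]. simpl.
        assert (r ^ n <= 1)%R by (rewrite <- (pow1 n); apply pow_incr; lra).
        assert (0 < r ^ n)%R by (apply pow_lt; lra). nra. }
      assert (A := Cmod_ge_diff 1 (Czpow q (Z.of_nat n + 1))).
      replace (Z.of_nat n + 1)%Z with (Z.of_nat (S n)) in * by lia.
      rewrite Czpow_nat, Cmod_1, Cmod_pow in A. fold r in A. fold y in A.
      rewrite Czpow_nat.
      apply Rle_trans with (/ (1 - y))%R; [apply Rinv_le_contravar; lra|].
      apply Rle_trans with (1 + y / (1 - r))%R.
      + apply (Rmult_le_reg_r ((1 - y) * (1 - r))); [nra|]. field_simplify; nra.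
      + replace (r / (1 - r) * r ^ n)%R with (y / (1 - r))%R by (unfold y; simpl; field; lra).
        apply exp_ineq1_le. }
  exists (exp (r / (1 - r) * (1 / (1 - r))))%R. split; [left; apply exp_pos|].
  intros k. destruct (Z_lt_dec k 0).
  - rewrite iq_neg, Cmod_0 by auto. left; apply exp_pos.
  - replace k with (Z.of_nat (Z.to_nat k)) by lia. rewrite iq_nat.
    eapply Rle_trans; [apply B|].
    assert (X : (r / (1 - r) * rsum (fun k => r ^ k)%R (seq 0 (Z.to_nat k)) <= r / (1 - r) * (1 / (1 - r)))%R).
    { apply Rmult_le_compat_l; [|apply geom_partial_bound; auto].
      apply Rlt_le, Rdiv_lt_0_compat; lra. }
    destruct X as [X| ->]; [left; apply exp_increasing; auto|lra].
Qed.

Lemma qpoch_bound q : nome q -> exists M, (0 <= M)%R /\ forall n, (Cmod (qpoch q q n) <= M)%R.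
Proof.
  intros Hq. set (r := Cmod q). assert (Hr : (0 < r < 1)%R) by apply Hq.
  assert (B : forall n, (Cmod (qpoch q q n) <= exp (r * rsum (fun k => r ^ k)%R (seq 0 n)))%R).
  { induction n as [|n IH].
    - simpl. rewrite Cmod_1, Rmult_0_r, exp_0. lra.
    - rewrite qpoch_qS, seq_S, rsum_app by auto. simpl rsum. rewrite Rplus_0_r.
      rewrite Rmult_plus_distr_l, exp_plus, Cmod_mult.
      apply Rmult_le_compat; try apply Cmod_ge_0; auto.
      eapply Rle_trans; [apply Cmod_triangle|]. rewrite Cmod_opp, Cmod_1.
      replace (Z.of_nat n + 1)%Z with (Z.of_nat (S n)) by lia.
      rewrite Czpow_nat, Cmod_pow. apply exp_ineq1_le. }
  exists (exp (r * (1 / (1 - r))))%R. split; [left; apply exp_pos|]. intros n.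
  eapply Rle_trans; [apply B|].
  assert (X : (r * rsum (fun k => r ^ k)%R (seq 0 n) <= r * (1 / (1 - r)))%R).
  { apply Rmult_le_compat_l; [lra|apply geom_partial_bound; auto]. }
  destruct X as [X| ->]; [left; apply exp_increasing; auto|lra].
Qed.

Lemma qpoch_Clim q : nome q -> exists Q, Clim (qpoch q q) Q.
Proof.
  intros Hq. destruct (qpoch_bound q Hq) as (M & HM & B).
  set (d := fun n => qpoch q q (S n) - qpoch q q n).
  destruct (sums_exists d) as (D & HD).
  - apply (bounded_sums_le _ (fun n => M * powerRZ (Cmod q) (Z.abs (Z.of_nat n)))%R).
    + intros n. unfold d. rewrite qpoch_qS by auto.
      replace (qpoch q q n * (1 - Czpow q (Z.of_nat n + 1)) - qpoch q q n) with
        (- (qpoch q q n * Czpow q (Z.of_nat n + 1))) by ring.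
      rewrite Cmod_opp, Cmod_mult, Cmod_Czpow by (apply nome_nz; auto).
      apply Rmult_le_compat; auto; try apply Cmod_ge_0; [apply powerRZ_le, Hq|].
      apply powerRZ_anti; auto. lia.
    + apply bounded_sums_scal; auto.
      apply (bounded_sums_inj Z.of_nat (fun k => powerRZ (Cmod q) (Z.abs k))).
      * intros; lia.
      * apply bounded_sums_geom, Hq.
  - exists (1 + D). intros eps He. destruct (sums_Clim _ _ HD eps He) as (N & HN).
    exists (S N). intros n Hn. specialize (HN (pred n) ltac:(lia)).
    assert (E : sum_n d (pred n) = qpoch q q n - 1).
    { replace n with (S (pred n)) at 2 by lia. clear. induction (pred n) as [|k IH].
      - rewrite sum_O. unfold d. simpl. ring.
      - rewrite sum_Sn, IH. change (d (S k)) with (qpoch q q (S (S k)) - qpoch q q (S k)).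
        match goal with |- ?a = ?b => change (@eq C a b) end. change plus with Cplus. ring. }
    rewrite E in HN. replace (qpoch q q n - (1 + D)) with (qpoch q q n - 1 - D) by ring. auto.
Qed.

(** Bounded reciprocals keep the limit away from 0. Applied to (q)_n and 1/(q)_n this yields (q)_inf
    <> 0 without a separate estimate from below. *)
Lemma Clim_inv (u v : nat -> C) l (M : R) : Clim u l -> (forall n, Cmod (v n) <= M)%R ->
  (forall n, u n * v n = 1) -> l <> 0 /\ Clim v (/ l).
Proof.
  intros H B E.
  assert (HM : (0 < M)%R).
  { destruct (Rlt_dec 0 M); auto. exfalso. specialize (B O).
    assert (Cmod (v O) = 0)%R by (pose proof (Cmod_ge_0 (v O)); lra).
    apply Cmod_eq_0 in H0. specialize (E O). rewrite H0, Cmult_0_r in E.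
    symmetry in E. destruct (C1_nz E). }
  assert (L : l <> 0).
  { intros ->. destruct (H (/ M)%R) as (N & HN); [apply Rinv_0_lt_compat; auto|].
    specialize (HN N (le_n _)). replace (u N - 0) with (u N) in HN by ring.
    assert (X : (Cmod (u N) * Cmod (v N) = 1)%R) by (rewrite <- Cmod_mult, E; apply Cmod_1).
    specialize (B N). pose proof (Cmod_ge_0 (u N)).
    assert (Cmod (u N) * Cmod (v N) <= Cmod (u N) * M)%R by (apply Rmult_le_compat_l; auto).
    assert (Cmod (u N) * M < / M * M)%R by (apply Rmult_lt_compat_r; auto).
    rewrite Rinv_l in H2 by lra. lra. }
  split; auto. intros eps He.
  assert (Pl : (0 < Cmod l)%R) by (apply Cmod_gt_0; auto).
  destruct (H (eps * Cmod l / M)%R) as (N & HN).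
  { apply Rdiv_lt_0_compat; auto. apply Rmult_lt_0_compat; auto. }
  exists N. intros n Hn. specialize (HN n Hn).
  replace (v n - / l) with (- ((u n - l) * v n * / l)).
  2:{ transitivity (v n - (u n * v n) * / l); [field; auto|]. rewrite E. field; auto. }
  rewrite Cmod_opp, !Cmod_mult, Cmod_inv by auto.
  apply (Rmult_lt_reg_r (Cmod l)); auto. rewrite Rmult_assoc, Rinv_l, Rmult_1_r by lra.
  apply Rle_lt_trans with (Cmod (u n - l) * M)%R.
  - apply Rmult_le_compat_l; auto. apply Cmod_ge_0.
  - apply (Rmult_lt_reg_r (/ M)); [apply Rinv_0_lt_compat; auto|].
    rewrite Rmult_assoc, Rinv_r by lra. unfold Rdiv in HN. lra.
Qed.

Lemma qinf_Clim q : nome q -> Clim (qpoch q q) (qinf q).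
Proof.
  intros Hq. destruct (qpoch_Clim q Hq) as (Q & HQ).
  unfold qinf. rewrite (Clim_Clim_seq _ _ HQ). exact HQ.
Qed.

Lemma iq_Clim_nz q : nome q -> qinf q <> 0 /\ Clim (fun n => iq q (Z.of_nat n)) (/ qinf q).
Proof.
  intros Hq. destruct (iq_bound q Hq) as (M & _ & B).
  apply (Clim_inv (qpoch q q) _ _ M); auto using qinf_Clim.
  intros n. rewrite iq_nat. apply Cinv_r, qpoch_nz; auto.
Qed.

Lemma qinf_nz q : nome q -> qinf q <> 0.
Proof. intros Hq; apply (iq_Clim_nz q Hq). Qed.

Lemma iq_Clim_shift q (c d : Z) : nome q -> (0 < c)%Z ->
  Clim (fun n => iq q (c * Z.of_nat n + d)) (/ qinf q).
Proof.
  intros Hq Hc. intros eps He.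
  destruct (iq_Clim_nz q Hq) as [_ H]. destruct (H eps He) as (N & HN).
  exists (N + Z.to_nat (Z.abs d))%nat. intros n Hn.
  specialize (HN (Z.to_nat (c * Z.of_nat n + d))).
  rewrite Z2Nat.id in HN by nia. apply HN. nia.
Qed.

(** * Finite triple product and partial fractions *)

(** Summand of the q-binomial theorem, centred so that r runs from -a to b and divided by (q)_(a+b).
    As [iq] vanishes at negative arguments, the finite sum may be written over Z and shifted
    freely. *)
Definition jtp_term (q z : C) (a b r : Z) : C :=
  sgz r * Czpow q (tri r) * Czpow z r * (iq q (b - r) * iq q (a + r)).

Lemma jtp_term_step (q z : C) a b r : nome q -> z <> 0 ->
  (1 - Czpow q (a + b + 1)) * jtp_term q z a (b + 1) r =
  jtp_term q z a b r - z * Czpow q b * jtp_term q z a b (r - 1).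
Proof.
  intros Hq Hz. assert (Hq0 := nome_nz q Hq). unfold jtp_term.
  replace (b - r)%Z with (b + 1 - r - 1)%Z by lia.
  replace (a + (r - 1))%Z with (a + r - 1)%Z by lia.
  replace (b - (r - 1))%Z with (b + 1 - r)%Z by lia.
  rewrite !(iq_pred q) by auto. rewrite sgz_pred.
  replace (tri (r - 1)) with (tri r + (1 - r))%Z
    by (pose proof (tri_succ (r - 1)) as E; replace (r - 1 + 1)%Z with r in E by lia; lia).
  unfold Z.sub. rewrite !Czpow_add, !Czpow_opp, !Czpow_1 by auto.
  assert (Czpow q r <> 0) by (apply Czpow_nz; auto).
  assert (Czpow z 1 <> 0) by (apply Czpow_nz; auto).
  change (Czpow z (-1)) with (/ z ^ 1). field. repeat split; auto.
Qed.

Lemma jtp_term_bound (q z : C) : nome q -> z <> 0 -> exists (M : R) (K : Z), (0 <= M)%R /\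
  forall a b r, (Cmod (jtp_term q z a b r) <= M * powerRZ (Cmod q) (Z.abs r - K))%R.
Proof.
  intros Hq Hz. destruct (iq_bound q Hq) as (M & HM & B).
  destruct (Czpow_bound q z Hq Hz) as (b0 & Hb0 & B').
  exists (M * M)%R, ((2 * (b0 + 1) + 1) * (2 * (b0 + 1) + 1))%Z. split; [nra|].
  intros a b r. unfold jtp_term. rewrite !Cmod_mult, Cmod_sgz, Cmod_Czpow by (apply nome_nz; auto).
  rewrite Rmult_1_l, Rmult_comm.
  apply Rmult_le_compat; [rewrite <- Cmod_mult; apply Cmod_ge_0| | |].
  - apply Rmult_le_pos; [apply powerRZ_le, Hq|apply Cmod_ge_0].
  - apply Rmult_le_compat; auto; apply Cmod_ge_0.
  - eapply Rle_trans; [apply Rmult_le_compat_l; [apply powerRZ_le, Hq|apply B']|].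
    rewrite <- powerRZ_add by (destruct Hq; lra). apply powerRZ_anti; auto.
    pose proof (tri_lb (b0 + 1) r ltac:(lia)). lia.
Qed.

Lemma sums_shift (f : Z -> C) S d : sums f S -> sums (fun n => f (n + d)%Z) S.
Proof.
  intros H. apply (sums_reindex (fun n => n + d)%Z (fun n => n - d)%Z f); auto; intros; lia.
Qed.

Lemma sums_neg (f : Z -> C) S : sums f S -> sums (fun n => f (- n)%Z) S.
Proof. intros H. apply (sums_reindex Z.opp Z.opp f); auto; intros; lia. Qed.

Lemma sums_refl (f : Z -> C) S d : sums f S -> sums (fun n => f (d - n)%Z) S.
Proof.
  intros H. apply (sums_reindex (fun n => d - n)%Z (fun n => d - n)%Z f); auto; intros; lia.
Qed.

Lemma sums_div (f : Z -> C) (c S : C) : c <> 0 -> sums (fun n => c * f n) S -> sums f (S / c).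
Proof.
  intros Hc H. apply (sums_ext (fun n => / c * (c * f n))).
  - intros t. field; auto.
  - apply (sums_eq _ (/ c * S)); [apply sums_scal; auto|]. field; auto.
Qed.

Lemma jtp_step (q z : C) a b S : nome q -> z <> 0 -> (0 <= a + b)%Z ->
  sums (jtp_term q z a b) S ->
  sums (jtp_term q z a (b + 1)) (S * (1 - z * Czpow q b) / (1 - Czpow q (a + b + 1))).
Proof.
  intros Hq Hz Hab H. apply sums_div; [apply one_minus_qpow_nz; auto; lia|].
  apply (sums_ext (fun r => jtp_term q z a b r - z * Czpow q b * jtp_term q z a b (r + - (1))%Z)).
  - intros r. rewrite jtp_term_step by auto. reflexivity.
  - apply (sums_eq _ (S - z * Czpow q b * S)); [|ring].
    apply sums_minus; auto. apply sums_scal, sums_shift; auto.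
Qed.

Lemma jtp_steps (q z : C) (a b : nat) (c : C) : nome q -> z <> 0 ->
  sums (jtp_term q z (Z.of_nat a) 0) (c * iq q (Z.of_nat a)) ->
  sums (jtp_term q z (Z.of_nat a) (Z.of_nat b)) (c * qpoch z q b * iq q (Z.of_nat (a + b))).
Proof.
  intros Hq Hz H. induction b as [|b IH].
  - rewrite Nat.add_0_r. simpl. rewrite Cmult_1_r. exact H.
  - replace (Z.of_nat (S b)) with (Z.of_nat b + 1)%Z by lia.
    eapply sums_eq; [apply jtp_step; [auto|auto|lia|exact IH]|].
    replace (Z.of_nat a + Z.of_nat b + 1)%Z with (Z.of_nat (a + S b)) by lia.
    replace (Z.of_nat (a + b)) with (Z.of_nat (a + S b) - 1)%Z by lia.
    rewrite iq_pred, qpoch_S by auto. field. apply one_minus_qpow_nz; auto; lia.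
Qed.

Lemma jtp_term_symm (q z : C) a b r : nome q -> z <> 0 ->
  jtp_term q (q / z) b a (- r) = jtp_term q z a b r.
Proof.
  intros Hq Hz. assert (Hq0 := nome_nz q Hq). unfold jtp_term. rewrite sgz_opp.
  replace (a - - r)%Z with (a + r)%Z by lia. replace (b + - r)%Z with (b - r)%Z by lia.
  unfold Cdiv. rewrite Czpow_base_mul by (auto using Cinv_nz).
  rewrite Czpow_inv_base by auto.
  replace (tri (- r)) with (tri r + r)%Z
    by (pose proof (tri_spec r); pose proof (tri_spec (- r)); lia).
  rewrite Czpow_add, !Czpow_opp by auto.
  field. split; apply Czpow_nz; auto.
Qed.

(** Raising the upper bound b by one multiplies the sum by a factor in z. The factors in q/z come
    from the same induction after the reflection r -> -r, which exchanges a with b and z with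
    q/z. *)
Lemma jtp_finite (q z : C) (a b : nat) : nome q -> z <> 0 ->
  sums (jtp_term q z (Z.of_nat a) (Z.of_nat b))
    (qpoch (q / z) q a * qpoch z q b * iq q (Z.of_nat (a + b))).
Proof.
  intros Hq Hz. apply jtp_steps; auto.
  assert (Hw : q / z <> 0) by (apply Cmult_neq_0; [apply nome_nz; auto|apply Cinv_nz; auto]).
  apply (sums_ext (fun r => jtp_term q (q / z) 0 (Z.of_nat a) (- r)%Z)).
  { intros; apply jtp_term_symm; auto. }
  apply sums_neg.
  eapply sums_eq; [apply (jtp_steps q (q / z) 0 a 1); auto|].
  - assert (E : jtp_term q (q / z) 0 0 0 = 1 * iq q 0).
    { unfold jtp_term. simpl. rewrite !iq_0. unfold sgz. simpl. ring. }
    simpl Z.of_nat. rewrite <- E. apply sums_single. intros t Ht. unfold jtp_term.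
    destruct (Z_lt_dec 0 t).
    + rewrite (iq_neg q (0 - t)) by lia. ring.
    + rewrite (iq_neg q (0 + t)) by lia. ring.
  - simpl. ring.
Qed.

(** Partial fractions of 1/((z)_(b+1) (q/z)_a), whose simple poles are z = q^(-r) with r from -a to
    b. *)
Definition pf_term (q z : C) (a b r : Z) : C :=
  sgz r * Czpow q (tri (r + 1)) * (iq q (b - r) * iq q (a + r)) / (1 - z * Czpow q r).

(** The error term is a triple-product summand at z = 1; its sum contains the factor (1;q)_(b+1) =
    0. So adding the pole b + 1 just divides the sum by 1 - z q^(b+1). *)
Lemma pf_term_step_r (q z : C) a b r : nome q -> (forall m, 1 - z * Czpow q m <> 0) ->
  (1 - z * Czpow q (b + 1)) * pf_term q z a (b + 1) r =
  pf_term q z a b r + Czpow q (b + 1) * jtp_term q 1 a (b + 1) r.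
Proof.
  intros Hq Hz. assert (Hq0 := nome_nz q Hq). unfold pf_term, jtp_term.
  replace (b - r)%Z with (b + 1 - r - 1)%Z by lia. rewrite (iq_pred q _ Hq).
  rewrite tri_succ, Czpow_1_l.
  unfold Z.sub. rewrite !Czpow_add, !Czpow_opp, !Czpow_1 by auto.
  assert (X := Hz r). assert (Y := Czpow_nz q r Hq0). field; auto.
Qed.

(** Here the error is a triple-product summand at z = q, whose sum vanishes through (q/z)_(a+1) =
    (1;q)_(a+1). *)
Lemma pf_term_step_l (q z : C) a b r : nome q -> z <> 0 -> (forall m, 1 - z * Czpow q m <> 0) ->
  (1 - Czpow q (a + 1) / z) * pf_term q z (a + 1) b r =
  pf_term q z a b r - Czpow q (a + 1) / z * jtp_term q q (a + 1) b r.
Proof.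
  intros Hq Hz0 Hz. assert (Hq0 := nome_nz q Hq). unfold pf_term, jtp_term.
  replace (a + r)%Z with (a + 1 + r - 1)%Z by lia. rewrite (iq_pred q _ Hq).
  rewrite tri_succ. unfold Z.sub. rewrite !Czpow_add, !Czpow_1 by auto.
  assert (X := Hz r). field; auto.
Qed.

Lemma qpoch_pole_nz (q z : C) n : (forall m, 1 - z * Czpow q m <> 0) -> qpoch z q n <> 0.
Proof.
  intros Hz. induction n as [|n IH]; [apply C1_nz|].
  rewrite qpoch_S. apply Cmult_neq_0; auto.
Qed.

Lemma pole_inv (q z : C) : q <> 0 -> z <> 0 -> (forall m, 1 - z * Czpow q m <> 0) ->
  forall m, 1 - q / z * Czpow q m <> 0.
Proof.
  intros Hq Hz0 Hz m E. apply (Hz (- (m + 1))%Z).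
  rewrite Czpow_opp, Czpow_succ by auto.
  assert (N := Czpow_nz q m Hq).
  replace (1 - z * / (Czpow q m * q)) with (- z * / (Czpow q m * q) * (1 - q / z * Czpow q m))
    by (field; auto).
  rewrite E; ring.
Qed.

Lemma pf_finite (q z : C) (a b : nat) : nome q -> z <> 0 -> (forall m, 1 - z * Czpow q m <> 0) ->
  sums (pf_term q z (Z.of_nat a) (Z.of_nat b)) (/ (qpoch z q (S b) * qpoch (q / z) q a)).
Proof.
  intros Hq Hz0 Hz. assert (Hq0 := nome_nz q Hq).
  assert (P1 : forall n, qpoch z q n <> 0) by (intros; apply qpoch_pole_nz; auto).
  assert (P2 : forall n, qpoch (q / z) q n <> 0).
  { intros; apply qpoch_pole_nz, pole_inv; auto. }
  assert (N1 : RtoC 1 <> 0) by apply C1_nz.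
  revert b. induction a as [|a IHa]; intros b.
  - induction b as [|b IHb].
    + replace (/ (qpoch z q 1 * qpoch (q / z) q 0)) with (pf_term q z 0 0 0).
      * apply sums_single. intros t Ht. unfold pf_term. simpl Z.of_nat. unfold Cdiv.
        destruct (Z_lt_dec 0 t).
        -- rewrite (iq_neg q (0 - t)) by lia. ring.
        -- rewrite (iq_neg q (0 + t)) by lia. ring.
      * unfold pf_term. simpl. rewrite !iq_0. unfold sgz. simpl.
        assert (X := Hz 0%Z). simpl in X. rewrite Cmult_1_r in X. field. exact X.
    + replace (Z.of_nat (S b)) with (Z.of_nat b + 1)%Z by lia.
      assert (X := Hz (Z.of_nat b + 1)%Z).
      eapply sums_eq; [apply (sums_div _ (1 - z * Czpow q (Z.of_nat b + 1))); auto|].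
      * eapply sums_ext; [intros r; symmetry; apply pf_term_step_r; auto|].
        apply sums_plus; [exact IHb|]. apply sums_scal.
        replace (Z.of_nat b + 1)%Z with (Z.of_nat (S b)) by lia.
        apply (jtp_finite q 1 0 (S b)); auto.
      * rewrite (qpoch_1 q (S b)) by lia. rewrite (qpoch_S z q (S b)).
        replace (Z.of_nat (S b)) with (Z.of_nat b + 1)%Z by lia.
        assert (Y1 := P1 (S b)). assert (Y2 := P2 O). clear IHb P1 P2 Hz. field; auto.
  - replace (Z.of_nat (S a)) with (Z.of_nat a + 1)%Z by lia.
    assert (X : 1 - Czpow q (Z.of_nat a + 1) / z <> 0).
    { rewrite Czpow_succ by auto.
      replace (1 - Czpow q (Z.of_nat a) * q / z) with (1 - q / z * Czpow q (Z.of_nat a))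
        by (field; auto). apply pole_inv; auto. }
    eapply sums_eq; [apply (sums_div _ (1 - Czpow q (Z.of_nat a + 1) / z)); auto|].
    + eapply sums_ext; [intros r; symmetry; apply pf_term_step_l; auto|].
      apply sums_minus; [apply IHa|]. apply sums_scal.
      replace (Z.of_nat a + 1)%Z with (Z.of_nat (S a)) by lia.
      apply (jtp_finite q q (S a) b); auto.
    + replace (q / q) with (RtoC 1) by (field; auto). rewrite (qpoch_1 q (S a)) by lia.
      rewrite (qpoch_S (q / z) q a).
      replace (1 - q / z * Czpow q (Z.of_nat a)) with (1 - Czpow q (Z.of_nat a + 1) / z).
      2:{ rewrite Czpow_succ by auto. field; auto. }
      assert (A1 := P1 (S b)). assert (A2 := P2 a).
      set (u := 1 - Czpow q (Z.of_nat a + 1) / z) in *. field; auto.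
Qed.

Lemma pf_term_bound (q z : C) : nome q -> z <> 0 -> (forall m, 1 - z * Czpow q m <> 0) ->
  exists (M : R) (K : Z), (0 <= M)%R /\ forall a b r, (Cmod (pf_term q z a b r) <= M * powerRZ (Cmod q) (Z.abs r - K))%R.
Proof.
  intros Hq Hz0 Hz. destruct (jtp_term_bound q q Hq (nome_nz q Hq)) as (M & K & HM & B).
  destruct (pole_distance q z Hq Hz) as (d & Hd & D).
  exists (M * / d)%R, K. split.
  { apply Rmult_le_pos; auto. left; apply Rinv_0_lt_compat; auto. }
  intros a b r.
  replace (pf_term q z a b r) with (jtp_term q q a b r * / (1 - z * Czpow q r)).
  - rewrite Cmod_mult, Cmod_inv by auto. rewrite Rmult_assoc, (Rmult_comm (/ d)), <- Rmult_assoc.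
    apply Rmult_le_compat; auto; try apply Cmod_ge_0.
    + left; apply Rinv_0_lt_compat, Cmod_gt_0; auto.
    + apply Rinv_le_contravar; auto.
  - unfold jtp_term, pf_term. rewrite tri_succ, Czpow_add by (apply nome_nz; auto). field. auto.
Qed.

(** * Infinite triple product and partial fractions *)

Definition j_term (q z : C) (r : Z) : C := sgz r * Czpow q (tri r) * Czpow z r.

Lemma j_term_bound (q z : C) : nome q -> z <> 0 -> exists (M : R) (K : Z), (0 <= M)%R /\ forall r, (Cmod (j_term q z r) <= M * powerRZ (Cmod q) (Z.abs r - K))%R.
Proof.
  intros Hq Hz. destruct (Czpow_bound q z Hq Hz) as (b0 & Hb0 & B').
  exists 1%R, ((2 * (b0 + 1) + 1) * (2 * (b0 + 1) + 1))%Z. split; [lra|].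
  intros r. unfold j_term. rewrite !Cmod_mult, Cmod_sgz, Cmod_Czpow by (apply nome_nz; auto).
  rewrite !Rmult_1_l.
  eapply Rle_trans; [apply Rmult_le_compat_l; [apply powerRZ_le, Hq|apply B']|].
  rewrite <- powerRZ_add by (destruct Hq; lra). apply powerRZ_anti; auto.
  pose proof (tri_lb (b0 + 1) r ltac:(lia)). lia.
Qed.

Lemma j_sums (q z : C) : nome q -> z <> 0 -> sums (j_term q z) (j z q).
Proof.
  intros Hq Hz. destruct (j_term_bound q z Hq Hz) as (M & K & HM & B).
  destruct (sums_exists (j_term q z)) as (S & HS); [apply (abs_quad q M K); auto|].
  assert (E : j z q = S); [|rewrite E; auto].
  unfold j. apply sums_ZSeries. exact HS.
Qed.

Lemma Clim_iq_pair q r : nome q ->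
  Clim (fun n => iq q (Z.of_nat n - r) * iq q (Z.of_nat n + r)) (/ qinf q * / qinf q).
Proof.
  intros Hq. apply Clim_mult.
  - apply (Clim_ext (fun n => iq q (1 * Z.of_nat n + - r))); [intros; f_equal; lia|].
    apply iq_Clim_shift; auto; lia.
  - apply (Clim_ext (fun n => iq q (1 * Z.of_nat n + r))); [intros; f_equal; lia|].
    apply iq_Clim_shift; auto; lia.
Qed.

Lemma jtp_limit (q z : C) : nome q -> z <> 0 ->
  Clim (fun n => qpoch (q / z) q n * qpoch z q n * iq q (Z.of_nat (n + n)))
    (j z q * (/ qinf q * / qinf q)).
Proof.
  intros Hq Hz. destruct (jtp_term_bound q z Hq Hz) as (M & K & HM & B).
  destruct (sums_dominated (fun n r => jtp_term q z (Z.of_nat n) (Z.of_nat n) r)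
    (fun n => qpoch (q / z) q n * qpoch z q n * iq q (Z.of_nat (n + n)))
    (fun r => j_term q z r * (/ qinf q * / qinf q))
    (fun r => M * powerRZ (Cmod q) (Z.abs r - K))%R) as (S & HS & HL).
  - intros n. apply jtp_finite; auto.
  - intros n r. apply B.
  - apply bounded_sums_quad; auto.
  - intros r. unfold jtp_term. apply Clim_mult; [apply Clim_const|apply Clim_iq_pair; auto].
  - assert (E : S = j z q * (/ qinf q * / qinf q)); [|rewrite <- E; auto].
    apply (sums_unique _ _ _ HS).
    apply (sums_ext (fun r => (/ qinf q * / qinf q) * j_term q z r)); [intros; ring|].
    eapply sums_eq; [apply sums_scal, j_sums; auto|ring].
Qed.

Definition pf_lim_term (q z : C) (r : Z) : C := sgz r * Czpow q (tri (r + 1)) / (1 - z * Czpow q r).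

Lemma pf_limit (q z : C) : nome q -> z <> 0 -> (forall m, 1 - z * Czpow q m <> 0) ->
  exists P, sums (pf_lim_term q z) P /\ Clim (fun n => / (qpoch z q (S n) * qpoch (q / z) q n)) (P * (/ qinf q * / qinf q)).
Proof.
  intros Hq Hz0 Hz. destruct (pf_term_bound q z Hq Hz0 Hz) as (M & K & HM & B).
  assert (QN := qinf_nz q Hq).
  destruct (sums_dominated (fun n r => pf_term q z (Z.of_nat n) (Z.of_nat n) r)
    (fun n => / (qpoch z q (S n) * qpoch (q / z) q n))
    (fun r => pf_lim_term q z r * (/ qinf q * / qinf q))
    (fun r => M * powerRZ (Cmod q) (Z.abs r - K))%R) as (S & HS & HL).
  - intros n. apply pf_finite; auto.
  - intros n r. apply B.
  - apply bounded_sums_quad; auto.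
  - intros r.
    apply (Clim_ext (fun n => pf_lim_term q z r * (iq q (Z.of_nat n - r) * iq q (Z.of_nat n + r)))).
    + intros n. unfold pf_term, pf_lim_term. field. apply Hz.
    + apply Clim_mult; [apply Clim_const|apply Clim_iq_pair; auto].
  - exists (S * (qinf q * qinf q)). split.
    + eapply sums_eq; [|apply Cmult_comm].
      eapply sums_ext; [|apply (sums_scal (qinf q * qinf q) _ _ HS)].
      intros r; simpl. field; auto.
    + replace (S * (qinf q * qinf q) * (/ qinf q * / qinf q)) with S by (field; auto). auto.
Qed.

(** In the product of the two finite identities with a = b = n everything cancels except 1/(q)_(2n)
    and 1/(1 - z q^n), and the latter tends to 1. The limit reads j P / (q)_inf^4 = 1/(q)_inf. It
    also shows that j(z;q) does not vanish away from the poles. *)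
Lemma pf_j (q z : C) : nome q -> z <> 0 -> (forall m, 1 - z * Czpow q m <> 0) ->
  exists P, sums (pf_lim_term q z) P /\ P * j z q = qinf q ^ 3.
Proof.
  intros Hq Hz0 Hz. destruct (pf_limit q z Hq Hz0 Hz) as (P & HP & HL).
  exists P; split; auto.
  assert (QN := qinf_nz q Hq). assert (Hq0 := nome_nz q Hq).
  assert (L := Clim_mult _ _ _ _ (jtp_limit q z Hq Hz0) HL).
  assert (L2 : Clim (fun n => 1 - z * Czpow q (Z.of_nat n)) 1).
  { intros eps He.
    assert (Hz' : (0 < Cmod z)%R) by (apply Cmod_gt_0; auto).
    destruct (Czpow_small q (eps / Cmod z)%R Hq) as (N & _ & HN); [apply Rdiv_lt_0_compat; auto|].
    exists (Z.to_nat N). intros n Hn. specialize (HN (Z.of_nat n) ltac:(lia)).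
    replace (1 - z * Czpow q (Z.of_nat n) - 1) with (- (z * Czpow q (Z.of_nat n))) by ring.
    rewrite Cmod_opp, Cmod_mult. apply (Rmult_lt_compat_l (Cmod z)) in HN; auto.
    replace (Cmod z * (eps / Cmod z))%R with eps in HN by (field; lra). auto. }
  assert (L3 := Clim_mult _ _ _ _ L L2).
  assert (L4 : Clim (fun n => iq q (Z.of_nat (n + n))) (/ qinf q)).
  { apply (Clim_ext (fun n => iq q (2 * Z.of_nat n + 0))); [intros; f_equal; lia|].
    apply iq_Clim_shift; auto; lia. }
  assert (E : j z q * (/ qinf q * / qinf q) * (P * (/ qinf q * / qinf q)) * 1 = / qinf q).
  { eapply Clim_unique; [|exact L4]. eapply Clim_ext; [|exact L3].
    intros n. cbv beta. rewrite qpoch_S.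
    assert (A1 := qpoch_pole_nz q z n Hz).
    assert (A2 := qpoch_pole_nz q (q / z) n (pole_inv q z Hq0 Hz0 Hz)).
    assert (A3 := Hz (Z.of_nat n)). field. auto. }
  replace (P * j z q) with (j z q * (/ qinf q * / qinf q) * (P * (/ qinf q * / qinf q)) * 1 * qinf q ^ 4)
    by (field; auto).
  rewrite E. field; auto.
Qed.

(** The triple product with base q^3 and z = q: the factors with exponents 1, 2, 0 modulo 3
    interleave to (q)_(3n). *)
Lemma pentagonal q : nome q -> j q (q ^ 3) = qinf q.
Proof.
  intros Hq. assert (Hq0 := nome_nz q Hq).
  assert (Hq3 : nome (q ^ 3)) by (apply nome_pow; auto).
  assert (QN := qinf_nz q Hq). assert (QN3 := qinf_nz _ Hq3).
  assert (L := Clim_mult _ _ _ _ (jtp_limit (q ^ 3) q Hq3 Hq0) (qinf_Clim _ Hq3)).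
  assert (L1 : Clim (fun n => qpoch q q (3 * n) * iq (q ^ 3) (Z.of_nat (n + n))) (qinf q * / qinf (q ^ 3))).
  { apply Clim_mult.
    - apply (Clim_subseq (qpoch q q) _ (fun n => 3 * n)%nat); [intros; lia|apply qinf_Clim; auto].
    - apply (Clim_ext (fun n => iq (q ^ 3) (2 * Z.of_nat n + 0))); [intros; f_equal; lia|].
      apply iq_Clim_shift; auto; lia. }
  assert (E : j q (q ^ 3) * (/ qinf (q ^ 3) * / qinf (q ^ 3)) * qinf (q ^ 3) = qinf q * / qinf (q ^ 3)).
  { eapply Clim_unique; [exact L|]. eapply Clim_ext; [|exact L1]. intros n. cbv beta.
    assert (F : qpoch q q (3 * n) = qpoch (q ^ 3 / q) (q ^ 3) n * qpoch q (q ^ 3) n * qpoch (q ^ 3) (q ^ 3) n).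
    { replace (q ^ 3 / q) with (q ^ 2) by (simpl; field; auto). clear. induction n as [|n IH]; [simpl; ring|].
      replace (3 * S n)%nat with (S (S (S (3 * n)))) by lia.
      cbn [qpoch]. rewrite IH, <- !Cpow_mult_r.
      replace (q ^ S (S (3 * n)) * q) with (q ^ (3 * n) * q ^ 3) by (simpl; ring).
      replace (q ^ S (3 * n) * q) with (q ^ (3 * n) * q ^ 2) by (simpl; ring). ring. }
    rewrite F. ring. }
  replace (j q (q ^ 3)) with (j q (q ^ 3) * (/ qinf (q ^ 3) * / qinf (q ^ 3)) * qinf (q ^ 3) * qinf (q ^ 3))
    by (field; auto).
  rewrite E. field; auto.
Qed.

(** * Mock theta functions as Appell sums *)

(** Partitions sorted by their Durfee rectangle with sides m and m + s; the sum over m counts all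
    partitions, whatever s >= 0 is. *)
Definition durfee_term (q : C) (s m : Z) : C := Czpow q (m * (m + s)) * (iq q m * iq q (m + s)).

Lemma durfee_term_bound q : nome q -> exists M : R, (0 <= M)%R /\
  forall s m, (0 <= s)%Z -> (Cmod (durfee_term q s m) <= M * powerRZ (Cmod q) (Z.abs m))%R.
Proof.
  intros Hq. destruct (iq_bound q Hq) as (M & HM & B).
  exists (M * M)%R. split; [nra|]. intros s m Hs. unfold durfee_term.
  destruct (Z_lt_dec m 0).
  - rewrite (iq_neg q m) by auto.
    replace (Czpow q (m * (m + s)) * (0 * iq q (m + s))) with (RtoC 0) by ring.
    rewrite Cmod_0. apply Rmult_le_pos; [nra|apply powerRZ_le, Hq].
  - rewrite !Cmod_mult, Cmod_Czpow by (apply nome_nz; auto). rewrite Rmult_comm.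
    apply Rmult_le_compat.
    + apply Rmult_le_pos; apply Cmod_ge_0.
    + apply powerRZ_le, Hq.
    + apply Rmult_le_compat; auto; apply Cmod_ge_0.
    + apply powerRZ_anti; auto. nia.
Qed.

Lemma durfee_term_rec q s m : nome q ->
  durfee_term q s m - durfee_term q (s + 1) m =
  Czpow q (s + 1) * (durfee_term q (s + 2) (m - 1) - durfee_term q (s + 1) m).
Proof.
  intros Hq. assert (Hq0 := nome_nz q Hq). unfold durfee_term.
  replace (m - 1 + (s + 2))%Z with (m + s + 1)%Z by lia.
  rewrite (iq_pred q m Hq).
  replace (iq q (m + s)) with ((1 - Czpow q (m + s + 1)) * iq q (m + s + 1))
    by (rewrite <- iq_pred by auto; f_equal; lia).
  replace (m + (s + 1))%Z with (m + s + 1)%Z by lia.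
  replace (m * (m + s + 1))%Z with (m * (m + s) + m)%Z by lia.
  replace ((m - 1) * (m + s + 1))%Z with (m * (m + s) + - (s + 1))%Z by lia.
  rewrite !Czpow_add, Czpow_opp, !Czpow_add, Czpow_1 by auto.
  assert (A := Czpow_nz q s Hq0). field; auto.
Qed.

(* Summing [durfee_term_rec] over m gives D_s - D_(s+1) = q^(s+1) (D_(s+2) - D_(s+1)); as the
   D_s are bounded, iterating this forces D_s = D_(s+1), and D_s tends to 1/(q)_inf. *)
Lemma durfee_pos q s : nome q -> (0 <= s)%Z -> sums (durfee_term q s) (/ qinf q).
Proof.
  intros Hq. assert (Hq0 := nome_nz q Hq).
  destruct (durfee_term_bound q Hq) as (M & HM & B).
  assert (X : forall s : nat, exists S, sums (durfee_term q (Z.of_nat s)) S).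
  { intros n. apply sums_exists, (abs_geom (Cmod q) M); auto. intros m; apply B; lia. }
  set (D := fun n => proj1_sig (constructive_indefinite_description _ (X n))).
  assert (HD : forall n, sums (durfee_term q (Z.of_nat n)) (D n))
    by (intros n; apply (proj2_sig (constructive_indefinite_description _ (X n)))).
  clearbody D.
  assert (C0 : exists K : R, forall n, (Cmod (D n) <= K)%R).
  { destruct (bounded_sums_scal M _ HM (bounded_sums_geom (Cmod q) Hq)) as (K & HK).
    exists K. intros n. apply (sums_bound _ _ K _ (HD n)) with (2 := HK).
    intros m; apply B; lia. }
  destruct C0 as (K & HK).
  assert (R1 : forall n, D n - D (S n) = Czpow q (Z.of_nat n + 1) * (D (S (S n)) - D (S n))).
  { intros n. apply (sums_unique (fun m => durfee_term q (Z.of_nat n) m - durfee_term q (Z.of_nat (S n)) m)).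
    - apply sums_minus; auto.
    - apply (sums_ext (fun m => Czpow q (Z.of_nat n + 1) *
        (durfee_term q (Z.of_nat (S (S n))) (m + -1)%Z - durfee_term q (Z.of_nat (S n)) m))).
      + intros m. replace (Z.of_nat (S (S n))) with (Z.of_nat n + 2)%Z by lia.
        replace (Z.of_nat (S n)) with (Z.of_nat n + 1)%Z by lia.
        symmetry. apply durfee_term_rec; auto.
      + apply sums_scal, sums_minus; auto. apply sums_shift; auto. }
  assert (R2 : forall k n, (Cmod (D n - D (S n)) <= Cmod q ^ k * (2 * K))%R).
  { induction k as [|k IH]; intros n.
    - simpl. rewrite Rmult_1_l. unfold Cminus. eapply Rle_trans; [apply Cmod_triangle|].
      rewrite Cmod_opp. pose proof (HK n); pose proof (HK (S n)); lra.
    - rewrite R1, Cmod_mult. specialize (IH (S n)).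
      replace (D (S (S n)) - D (S n)) with (- (D (S n) - D (S (S n)))) by ring.
      rewrite Cmod_opp. simpl pow. rewrite Rmult_assoc.
      apply Rmult_le_compat; auto; try apply Cmod_ge_0.
      rewrite Cmod_Czpow by auto. rewrite <- (powerRZ_1 (Cmod q)) at 2.
      apply powerRZ_anti; auto; lia. }
  assert (R3 : forall n, D n = D (S n)).
  { intros n. assert (Z0 : D n - D (S n) = 0).
    { apply Cmod_eq_0. apply Rle_antisym; [|apply Cmod_ge_0].
      apply le_epsilon. intros eps He.
      assert (HK0 : (0 <= K)%R) by (pose proof (HK O); pose proof (Cmod_ge_0 (D O)); lra).
      destruct (pow_lt_1_zero (Cmod q)) with (y := (eps / (2 * K + 1))%R) as (N & HN).
      - rewrite Rabs_pos_eq; [apply Hq|left; apply Hq].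
      - apply Rdiv_lt_0_compat; lra.
      - specialize (HN N (le_n _)).
        rewrite Rabs_pos_eq in HN by (apply pow_le; left; apply Hq).
        eapply Rle_trans; [apply (R2 N)|].
        assert (Cmod q ^ N * (2 * K + 1) < eps / (2 * K + 1) * (2 * K + 1))%R
          by (apply Rmult_lt_compat_r; lra).
        replace (eps / (2 * K + 1) * (2 * K + 1))%R with eps in H by (field; lra).
        assert (0 <= Cmod q ^ N)%R by (apply pow_le; left; apply Hq). nra. }
    replace (D n) with (D n - D (S n) + D (S n)) by ring. rewrite Z0; ring. }
  assert (R4 : forall n, D n = D O) by (induction n; congruence).
  assert (E : D O = / qinf q).
  (* As s grows, q^(m(m+s)) kills every term with m > 0, and the term m = 0 is 1/(q)_s. *)
  { destruct (sums_dominated (fun n m => durfee_term q (Z.of_nat n) m) D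
      (fun m => if Z.eq_dec m 0 then / qinf q else 0)
      (fun m => M * powerRZ (Cmod q) (Z.abs m))%R) as (S & HS & HL).
    - exact HD.
    - intros n m; apply B; lia.
    - apply bounded_sums_scal; auto. apply bounded_sums_geom, Hq.
    - intros m. destruct (Z.eq_dec m 0) as [->|Hm].
      + apply (Clim_ext (fun n => iq q (Z.of_nat n))).
        * intros n. unfold durfee_term. rewrite iq_0. simpl. ring.
        * apply iq_Clim_nz; auto.
      + destruct (iq_bound q Hq) as (M1 & HM1 & B1).
        intros eps He.
        destruct (Czpow_small q (eps / (M1 * M1 + 1))%R Hq) as (N & PN & HN).
        { apply Rdiv_lt_0_compat; nra. }
        exists (Z.to_nat N). intros n Hn.
        unfold durfee_term. destruct (Z_lt_dec m 0).
        * rewrite (iq_neg q m) by auto.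
          replace (Czpow q (m * (m + Z.of_nat n)) * (0 * iq q (m + Z.of_nat n)) - 0) with (RtoC 0) by ring.
          rewrite Cmod_0; auto.
        * specialize (HN (m * (m + Z.of_nat n))%Z ltac:(nia)).
          match goal with |- (Cmod (?x - _) < _)%R => replace (x - 0)%C with x by ring end.
          rewrite !Cmod_mult.
          assert (Cmod (iq q m) * Cmod (iq q (m + Z.of_nat n)) <= M1 * M1)%R
            by (apply Rmult_le_compat; auto; apply Cmod_ge_0).
          pose proof (Cmod_ge_0 (Czpow q (m * (m + Z.of_nat n)))).
          apply Rle_lt_trans with (Cmod (Czpow q (m * (m + Z.of_nat n))) * (M1 * M1 + 1))%R.
          { apply Rmult_le_compat_l; lra. }
          apply (Rmult_lt_compat_r (M1 * M1 + 1)) in HN; [|nra].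
          replace (eps / (M1 * M1 + 1) * (M1 * M1 + 1))%R with eps in HN by (field; nra). auto.
    - apply (sums_unique (fun m => if Z.eq_dec m 0 then / qinf q else 0)); [|apply sums_delta].
      replace (D O) with S; auto. eapply Clim_unique; [exact HL|].
      apply (Clim_ext (fun _ => D O)); [intros; auto|apply Clim_const]. }
  intros Hs. rewrite <- E, <- (R4 (Z.to_nat s)).
  replace s with (Z.of_nat (Z.to_nat s)) at 1 by lia. apply HD.
Qed.

(** In Bailey's terms, q^(n(n+c)) and q^(r(r+c))/(q)_inf form a conjugate Bailey pair relative to
    q^c; shifting n by r reduces it to Durfee rectangles with s = 2r + c. *)
Lemma durfee q (c r : Z) : nome q ->
  sums (fun n => Czpow q (n * (n + c)) * (iq q (n - r) * iq q (n + c + r)))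
       (Czpow q (r * (r + c)) * / qinf q).
Proof.
  intros Hq. assert (Hq0 := nome_nz q Hq).
  assert (P : forall r, (0 <= 2 * r + c)%Z ->
    sums (fun n => Czpow q (n * (n + c)) * (iq q (n - r) * iq q (n + c + r)))
       (Czpow q (r * (r + c)) * / qinf q)).
  { intros r0 Hr.
    apply (sums_ext (fun n => Czpow q (r0 * (r0 + c)) * durfee_term q (2 * r0 + c) (n + - r0))).
    - intros n. unfold durfee_term. rewrite Cmult_assoc, <- Czpow_add by auto.
      f_equal; [f_equal; lia|]. f_equal; f_equal; lia.
    - apply sums_scal, sums_shift, durfee_pos; auto. }
  destruct (Z_le_dec 0 (2 * r + c)) as [h|h]; [apply P; auto|].
  (* For 2r + c < 0 the reflection r -> -r - c exchanges the two reciprocal factors and fixes r(r +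
     c). *)
  specialize (P (- r - c)%Z ltac:(lia)).
  replace ((- r - c) * (- r - c + c))%Z with (r * (r + c))%Z in P by lia.
  eapply sums_ext; [|exact P]. intros n. simpl. f_equal.
  rewrite Cmult_comm. f_equal; f_equal; lia.
Qed.

(** Expand each 1/((z)_(n+1) (q/z)_(n+c)) in partial fractions and exchange the sums: the inner sum
    over n is a Durfee sum and supplies q^(r(r+c))/(q)_inf. The case c = 0 serves f_3, the case c =
    1 serves omega_3. *)
Lemma watson (q z : C) (c : nat) : nome q -> (c <= 1)%nat -> z <> 0 -> (forall m, 1 - z * Czpow q m <> 0) ->
  exists W : C,
    sums (fun n : nat => q ^ (n * (n + c)) / (qpoch z q (S n) * qpoch (q / z) q (n + c))) W /\
    sums (fun r => sgz r * Czpow q (tri (r + 1) + r * (r + Z.of_nat c)) / (1 - z * Czpow q r))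
      (W * qinf q).
Proof.
  intros Hq Hc Hz0 Hz. assert (Hq0 := nome_nz q Hq). assert (QN := qinf_nz q Hq).
  destruct (pf_term_bound q z Hq Hz0 Hz) as (M & K & HM & B).
  destruct (sums_exchange (fun p : Z * nat => q ^ (snd p * (snd p + c)) *
      pf_term q z (Z.of_nat (snd p + c)) (Z.of_nat (snd p)) (fst p))
    (fun r => pf_lim_term q z r * (Czpow q (r * (r + Z.of_nat c)) * / qinf q))
    (fun n => q ^ (n * (n + c)) / (qpoch z q (S n) * qpoch (q / z) q (n + c)))) as (W & H2 & H1).
  - apply (abs_quad2 q (Cmod q) M K Z.of_nat); auto; [apply Nat2Z.inj|].
    intros k n. simpl. rewrite Cmod_mult.
    rewrite <- Rmult_assoc, Rmult_comm.
    apply Rmult_le_compat; auto; try apply Cmod_ge_0.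
    rewrite <- Czpow_nat, Cmod_Czpow by auto. apply powerRZ_anti; auto. nia.
  - intros r. simpl.
    apply (sums_ext (fun n : nat => pf_lim_term q z r * (Czpow q (Z.of_nat n * (Z.of_nat n + Z.of_nat c))
        * (iq q (Z.of_nat n - r) * iq q (Z.of_nat n + Z.of_nat c + r))))).
    + intros n. rewrite <- Czpow_nat, Nat2Z.inj_mul, Nat2Z.inj_add. unfold pf_lim_term, pf_term.
      field. apply Hz.
    + apply sums_scal.
      apply (sums_ZtoN (fun n => Czpow q (n * (n + Z.of_nat c)) * (iq q (n - r) * iq q (n + Z.of_nat c + r)))).
      * apply durfee; auto.
      (* The arguments k - r and k + c + r add up to 2k + c, negative for k < 0 because c <= 1; so
         one of them is negative and its reciprocal factor vanishes. *)
      * intros k Hk. destruct (Z_lt_dec (k - r) 0).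
        -- rewrite (iq_neg q (k - r)) by auto. ring.
        -- rewrite (iq_neg q (k + Z.of_nat c + r)) by lia. ring.
  - intros n. unfold Cdiv. apply (sums_scal (q ^ (n * (n + c))) (pf_term q z (Z.of_nat (n + c)) (Z.of_nat n))).
    apply pf_finite; auto.
  - exists W; split; auto.
    eapply sums_eq; [|apply Cmult_comm].
    eapply sums_ext; [|apply (sums_scal (qinf q) _ _ H2)].
    intros r. simpl. unfold pf_lim_term. rewrite Czpow_add by auto. field. split; auto.
Qed.

Lemma qpoch_head x q n : qpoch x q (S n) = (1 - x) * qpoch (x * q) q n.
Proof.
  induction n as [|n IH]; [simpl; ring|].
  change (qpoch x q (S n) * (1 - q ^ S n * x) = (1 - x) * (qpoch (x * q) q n * (1 - q ^ n * (x * q)))).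
  rewrite IH. simpl. ring.
Qed.

Lemma one_plus_qpow_nz q m : nome q -> 1 + Czpow q m <> 0.
Proof.
  intros Hq E. destruct (Z.eq_dec m 0) as [->|Hm].
  - simpl in E. apply (f_equal fst) in E. simpl in E. lra.
  - apply (one_minus_qpow_nz q (2 * m) Hq ltac:(lia)).
    replace (2 * m)%Z with (m + m)%Z by lia. rewrite Czpow_add by (apply nome_nz; auto).
    transitivity ((1 + Czpow q m) * (1 - Czpow q m)); [ring|rewrite E; ring].
Qed.

Lemma f3_appell (q : C) : nome q ->
  sums (fun r => sgz r * Czpow q (tri (r + 1) + r * r) / (1 + Czpow q r))
    (qinf q * f3 q / 2).
Proof.
  intros Hq. assert (Hm : forall m, 1 - (- (1)) * Czpow q m <> 0).
  { intros m. replace (1 - (- (1)) * Czpow q m) with (1 + Czpow q m) by ring.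
    apply one_plus_qpow_nz; auto. }
  assert (H2 := C2_nz). assert (Hm1 := Copp_nz 1 C1_nz).
  destruct (watson q (- (1)) 0 Hq ltac:(lia) Hm1 Hm) as (W & H1 & HW).
  (* At z = -1 one has (z)_(n+1) = 2 (-q)_n, the origin of the factor 2. *)
  assert (E : f3 q = 2 * W).
  { unfold f3. apply sums_CSeries.
    eapply sums_ext; [|apply (sums_scal 2 _ _ H1)]. intros n. cbv beta.
    rewrite Nat.add_0_r, qpoch_head.
    replace (- (1) * q) with (- q) by ring. replace (q / - (1)) with (- q) by (field; auto).
    assert (N : qpoch (- q) q n <> 0).
    { apply qpoch_pole_nz. intros m. replace (1 - - q * Czpow q m) with (1 + Czpow q (m + 1)).
      - apply one_plus_qpow_nz; auto.
      - rewrite Czpow_succ by (apply nome_nz; auto). ring. }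
    field. exact N. }
  rewrite E. eapply sums_eq; [|instantiate (1 := W * qinf q); field; auto].
  eapply sums_ext; [|exact HW]. intros r. cbv beta. simpl Z.of_nat. rewrite Z.add_0_r.
  f_equal. ring.
Qed.

(** Base q^2 and z = -q make q^2/z equal to z, so with c = 1 both products coincide and give the
    square (-q;q^2)_(n+1)^2. *)
Lemma omega3_appell (q : C) : nome q ->
  sums (fun r => sgz r * Czpow q (3 * r * r + 3 * r) / (1 + Czpow q (2 * r + 1)))
    (qinf (q ^ 2) * omega3 (- q)).
Proof.
  intros Hq. assert (Hq0 := nome_nz q Hq). assert (Hq2 : nome (q ^ 2)) by (apply nome_pow; auto).
  assert (HP : forall m, - q * Czpow (q ^ 2) m = - Czpow q (2 * m + 1)).
  { intros m. rewrite Czpow_pow, Czpow_succ by auto. simpl Z.of_nat. ring. }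
  assert (Hm : forall m, 1 - (- q) * Czpow (q ^ 2) m <> 0).
  { intros m. rewrite HP. replace (1 - - Czpow q (2 * m + 1)) with (1 + Czpow q (2 * m + 1)) by ring.
    apply one_plus_qpow_nz; auto. }
  assert (Hm1 : - q <> 0).
  { intros E. apply Hq0. replace q with (- - q) by ring. rewrite E; ring. }
  destruct (watson (q ^ 2) (- q) 1 Hq2 ltac:(lia) Hm1 Hm) as (W & H1 & HW).
  assert (E : omega3 (- q) = W).
  { unfold omega3. apply sums_CSeries.
    eapply sums_ext; [|apply H1]. intros n. cbv beta.
    replace ((- q) ^ 2) with (q ^ 2) by (simpl; ring).
    replace (q ^ 2 / - q) with (- q) by (simpl; field; auto).
    replace (n + 1)%nat with (S n) by lia.
    replace ((- q) ^ (2 * n * S n)) with ((q ^ 2) ^ (n * S n)).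
    - assert (N := qpoch_pole_nz _ _ (S n) Hm). set (y := qpoch (- q) (q ^ 2) (S n)) in *. clearbody y.
      field. exact N.
    - rewrite <- Nat.mul_assoc, (Cpow_mult_r (- q)). f_equal. simpl; ring. }
  rewrite E. eapply sums_eq; [|apply Cmult_comm].
  eapply sums_ext; [|exact HW]. intros r. cbv beta.
  rewrite HP, Czpow_pow by auto.
  replace (Z.of_nat 2 * (tri (r + 1) + r * (r + Z.of_nat 1)))%Z with (3 * r * r + 3 * r)%Z.
  - f_equal. ring.
  - pose proof (tri_spec (r + 1)). lia.
Qed.

(** * Named sums, antisymmetry and correlation of series *)

Definition tsum {T : Type} (f : T -> C) : C := epsilon (inhabits (RtoC 0)) (sums f).

Lemma tsum_spec {T} (f : T -> C) : abs_summable f -> sums f (tsum f).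
Proof.
  intros A. unfold tsum. apply epsilon_spec. apply sums_exists; auto.
Qed.

Lemma sums_congr {T} (f g : T -> C) S S' :
  sums f S -> sums g S' -> (forall t, f t = g t) -> S = S'.
Proof. intros H H' E. apply (sums_unique g); auto. eapply sums_ext; eauto. Qed.

Lemma sums_quad (q : C) (f : Z -> C) (M : R) (K : Z) : nome q -> (0 <= M)%R ->
  (forall n, Cmod (f n) <= M * powerRZ (Cmod q) (Z.abs n - K))%R -> sums f (tsum f).
Proof. intros. apply tsum_spec, (abs_quad q M K); auto. Qed.

Lemma bounded_by_geom_symm (q : C) (h : Z -> C) (M : R) : nome q -> (0 <= M)%R ->
  (forall m, (0 <= m)%Z -> (Cmod (h m) <= M * powerRZ (Cmod q) m)%R) ->
  (forall m, Cmod (h (-1 - m)%Z) = Cmod (h m)) ->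
  forall m, (Cmod (h m) <= M * powerRZ (Cmod q) (Z.abs m - 1))%R.
Proof.
  intros Hq HM H1 H2 m. destruct (Z_le_dec 0 m).
  - eapply Rle_trans; [apply H1; auto|]. apply Rmult_le_compat_l; auto.
    apply powerRZ_anti; auto; lia.
  - replace m with (-1 - (-1 - m))%Z by lia. rewrite H2.
    eapply Rle_trans; [apply H1; lia|]. apply Rmult_le_compat_l; auto.
    apply powerRZ_anti; auto; lia.
Qed.

Lemma sums_antisymm (h : Z -> C) (S : C) :
  sums h S -> (forall m, h (-1 - m)%Z = - h m) -> S = 0.
Proof.
  intros H E. assert (H2 := sums_refl h S (-1) H).
  assert (F : S = - S).
  { apply (sums_unique _ _ _ H2). eapply sums_ext; [|apply sums_opp; exact H].
    intros t; symmetry; apply E. }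
  assert (G : 2 * S = 0) by (transitivity (S + S); [ring|rewrite F at 2; ring]).
  replace S with (/ 2 * (2 * S)) by (field; apply C2_nz).
  rewrite G; ring.
Qed.

(** The double decay required of [F] pays for the shift in [h]: since |n + k| >= |k| - |n|, the
    exponent 2|n| + |n + k| still dominates |n| + |k|. *)
Lemma sums_correlation (q : C) (F h c : Z -> C) (W S : C) (M1 M2 : R) (K K' : Z) :
  nome q -> (0 <= M1)%R -> (0 <= M2)%R ->
  (forall n, Cmod (F n) <= M1 * powerRZ (Cmod q) (2 * Z.abs n - K))%R ->
  (forall m, Cmod (h m) <= M2 * powerRZ (Cmod q) (Z.abs m - K'))%R ->
  sums F W -> sums h S ->
  (forall k, sums (fun n => F n * h (n + k)%Z) (c k)) ->
  sums c (W * S).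
Proof.
  intros Hq HM1 HM2 BF Bh HF Hh Hc.
  destruct (sums_exchange (fun p => F (fst p) * h (fst p + snd p)%Z) (fun n => F n * S) c)
    as (V & V1 & V2).
  - apply (abs_quad2 q (Cmod q) (M1 * M2 * powerRZ (Cmod q) (- K')) K (fun k => k)); auto.
    + apply Rmult_le_pos; [apply Rmult_le_pos; auto|apply powerRZ_le, Hq].
    + intros n k. simpl. rewrite Cmod_mult.
      apply Rle_trans with (M1 * powerRZ (Cmod q) (2 * Z.abs n - K) *
        (M2 * powerRZ (Cmod q) (Z.abs k - Z.abs n - K')))%R.
      * apply Rmult_le_compat; try apply Cmod_ge_0; auto.
        eapply Rle_trans; [apply Bh|]. apply Rmult_le_compat_l; auto.
        apply powerRZ_anti; auto. lia.
      * right. replace (M1 * M2 * powerRZ (Cmod q) (- K') *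
          (powerRZ (Cmod q) (Z.abs n - K) * powerRZ (Cmod q) (Z.abs k)))%R with
          (M1 * M2 * (powerRZ (Cmod q) (- K') *
          (powerRZ (Cmod q) (Z.abs n - K) * powerRZ (Cmod q) (Z.abs k))))%R by ring.
        replace (M1 * powerRZ (Cmod q) (2 * Z.abs n - K) *
          (M2 * powerRZ (Cmod q) (Z.abs k - Z.abs n - K')))%R with (M1 * M2 *
          (powerRZ (Cmod q) (2 * Z.abs n - K) *
          (powerRZ (Cmod q) (Z.abs k - Z.abs n - K'))))%R by ring.
        rewrite <- !powerRZ_add by (destruct Hq; lra). f_equal. f_equal. lia.
  - intros n. simpl. apply sums_scal.
    apply (sums_ext (fun k => h (k + n)%Z)); [intros; f_equal; lia|]. apply sums_shift; auto.
  - exact Hc.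
  - replace (W * S) with V; auto. apply (sums_unique _ _ _ V1).
    eapply sums_eq; [|apply Cmult_comm]. eapply sums_ext; [|apply (sums_scal S _ _ HF)].
    intros; simpl; ring.
Qed.

(** * Theta constants *)

(** In base q^2 the pentagonal exponents are 3 n^2 + n and 3 n^2 - n, so b = 1 and b = -1 sum to
    J_2; b = 3 sums to 0, and a shift of n moves b by 6. These cover all odd b that arise below. *)
Definition theta3 (q : C) (b n : Z) : C := sgz n * Czpow q (3 * n * n + b * n).

Lemma theta3_bound q b : nome q ->
  exists K, forall n, (Cmod (theta3 q b n) <= 1 * powerRZ (Cmod q) (2 * Z.abs n - K))%R.
Proof.
  intros Hq. exists ((2 + Z.abs b) * (2 + Z.abs b))%Z. intros n. unfold theta3.
  rewrite Cmod_mult, Cmod_sgz, Cmod_Czpow by (apply nome_nz; auto). rewrite !Rmult_1_l.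
  apply powerRZ_anti; auto. pose proof (sq_lb (2 + Z.abs b) n ltac:(lia)).
  assert (0 <= n * n)%Z by apply Z.square_nonneg.
  assert (- (Z.abs b * Z.abs n) <= b * n)%Z by (rewrite <- Z.abs_mul; lia). lia.
Qed.

Lemma theta3_bound1 q b : nome q ->
  exists K, forall n, (Cmod (theta3 q b n) <= 1 * powerRZ (Cmod q) (Z.abs n - K))%R.
Proof.
  intros Hq. destruct (theta3_bound q b Hq) as (K & HK). exists K. intros n.
  eapply Rle_trans; [apply HK|]. apply Rmult_le_compat_l; [lra|].
  apply powerRZ_anti; auto; lia.
Qed.

Lemma theta3_shift q b n : nome q ->
  theta3 q b (n + 1) = - Czpow q (3 + b) * theta3 q (b + 6) n.
Proof.
  intros Hq. unfold theta3. rewrite sgz_succ.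
  replace (3 * (n + 1) * (n + 1) + b * (n + 1))%Z with ((3 + b) + (3 * n * n + (b + 6) * n))%Z by lia.
  rewrite Czpow_add by (apply nome_nz; auto). ring.
Qed.

Lemma theta3_next q b S : nome q -> sums (theta3 q b) S ->
  sums (theta3 q (b + 6)) (- Czpow q (- (3 + b)) * S).
Proof.
  intros Hq H. assert (Hq0 := nome_nz q Hq). assert (N := Czpow_nz q (3 + b) Hq0).
  eapply sums_eq; [apply (sums_div _ (- Czpow q (3 + b)))|].
  - apply Copp_nz; auto.
  - apply (sums_ext (fun n => theta3 q b (n + 1))); [intros; apply theta3_shift; auto|].
    apply sums_shift; exact H.
  - rewrite Czpow_opp by auto. field; auto.
Qed.

Lemma theta3_m1 q : nome q -> sums (theta3 q (-1)) (qinf (q ^ 2)).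
Proof.
  intros Hq. assert (Hq0 := nome_nz q Hq). assert (Hq2 : nome (q ^ 2)) by (apply nome_pow; auto).
  assert (Hq6 : nome ((q ^ 2) ^ 3)) by (apply nome_pow; auto).
  rewrite <- pentagonal by auto.
  eapply sums_ext; [|apply j_sums; auto; apply nome_nz; auto].
  intros n. unfold j_term, theta3. rewrite Czpow_pow, !Czpow_pow by (auto; apply nome_nz; auto).
  rewrite <- Cmult_assoc, <- Czpow_add by auto. f_equal. f_equal.
  pose proof (tri_spec n). lia.
Qed.

Lemma theta3_neg q b S : sums (theta3 q b) S -> sums (theta3 q (- b)) S.
Proof.
  intros H. eapply sums_ext; [|apply sums_neg; exact H].
  intros n. unfold theta3. rewrite sgz_opp. f_equal. f_equal. lia.
Qed.

Lemma theta3_1 q : nome q -> sums (theta3 q 1) (qinf (q ^ 2)).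
Proof. intros Hq. apply (theta3_neg q (-1)), theta3_m1; auto. Qed.

Lemma theta3_3 q : nome q -> sums (theta3 q 3) 0.
Proof.
  intros Hq. destruct (theta3_bound1 q 3 Hq) as (K & HK).
  assert (H := sums_quad q _ 1 K Hq ltac:(lra) HK).
  eapply sums_eq; [exact H|]. apply (sums_antisymm _ _ H).
  intros m. unfold theta3. replace (-1 - m)%Z with (- (m + 1))%Z by lia.
  rewrite sgz_opp, sgz_succ. replace (3 * - (m + 1) * - (m + 1) + 3 * - (m + 1))%Z with
   (3 * m * m + 3 * m)%Z by lia. ring.
Qed.

(** * The two mock theta sequences *)

(** Equals 1/(q^m + q^(-m)), half a hyperbolic secant. This normalization makes the kernel of the
    Appell sum of f_3(q^2) even in m. *)
Definition sech (q : C) (m : Z) : C := Czpow q m / (1 + Czpow q (2 * m)).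

(* Solutions of the recurrence of the Laurent coefficients of the character, with
   inhomogeneous terms proportional to those attached to num(q) and num(q^2); at k = 0 they
   are J_2 f_3(q^2) / 2 and J_2 omega_3(-q). *)
Definition f3_seq (q : C) (k : Z) : C := tsum (fun n => theta3 q 0 n * sech q (n + k)).

Definition omega3_seq (q : C) (k : Z) : C :=
  tsum (fun n => theta3 q 3 n / (1 + Czpow q (2 * (n + k) + 1))).

Lemma plus_distance q : nome q ->
  exists d, (0 < d)%R /\ forall m, (d <= Cmod (1 + Czpow q m))%R.
Proof.
  intros Hq. destruct (pole_distance q (- (1)) Hq) as (d & Hd & H).
  - intros m. replace (1 - - (1) * Czpow q m) with (1 + Czpow q m) by ring.
    apply one_plus_qpow_nz; auto.
  - exists d; split; auto. intros m. specialize (H m).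
    replace (1 - - (1) * Czpow q m) with (1 + Czpow q m) in H by ring. auto.
Qed.

Lemma sech_even q m : nome q -> sech q (- m) = sech q m.
Proof.
  intros Hq. assert (Hq0 := nome_nz q Hq). unfold sech.
  replace (2 * - m)%Z with (- (2 * m))%Z by lia. rewrite !Czpow_opp by auto.
  replace (2 * m)%Z with (m + m)%Z by lia. rewrite Czpow_add by auto.
  assert (N := one_plus_qpow_nz q (2 * m) Hq).
  replace (2 * m)%Z with (m + m)%Z in N by lia. rewrite Czpow_add in N by auto.
  assert (N' := Czpow_nz q m Hq0). rewrite Cplus_comm in N.
  field. repeat split; auto. rewrite Cplus_comm. auto.
Qed.

Lemma sech_bound q : nome q -> exists M, (0 <= M)%R /\
  forall m, (Cmod (sech q m) <= M * powerRZ (Cmod q) (Z.abs m))%R.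
Proof.
  intros Hq. destruct (plus_distance q Hq) as (d & Hd & H).
  exists (/ d)%R. split; [left; apply Rinv_0_lt_compat; auto|].
  assert (P : forall m, (0 <= m)%Z -> (Cmod (sech q m) <= / d * powerRZ (Cmod q) m)%R).
  { intros m Hm. unfold sech. rewrite Cmod_div by (apply one_plus_qpow_nz; auto).
    rewrite Cmod_Czpow by (apply nome_nz; auto). unfold Rdiv. rewrite Rmult_comm.
    apply Rmult_le_compat_r; [apply powerRZ_le, Hq|]. apply Rinv_le_contravar; auto. }
  intros m. destruct (Z_le_dec 0 m).
  - rewrite Z.abs_eq by auto. auto.
  - rewrite <- sech_even by auto. rewrite Z.abs_neq by lia. apply P; lia.
Qed.

Lemma f3_seq_sums q k : nome q -> sums (fun n => theta3 q 0 n * sech q (n + k)) (f3_seq q k).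
Proof.
  intros Hq. destruct (theta3_bound1 q 0 Hq) as (K & HK).
  destruct (sech_bound q Hq) as (M & HM & B).
  apply (sums_quad q _ M K); auto. intros n. rewrite Cmod_mult, Rmult_comm.
  apply Rmult_le_compat; try apply Cmod_ge_0.
  - eapply Rle_trans; [apply B|]. rewrite <- (Rmult_1_r M) at 2.
    apply Rmult_le_compat_l; auto. apply powerRZ_le1; auto. lia.
  - specialize (HK n). lra.
Qed.

Lemma omega3_seq_sums q k : nome q ->
  sums (fun n => theta3 q 3 n / (1 + Czpow q (2 * (n + k) + 1))) (omega3_seq q k).
Proof.
  intros Hq. destruct (theta3_bound1 q 3 Hq) as (K & HK).
  destruct (plus_distance q Hq) as (d & Hd & B).
  apply (sums_quad q _ (/ d) K); auto; [left; apply Rinv_0_lt_compat; auto|].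
  intros n. rewrite Cmod_div, Rmult_comm by (apply one_plus_qpow_nz; auto).
  unfold Rdiv. rewrite (Rmult_comm (Cmod _)), (Rmult_comm (powerRZ _ _)).
  apply Rmult_le_compat; try apply Cmod_ge_0.
  - left; apply Rinv_0_lt_compat, Cmod_gt_0, one_plus_qpow_nz; auto.
  - apply Rinv_le_contravar; auto.
  - specialize (HK n). lra.
Qed.

Lemma f3_seq_0 q : nome q -> f3_seq q 0 = qinf (q ^ 2) * f3 (q ^ 2) / 2.
Proof.
  intros Hq. assert (Hq0 := nome_nz q Hq).
  apply (sums_unique _ _ _ (f3_seq_sums q 0 Hq)).
  eapply sums_ext; [|apply f3_appell; apply nome_pow; auto].
  intros n. unfold theta3, sech. rewrite !Czpow_pow, (Z.add_0_r n) by auto.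
  replace (Z.of_nat 2 * (tri (n + 1) + n * n))%Z with (3 * n * n + 0 * n + n)%Z
    by (pose proof (tri_spec (n + 1)); lia).
  rewrite (Czpow_add q (3 * n * n + 0 * n)) by auto. change (Z.of_nat 2) with 2%Z.
  field. apply one_plus_qpow_nz; auto.
Qed.

Lemma omega3_seq_0 q : nome q -> omega3_seq q 0 = qinf (q ^ 2) * omega3 (- q).
Proof.
  intros Hq. apply (sums_unique _ _ _ (omega3_seq_sums q 0 Hq)).
  eapply sums_ext; [|apply omega3_appell; auto].
  intros n. unfold theta3. rewrite (Z.add_0_r n). reflexivity.
Qed.

(** Put x = q^(n+k). Shifting n in the series for k - 1 turns the difference of the two sides into
    the kernel times 1 + x^6, and x (1 + x^6)/(1 + x^2) = x - x^3 + x^5 has no denominator. The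
    three monomials are theta constants with b = 1, 3, 5, of which the middle one vanishes. *)
Lemma f3_seq_rec q k : nome q -> f3_seq q k =
  Czpow q (6 * k - 3) * f3_seq q (k - 1) + qinf (q ^ 2) * (Czpow q k - Czpow q (5 * k - 2)).
Proof.
  intros Hq. assert (Hq0 := nome_nz q Hq).
  assert (H := sums_shift _ _ 1 (f3_seq_sums q (k - 1) Hq)).
  assert (H1 := sums_minus _ _ _ _ (f3_seq_sums q k Hq) (sums_scal (Czpow q (6 * k - 3)) _ _ H)).
  assert (H5 := theta3_next q (-1) _ Hq (theta3_m1 q Hq)).
  assert (H2 := sums_plus _ _ _ _
     (sums_minus _ _ _ _ (sums_scal (Czpow q k) _ _ (theta3_1 q Hq))
        (sums_scal (Czpow q (3 * k)) _ _ (theta3_3 q Hq)))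
     (sums_scal (Czpow q (5 * k)) _ _ H5)).
  lapply (sums_congr _ _ _ _ H1 H2); [intros E|intros n].
  - replace (5 * k - 2)%Z with (5 * k + - (3 + -1))%Z by lia. rewrite Czpow_add by auto.
    rewrite <- (Cplus_0_r (f3_seq q k)).
    match type of E with ?a - ?b = ?c => transitivity (b + c); [rewrite <- E; ring|] end. ring.
  - cbv beta. rewrite theta3_shift by auto. unfold theta3, sech.
    replace (n + 1 + (k - 1))%Z with (n + k)%Z by lia.
    assert (N := one_plus_qpow_nz q (2 * (n + k)) Hq).
    replace (2 * (n + k))%Z with ((n + k) + (n + k))%Z in * by lia.
    replace (6 * k - 3)%Z with (k + k + k + k + k + k + - (3))%Z by lia.
    replace (3 * k)%Z with (k + k + k)%Z by lia.
    replace (5 * k)%Z with (k + k + k + k + k)%Z by lia.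
    replace ((0 + 6) * n)%Z with (n + n + n + n + n + n)%Z by lia.
    replace ((-1 + 6) * n)%Z with (n + n + n + n + n)%Z by lia.
    replace (3 * n)%Z with (n + n + n)%Z by lia.
    replace (1 * n)%Z with n by lia. replace (0 * n)%Z with 0%Z by lia.
    rewrite !Czpow_add, Czpow_opp, !Czpow_add, Czpow_0 in * by auto.
    assert (Nk := Czpow_nz q k Hq0). assert (Nn := Czpow_nz q n Hq0).
    assert (N3 := Czpow_nz q 3 Hq0).
    set (a := Czpow q k) in *. set (b := Czpow q n) in *. set (c := Czpow q 3) in *.
    clearbody a b c. field. auto.
Qed.

(** Same mechanism with y = q^(2(n+k)+1): (1 + y^3)/(1 + y) = 1 - y + y^2 leaves theta constants
    with b = 3, 5, 7, and the first one vanishes. *)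
Lemma omega3_seq_rec q k : nome q -> omega3_seq q k =
  Czpow q (6 * k - 3) * omega3_seq q (k - 1) + qinf (q ^ 2) * (Czpow q (2 * k - 1) - Czpow q (4 * k - 2)).
Proof.
  intros Hq. assert (Hq0 := nome_nz q Hq).
  assert (H := sums_shift _ _ 1 (omega3_seq_sums q (k - 1) Hq)).
  assert (H1 := sums_minus _ _ _ _ (omega3_seq_sums q k Hq) (sums_scal (Czpow q (6 * k - 3)) _ _ H)).
  assert (H5 := theta3_next q (-1) _ Hq (theta3_m1 q Hq)).
  assert (H7 := theta3_next q 1 _ Hq (theta3_1 q Hq)).
  assert (H2 := sums_plus _ _ _ _
     (sums_minus _ _ _ _ (theta3_3 q Hq)
        (sums_scal (Czpow q (2 * k + 1)) _ _ H5))
     (sums_scal (Czpow q (4 * k + 2)) _ _ H7)).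
  lapply (sums_congr _ _ _ _ H1 H2); [intros E|intros n].
  - replace (2 * k - 1)%Z with (2 * k + 1 + - (3 + -1))%Z by lia.
    replace (4 * k - 2)%Z with (4 * k + 2 + - (3 + 1))%Z by lia.
    rewrite !(Czpow_add q _ (- _)) by auto.
    rewrite <- (Cplus_0_r (omega3_seq q k)).
    match type of E with ?a - ?b = ?c => transitivity (b + c); [rewrite <- E; ring|] end. ring.
  - cbv beta. rewrite theta3_shift by auto. unfold theta3.
    replace (n + 1 + (k - 1))%Z with (n + k)%Z by lia.
    assert (N := one_plus_qpow_nz q (2 * (n + k) + 1) Hq).
    replace (2 * (n + k) + 1)%Z with ((n + k) + (n + k) + 1)%Z in * by lia.
    replace (6 * k - 3)%Z with (k + k + k + k + k + k + - (1 + 1 + 1))%Z by lia.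
    replace (2 * k + 1)%Z with (k + k + 1)%Z by lia.
    replace (4 * k + 2)%Z with (k + k + k + k + 1 + 1)%Z by lia.
    replace ((3 + 6) * n)%Z with (n + n + n + n + n + n + n + n + n)%Z by lia.
    replace ((-1 + 6) * n)%Z with (n + n + n + n + n)%Z by lia.
    replace ((1 + 6) * n)%Z with (n + n + n + n + n + n + n)%Z by lia.
    replace (3 + 3)%Z with (1 + 1 + 1 + 1 + 1 + 1)%Z by lia.
    replace (3 * n)%Z with (n + n + n)%Z by lia.
    rewrite !Czpow_add, Czpow_opp, !Czpow_add, !Czpow_1 in * by auto.
    assert (Nk := Czpow_nz q k Hq0). assert (Nn := Czpow_nz q n Hq0).
    set (a := Czpow q k) in *. set (b := Czpow q n) in *.
    clearbody a b. field. auto.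
Qed.

(** Moving the factor (-q)^(-n) into the theta weight makes the summand a correlation of q^(3n^2-n)
    with a kernel [h] that is odd under m -> -1 - m, so the total is a product with a vanishing
    factor. *)
Lemma f3_seq_eval q : nome q ->
  sums (fun k => Czpow (- q) k * (f3_seq q k - q * f3_seq q (k + 1))) 0.
Proof.
  intros Hq. assert (Hq0 := nome_nz q Hq).
  destruct (plus_distance q Hq) as (d & Hd & B).
  (* For m -> -infinity both (-q)^m sech(m) and q (-q)^m sech(m+1) have modulus tending to 1. The
     closed form of their difference shows its decay on both sides as well as its antisymmetry. *)
  set (h := fun m => sgz m * (1 - q * q) * Czpow q (2 * m) /
     ((1 + Czpow q (2 * m)) * (1 + Czpow q (2 * m + 2)))).
  assert (Eh : forall m, h m = Czpow (- q) m * (sech q m - q * sech q (m + 1))).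
  { intros m. unfold h, sech. rewrite Czpow_neg by auto.
    assert (N := one_plus_qpow_nz q (2 * m) Hq).
    assert (N2 := one_plus_qpow_nz q (2 * m + 2) Hq).
    replace (2 * (m + 1))%Z with (2 * m + 2)%Z by lia.
    replace (2 * m + 2)%Z with (m + m + 1 + 1)%Z in * by lia.
    replace (2 * m)%Z with (m + m)%Z in * by lia.
    rewrite !Czpow_add, !Czpow_1 in * by auto.
    field; auto. }
  assert (As : forall m, h (-1 - m)%Z = - h m).
  { intros m. unfold h.
    replace (-1 - m)%Z with (- (m + 1))%Z by lia. rewrite sgz_opp, sgz_succ.
    assert (N := one_plus_qpow_nz q (2 * m) Hq).
    assert (N2 := one_plus_qpow_nz q (2 * m + 2) Hq).
    replace (2 * - (m + 1) + 2)%Z with (- (m + m))%Z by lia.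
    replace (2 * - (m + 1))%Z with (- (m + m + 1 + 1))%Z by lia.
    replace (2 * m + 2)%Z with (m + m + 1 + 1)%Z in * by lia.
    replace (2 * m)%Z with (m + m)%Z in * by lia.
    rewrite !Czpow_opp, !Czpow_add, !Czpow_1 in * by auto.
    assert (Nm := Czpow_nz q m Hq0). set (a := Czpow q m) in *. clearbody a.
    field. rewrite Cplus_comm in N. rewrite Cplus_comm in N2. repeat split; auto;
    rewrite Cplus_comm; auto. }
  set (M := (Cmod (1 - q * q) * (/ d * / d))%R).
  assert (HM : (0 <= M)%R).
  { apply Rmult_le_pos; [apply Cmod_ge_0|]. apply Rmult_le_pos; left; apply Rinv_0_lt_compat; auto. }
  assert (Bh : forall m, (Cmod (h m) <= M * powerRZ (Cmod q) (Z.abs m - 1))%R).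
  { apply bounded_by_geom_symm; auto.
    - intros m Hm. unfold h.
      assert (N := one_plus_qpow_nz q (2 * m) Hq).
      assert (N2 := one_plus_qpow_nz q (2 * m + 2) Hq).
      rewrite Cmod_div by (apply Cmult_neq_0; auto).
      rewrite !Cmod_mult, Cmod_sgz, Cmod_Czpow, Rmult_1_l by auto.
      unfold M, Rdiv. rewrite Rinv_mult.
      rewrite !Rmult_assoc. apply Rmult_le_compat_l; [apply Cmod_ge_0|].
      rewrite (Rmult_comm (powerRZ _ _)), <- !Rmult_assoc.
      apply Rmult_le_compat.
      + rewrite <- Rinv_mult, <- Cmod_mult. left. apply Rinv_0_lt_compat, Cmod_gt_0, Cmult_neq_0; auto.
      + apply powerRZ_le, Hq.
      + apply Rmult_le_compat.
        * left; apply Rinv_0_lt_compat, Cmod_gt_0; auto.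
        * left; apply Rinv_0_lt_compat, Cmod_gt_0; auto.
        * apply Rinv_le_contravar; auto.
        * apply Rinv_le_contravar; auto.
      + apply powerRZ_anti; auto; lia.
    - intros m. rewrite As, Cmod_opp. auto. }
  assert (Hh := sums_quad q h M 1 Hq HM Bh).
  rewrite (sums_antisymm _ _ Hh As) in Hh.
  destruct (theta3_bound q (-1) Hq) as (K & HK).
  assert (HF : sums (fun n => sgz n * theta3 q (-1) n) (tsum (fun n => sgz n * theta3 q (-1) n))).
  { apply (sums_quad q _ 1 K); auto; [lra|]. intros n. rewrite Cmod_mult, Cmod_sgz, Rmult_1_l.
    eapply Rle_trans; [apply HK|]. apply Rmult_le_compat_l; [lra|]. apply powerRZ_anti; auto; lia. }
  eapply sums_eq; [eapply (sums_correlation q (fun n => sgz n * theta3 q (-1) n) h _ _ _ 1 M K 1 Hq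
    ltac:(lra) HM _ Bh HF Hh)|ring].
  Unshelve.
  2:{ intros n. cbv beta. rewrite Cmod_mult, Cmod_sgz, Rmult_1_l. apply HK. }
  intros k.
  assert (H1 := sums_scal (Czpow (- q) k) _ _
    (sums_minus _ _ _ _ (f3_seq_sums q k Hq) (sums_scal q _ _ (f3_seq_sums q (k + 1) Hq)))).
  eapply sums_ext; [|exact H1]. intros n. cbv beta. rewrite Eh.
  rewrite !Czpow_neg by auto. unfold theta3.
  replace (n + k + 1)%Z with (n + (k + 1))%Z by lia.
  rewrite sgz_add, (Czpow_add q n k) by auto.
  replace (3 * n * n + -1 * n)%Z with (3 * n * n + 0 * n + - n)%Z by lia.
  rewrite (Czpow_add q (3 * n * n + 0 * n)), Czpow_opp by auto.
  assert (E := sgz_sq n). assert (Nn := Czpow_nz q n Hq0).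
  set (u := sech q (n + k) - q * sech q (n + (k + 1))).
  transitivity (sgz n * Czpow q (3 * n * n + 0 * n) * (sgz k * Czpow q k * u)); [unfold u; ring|].
  transitivity ((sgz n * sgz n) * (sgz n * Czpow q (3 * n * n + 0 * n) * (sgz k * Czpow q k * u)));
    [rewrite E; ring|field; auto].
Qed.

(** The kernel (-q)^m/(1 + q^(2m+1)) decays on both sides by itself and is odd under m -> -1 - m.
    Hence the sum of (-q)^k Y_k is already 0, and the part with k + 1 is a shifted copy of it. *)
Lemma omega3_seq_eval q : nome q ->
  sums (fun k => Czpow (- q) k * (omega3_seq q k - q * omega3_seq q (k + 1))) 0.
Proof.
  intros Hq. assert (Hq0 := nome_nz q Hq).
  assert (Hnq := Copp_nz q Hq0).
  destruct (plus_distance q Hq) as (d & Hd & B).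
  set (h := fun m => sgz m * Czpow q m / (1 + Czpow q (2 * m + 1))).
  assert (As : forall m, h (-1 - m)%Z = - h m).
  { intros m. unfold h.
    replace (-1 - m)%Z with (- (m + 1))%Z by lia. rewrite sgz_opp, sgz_succ.
    assert (N := one_plus_qpow_nz q (2 * m + 1) Hq).
    replace (2 * - (m + 1) + 1)%Z with (- (m + m + 1))%Z by lia.
    replace (2 * m + 1)%Z with (m + m + 1)%Z in * by lia.
    rewrite !Czpow_opp, !Czpow_add, !Czpow_1 in * by auto.
    assert (Nm := Czpow_nz q m Hq0). set (a := Czpow q m) in *. clearbody a.
    field. rewrite Cplus_comm in N. repeat split; auto;
    rewrite Cplus_comm; auto. }
  assert (HM : (0 <= / d)%R) by (left; apply Rinv_0_lt_compat; auto).
  assert (Bh : forall m, (Cmod (h m) <= / d * powerRZ (Cmod q) (Z.abs m - 1))%R).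
  { apply bounded_by_geom_symm; auto.
    - intros m Hm. unfold h. assert (N := one_plus_qpow_nz q (2 * m + 1) Hq).
      rewrite Cmod_div, Cmod_mult, Cmod_sgz, Cmod_Czpow, Rmult_1_l by auto.
      unfold Rdiv. rewrite Rmult_comm. apply Rmult_le_compat_r; [apply powerRZ_le, Hq|].
      apply Rinv_le_contravar; auto.
    - intros m. rewrite As, Cmod_opp. auto. }
  assert (Hh := sums_quad q h (/ d) 1 Hq HM Bh).
  rewrite (sums_antisymm _ _ Hh As) in Hh.
  destruct (theta3_bound q 2 Hq) as (K & HK).
  assert (HF : sums (fun n => sgz n * theta3 q 2 n) (tsum (fun n => sgz n * theta3 q 2 n))).
  { apply (sums_quad q _ 1 K); auto; [lra|]. intros n. rewrite Cmod_mult, Cmod_sgz, Rmult_1_l.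
    eapply Rle_trans; [apply HK|]. apply Rmult_le_compat_l; [lra|]. apply powerRZ_anti; auto; lia. }
  assert (H0 : sums (fun k => Czpow (- q) k * omega3_seq q k) 0).
  { eapply sums_eq; [eapply (sums_correlation q (fun n => sgz n * theta3 q 2 n) h _ _ _ 1 (/ d) K 1 Hq
      ltac:(lra) HM _ Bh HF Hh)|ring].
    Unshelve.
    2:{ intros n. cbv beta. rewrite Cmod_mult, Cmod_sgz, Rmult_1_l. apply HK. }
    intros k. eapply sums_ext; [|exact (sums_scal (Czpow (- q) k) _ _ (omega3_seq_sums q k Hq))].
    intros n. cbv beta. unfold h. rewrite Czpow_neg by auto. unfold theta3.
    assert (N := one_plus_qpow_nz q (2 * (n + k) + 1) Hq).
    rewrite sgz_add, (Czpow_add q n k) by auto.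
    replace (3 * n * n + 2 * n)%Z with (3 * n * n + 3 * n + - n)%Z by lia.
    rewrite (Czpow_add q (3 * n * n + 3 * n)), Czpow_opp by auto.
    assert (E := sgz_sq n). assert (Nn := Czpow_nz q n Hq0).
    set (u := 1 + Czpow q (2 * (n + k) + 1)) in *.
    transitivity ((sgz n * sgz n) * (sgz k * Czpow q k * (sgz n * Czpow q (3 * n * n + 3 * n) / u)));
      [rewrite E; ring|field; auto]. }
  eapply sums_eq; [|instantiate (1 := 0 + 0); ring].
  eapply sums_ext; [|apply (sums_plus _ _ _ _ H0 (sums_shift _ _ 1 H0))].
  intros k. cbv beta. rewrite (Czpow_succ (- q)) by auto. ring.
Qed.

(** * Laurent coefficients of J_1^3 / j(z;q) *)

(** Its sum is a partial theta function: expanding 1/(1 - q^n z) geometrically for n >= 0, this is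
    what the partial fractions of index n >= 0 contribute to z^l. *)
Definition alpha_term (q : C) (l n : Z) : C :=
  if Z_lt_dec n 0 then 0 else sgz n * Czpow q (tri (n + 1) + n * l).

Definition alpha (q : C) (l : Z) : C := tsum (alpha_term q l).

(* The coefficient of z^l in (q)_inf^3 / j(z;q) for |q| < |z| < 1. *)
Definition jinv_coef (q : C) (l : Z) : C :=
  if Z_le_dec 0 l then alpha q l else Czpow q (- l) * alpha q (- l).

Definition zstep (l : Z) : C := if Z_le_dec 0 l then 1 else 0.

(** Subtracting the coefficients of 1/(1 - z), which carries the only pole with |q| < |z| < 1/|q|,
    leaves coefficients that decay in both directions. *)
Definition jinv_coef_reg (q : C) (l : Z) : C := jinv_coef q l - zstep l.

Lemma alpha_term_bound q l n : nome q -> (0 <= l)%Z ->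
  (Cmod (alpha_term q l n) <= powerRZ (Cmod q) (Z.abs n))%R.
Proof.
  intros Hq Hl. unfold alpha_term. destruct (Z_lt_dec n 0).
  - rewrite Cmod_0. apply powerRZ_le, Hq.
  - rewrite Cmod_mult, Cmod_sgz, Cmod_Czpow, Rmult_1_l by (apply nome_nz; auto).
    apply powerRZ_anti; auto. pose proof (tri_spec (n + 1)). nia.
Qed.

Lemma alpha_sums q l : nome q -> (0 <= l)%Z -> sums (alpha_term q l) (alpha q l).
Proof.
  intros Hq Hl. apply tsum_spec, (abs_geom (Cmod q) 1); auto; [lra|].
  intros n. rewrite Rmult_1_l. apply alpha_term_bound; auto.
Qed.

Lemma alpha_rec q l : nome q -> (0 <= l)%Z -> alpha q l = 1 - Czpow q (l + 1) * alpha q (l + 1).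
Proof.
  intros Hq Hl. assert (Hq0 := nome_nz q Hq).
  assert (H := sums_plus _ _ _ _ (alpha_sums q l Hq Hl)
    (sums_scal (Czpow q (l + 1)) _ _ (sums_shift _ _ (-1) (alpha_sums q (l + 1) Hq ltac:(lia))))).
  assert (H0 := sums_delta 0%Z 1).
  lapply (sums_congr _ _ _ _ H H0).
  - simpl. intros E. rewrite <- E. ring.
  - intros n. cbv beta. unfold alpha_term. destruct (Z.eq_dec n 0) as [->|Hn].
    + destruct (Z_lt_dec 0 0); [lia|]. destruct (Z_lt_dec (0 + -1) 0); [|lia].
      replace (tri (0 + 1) + 0 * l)%Z with 0%Z by reflexivity. unfold sgz. simpl. ring.
    + destruct (Z_lt_dec n 0); destruct (Z_lt_dec (n + -1) 0); try lia; [ring|].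
      replace (tri (n + 1) + n * l)%Z with ((l + 1) + (tri (n + -1 + 1) + (n + -1) * (l + 1)))%Z.
      * rewrite (Czpow_add q (l + 1)) by auto.
        assert (Es : sgz (n + -1) = - sgz n) by exact (sgz_pred n). rewrite Es. ring.
      * pose proof (tri_spec (n + 1)). pose proof (tri_spec (n + -1 + 1)). lia.
Qed.

Lemma alpha_bound q : nome q -> exists M, (0 <= M)%R /\
  forall l, (0 <= l)%Z -> (Cmod (alpha q l) <= M)%R.
Proof.
  intros Hq. destruct (bounded_sums_geom (Cmod q) Hq) as (M & HM).
  assert (B : forall l, (0 <= l)%Z -> (Cmod (alpha q l) <= M)%R).
  { intros l Hl. apply (sums_bound _ _ M _ (alpha_sums q l Hq Hl)) with (2 := HM).
    intros n. apply alpha_term_bound; auto. }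
  exists M; split; auto. eapply Rle_trans; [apply Cmod_ge_0|apply (B 0%Z); lia].
Qed.

(** The coefficient form of P(qz) = -z P(z) for P(z) = (q)_inf^3 / j(z;q). The constant 1 is the
    jump of all coefficients when |z| crosses the pole at z = 1. *)
Lemma jinv_coef_rec q l : nome q -> jinv_coef q l = 1 - Czpow q (l + 1) * jinv_coef q (l + 1).
Proof.
  intros Hq. assert (Hq0 := nome_nz q Hq). unfold jinv_coef.
  destruct (Z_le_dec 0 l); destruct (Z_le_dec 0 (l + 1)); try lia.
  - apply alpha_rec; auto.
  (* At l = -1 the two branches of [jinv_coef] meet, and both sides reduce to the recurrence of
     [alpha] at 0. *)
  - replace l with (-1)%Z by lia. simpl Z.add. simpl Z.opp.
    rewrite (alpha_rec q 0) by (auto; lia). simpl (0 + 1)%Z. rewrite Czpow_0, Czpow_1. ring.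
  - rewrite (alpha_rec q (- (l + 1))) by (auto; lia).
    replace (- (l + 1) + 1)%Z with (- l)%Z by lia.
    rewrite (Czpow_opp q (l + 1)) by auto. assert (N := Czpow_nz q (l + 1) Hq0). field; auto.
Qed.

Lemma jinv_coef_bound q : nome q -> exists M, (0 <= M)%R /\
  forall l, (Cmod (jinv_coef_reg q l) <= M * powerRZ (Cmod q) (Z.abs l))%R /\ (Cmod (jinv_coef q l) <= M)%R.
Proof.
  intros Hq. assert (Hq0 := nome_nz q Hq). destruct (alpha_bound q Hq) as (M & HM & B).
  exists M; split; auto. intros l. unfold jinv_coef_reg, zstep. split.
  - destruct (Z_le_dec 0 l).
    + rewrite jinv_coef_rec by auto. unfold jinv_coef. destruct (Z_le_dec 0 (l + 1)); [|lia].
      replace (1 - Czpow q (l + 1) * alpha q (l + 1) - 1) with (- (alpha q (l + 1) * Czpow q (l + 1))) by ring.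
      rewrite Cmod_opp, Cmod_mult, Cmod_Czpow by auto.
      apply Rmult_le_compat; try apply Cmod_ge_0; [apply powerRZ_le, Hq|apply B; lia|].
      apply powerRZ_anti; auto; lia.
    + unfold jinv_coef. destruct (Z_le_dec 0 l); [lia|].
      replace (Czpow q (- l) * alpha q (- l) - 0) with (alpha q (- l) * Czpow q (- l)) by ring.
      rewrite Cmod_mult, Cmod_Czpow by auto.
      apply Rmult_le_compat; try apply Cmod_ge_0; [apply powerRZ_le, Hq|apply B; lia|].
      apply powerRZ_anti; auto; lia.
  - unfold jinv_coef. destruct (Z_le_dec 0 l); [apply B; auto|].
    rewrite Cmod_mult, Cmod_Czpow by auto. rewrite <- (Rmult_1_l M).
    apply Rmult_le_compat; try apply Cmod_ge_0; [apply powerRZ_le, Hq| |apply B; lia].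
    apply powerRZ_le1; auto; lia.
Qed.

(** * Laurent expansion of the partial fractions in the annulus *)

Definition annulus (q z : C) : Prop := (Cmod q < Cmod z < / Cmod q)%R.

Lemma annulus_nz q (z : C) : nome q -> annulus q z -> z <> 0.
Proof. intros Hq [H _]. apply Cmod_gt_0. destruct Hq; lra. Qed.

Lemma annulus_pole q (z : C) : nome q -> annulus q z -> z <> 1 -> forall m, 1 - z * Czpow q m <> 0.
Proof.
  intros Hq Hz H1 m E. assert (Hq0 := nome_nz q Hq).
  assert (E1 : z * Czpow q m = 1) by (replace (z * Czpow q m) with (1 - (1 - z * Czpow q m)) by ring;
    rewrite E; ring).
  destruct (Z.eq_dec m 0) as [->|Hm].
  { apply H1. rewrite Czpow_0, Cmult_1_r in E1. auto. }
  assert (E2 : (Cmod z * powerRZ (Cmod q) m = 1)%R)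
    by (rewrite <- Cmod_Czpow, <- Cmod_mult, E1 by auto; apply Cmod_1).
  destruct Hz as [Hz1 Hz2]. destruct (Z_lt_dec 0 m).
  - assert (A : (powerRZ (Cmod q) m <= Cmod q)%R).
    { rewrite <- (powerRZ_1 (Cmod q)) at 2. apply powerRZ_anti; auto; lia. }
    assert (B : (0 < powerRZ (Cmod q) m)%R) by (apply powerRZ_lt, Hq).
    assert (Cmod z * powerRZ (Cmod q) m <= Cmod z * Cmod q)%R
      by (apply Rmult_le_compat_l; auto; apply Cmod_ge_0).
    assert (Cmod z * Cmod q < / Cmod q * Cmod q)%R by (apply Rmult_lt_compat_r; auto; apply Hq).
    rewrite Rinv_l in H0 by (destruct Hq; lra). lra.
  - assert (A : (/ Cmod q <= powerRZ (Cmod q) m)%R).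
    { replace (/ Cmod q)%R with (powerRZ (Cmod q) (-1)) by (simpl; field; destruct Hq; lra).
      apply powerRZ_anti; auto; lia. }
    assert (B : (0 < / Cmod q)%R) by (apply Rinv_0_lt_compat, Hq).
    assert (Cmod q * / Cmod q = 1)%R by (apply Rinv_r; destruct Hq; lra).
    assert (Cmod q * / Cmod q < Cmod z * / Cmod q)%R by (apply Rmult_lt_compat_r; auto).
    assert (Cmod z * / Cmod q <= Cmod z * powerRZ (Cmod q) m)%R
      by (apply Rmult_le_compat_l; auto; apply Cmod_ge_0). lra.
Qed.

(** One ratio r < 1 that majorizes q, qz and q/z at once; strictness of the annulus is what keeps it
    below 1. *)
Lemma annulus_ratio q z : nome q -> annulus q z -> exists r, (0 < r < 1)%R /\
  (Cmod q <= r)%R /\ (Cmod q * Cmod z <= r)%R /\ (Cmod q * / Cmod z <= r)%R.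
Proof.
  intros Hq [Hz1 Hz2].
  assert (Z0 : (0 < Cmod z)%R) by (destruct Hq; lra).
  assert (Q0 : (0 < Cmod q)%R) by apply Hq.
  exists (Rmax (Cmod q) (Rmax (Cmod q * Cmod z) (Cmod q * / Cmod z)))%R.
  split; [|split; [apply Rmax_l|split]].
  - split; [eapply Rlt_le_trans; [exact Q0|apply Rmax_l]|].
    apply Rmax_lub_lt; [apply Hq|apply Rmax_lub_lt].
    + rewrite <- (Rinv_r (Cmod q)) by lra. apply Rmult_lt_compat_l; auto.
    + rewrite <- (Rinv_r (Cmod z)) by lra. apply Rmult_lt_compat_r; auto.
      apply Rinv_0_lt_compat; auto.
  - eapply Rle_trans; [apply Rmax_l|apply Rmax_r].
  - eapply Rle_trans; [apply Rmax_r|apply Rmax_r].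
Qed.

Lemma annulus_pow q (z : C) r l : nome q -> z <> 0 -> (0 < r)%R ->
  (Cmod q * Cmod z <= r)%R -> (Cmod q * / Cmod z <= r)%R ->
  (powerRZ (Cmod q) (Z.abs l) * Cmod (Czpow z l) <= powerRZ r (Z.abs l))%R.
Proof.
  intros Hq Hz Hr H1 H2. rewrite Cmod_Czpow by auto.
  assert (Z0 : (0 < Cmod z)%R) by (apply Cmod_gt_0; auto).
  assert (Q0 : (0 < Cmod q)%R) by apply Hq.
  destruct (Z_le_dec 0 l).
  - rewrite Z.abs_eq by auto. replace l with (Z.of_nat (Z.to_nat l)) by lia.
    rewrite <- !pow_powerRZ, <- Rpow_mult_distr. apply pow_incr. split; auto. nra.
  - rewrite Z.abs_neq by lia. replace (powerRZ (Cmod z) l) with (powerRZ (/ Cmod z) (- l)).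
    + replace (- l)%Z with (Z.of_nat (Z.to_nat (- l))) by lia.
      rewrite <- !pow_powerRZ, <- Rpow_mult_distr. apply pow_incr. split; auto.
      apply Rmult_le_pos; [lra|left; apply Rinv_0_lt_compat; auto].
    + rewrite powerRZ_inv', powerRZ_neg', Rinv_inv; auto.
Qed.

Lemma geom_half_sums (x : C) : x <> 0 -> (Cmod x < 1)%R ->
  sums (fun l => zstep l * Czpow x l) (1 / (1 - x)).
Proof.
  intros Hx H1. assert (N := one_minus_nz x H1).
  assert (Px : (0 < Cmod x)%R) by (apply Cmod_gt_0; auto).
  set (f := fun l => zstep l * Czpow x l).
  assert (Hf : sums f (tsum f)).
  { apply tsum_spec, (abs_geom (Cmod x) 1); [lra|lra|]. intros l. unfold f, zstep.
    destruct (Z_le_dec 0 l).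
    - rewrite Cmod_mult, Cmod_1, Cmod_Czpow by auto. rewrite Z.abs_eq by auto. lra.
    - rewrite Cmult_0_l, Cmod_0, Rmult_1_l. apply powerRZ_le; auto. }
  assert (H0 := sums_delta 0%Z 1).
  lapply (sums_congr _ _ _ _ (sums_minus _ _ _ _ Hf (sums_scal x _ _ (sums_shift _ _ (-1) Hf))) H0).
  - simpl. intros E. eapply sums_eq; [exact Hf|].
    replace (tsum f) with ((tsum f - x * tsum f) / (1 - x)) by (field; auto). rewrite E. auto.
  - intros l. unfold f, zstep.
    destruct (Z.eq_dec l 0) as [->|Hl].
    + destruct (Z_le_dec 0 0); [|lia]. destruct (Z_le_dec 0 (0 + -1)); [lia|].
      rewrite Czpow_0. ring.
    + destruct (Z_le_dec 0 l); destruct (Z_le_dec 0 (l + -1)); try lia; [|ring].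
      replace l with (l + -1 + 1)%Z at 1 by lia. rewrite (Czpow_succ x (l + -1)) by auto. ring.
Qed.

(** The factor 1 - [zstep] (- n) is the indicator of n > 0: the bilateral sum is folded so that the
    poles outside and inside the annulus are treated in pairs. *)
Lemma sums_pairs (f : Z -> C) W : sums f W ->
  sums (fun n => (1 - zstep (- n)) * (f n + f (- n)%Z)) (W - f 0%Z).
Proof.
  intros H.
  assert (A1 : forall g : Z -> C, (forall n, Cmod (g n) <= 1)%R -> abs_summable (fun n => g n * f n)).
  { intros g Hg. eapply bounded_sums_le; [|apply (proj1 H)]. intros n. simpl.
    rewrite Cmod_mult. rewrite <- (Rmult_1_l (Cmod (f n))) at 2.
    apply Rmult_le_compat_r; auto. apply Cmod_ge_0. }
  assert (B : forall n, (Cmod (1 - zstep n) <= 1)%R).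
  { intros n. unfold zstep. destruct (Z_le_dec 0 n).
    - replace (1 - 1) with (RtoC 0) by ring. rewrite Cmod_0. lra.
    - replace (1 - 0) with (RtoC 1) by ring. rewrite Cmod_1. lra. }
  assert (H1 := tsum_spec _ (A1 (fun n => 1 - zstep (- n)) (fun n => B (- n)%Z))).
  assert (H2 := tsum_spec _ (A1 (fun n => 1 - zstep n) (fun n => B n))).
  assert (H0 := sums_delta 0%Z (f 0%Z)).
  assert (E := sums_congr _ _ _ _ H (sums_plus _ _ _ _ (sums_plus _ _ _ _ H1 H2) H0)).
  lapply E; clear E; [intros E|].
  - eapply sums_eq; [|instantiate (1 := tsum (fun n => (1 - zstep (- n)) * f n) +
      tsum (fun n => (1 - zstep n) * f n)); rewrite E; ring].
    eapply sums_ext; [|apply (sums_plus _ _ _ _ H1 (sums_neg _ _ H2))].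
    intros n. cbv beta. ring.
  - intros n. unfold zstep. destruct (Z.eq_dec n 0) as [->|Hn].
    + destruct (Z_le_dec 0 (- 0)); [|lia]. destruct (Z_le_dec 0 0); [|lia]. ring.
    + destruct (Z_le_dec 0 (- n)); destruct (Z_le_dec 0 n); try lia; ring.
Qed.

(** For n > 0 the term of index -n equals -(-1)^n q^(n(n+1)/2) z^(-1)/(1 - q^n/z), so both members
    of a pair have the same weight and expand geometrically, in q^n z and in q^n/z. Summing over n
    first turns the columns into [alpha]. *)
Lemma pf_laurent q (z : C) (P : C) : nome q -> annulus q z -> z <> 1 -> sums (pf_lim_term q z) P ->
  sums (fun l => jinv_coef_reg q l * Czpow z l) (P - 1 / (1 - z)).
Proof.
  intros Hq Hz H1 HP. assert (Hq0 := nome_nz q Hq). assert (Hz0 := annulus_nz q z Hq Hz).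
  assert (Pole := annulus_pole q z Hq Hz H1).
  destruct (annulus_ratio q z Hq Hz) as (r & Hr & R0 & R1 & R2).
  set (G := fun p : Z * Z => let (n, l) := p in
    (1 - zstep (- n)) * (sgz n * Czpow q (tri (n + 1))) *
    (zstep l * Czpow (Czpow q n * z) l - zstep (-1 - l) * Czpow (Czpow q n * / z) (-1 - l) * / z)).
  destruct (sums_exchange G (fun n => (1 - zstep (- n)) * (pf_lim_term q z n + pf_lim_term q z (- n)))
    (fun l => jinv_coef_reg q l * Czpow z l)) as (W & W1 & W2).
  - assert (Z0 : (0 < Cmod z)%R) by (apply Cmod_gt_0; auto).
    assert (Q0 : (0 < Cmod q)%R) by apply Hq.
    assert (I0 : (0 < / Cmod q)%R) by (apply Rinv_0_lt_compat; auto).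
    (* The constant 1/|q| pays for the stray factor 1/z, since 1/|z| <= r/|q|. *)
    apply (abs_quad2 q r (/ Cmod q) 0 (fun k => k)); auto; [lra|]. intros n l. unfold G.
    unfold zstep at 1. destruct (Z_le_dec 0 (- n)).
    { replace (1 - 1) with (RtoC 0) by ring. rewrite !Cmult_0_l, Cmod_0.
      apply Rmult_le_pos; [lra|]. apply Rmult_le_pos; apply powerRZ_le; [apply Hq|apply Hr]. }
    rewrite !Cmod_mult, Cmod_sgz. replace (1 - 0) with (RtoC 1) by ring. rewrite Cmod_1, !Rmult_1_l.
    rewrite Cmod_Czpow by auto.
    rewrite <- Rmult_assoc, (Rmult_comm (/ Cmod q)), Rmult_assoc.
    apply Rmult_le_compat; [apply powerRZ_le, Hq|apply Cmod_ge_0| |].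
    { apply powerRZ_anti; auto. pose proof (tri_spec (n + 1)). nia. }
    assert (Bg : forall x : C, x <> 0 -> (Cmod x <= r)%R -> forall m, (0 <= m)%Z ->
              (Cmod (Czpow x m) <= powerRZ r m)%R).
    { intros x Hx Hxr m Hm. rewrite Cmod_Czpow by auto.
      replace m with (Z.of_nat (Z.to_nat m)) by lia. rewrite <- !pow_powerRZ. apply pow_incr.
      split; auto. apply Cmod_ge_0. }
    assert (Qn : (Cmod (Czpow q n) <= Cmod q)%R).
    { rewrite Cmod_Czpow by auto. rewrite <- (powerRZ_1 (Cmod q)) at 2.
      apply powerRZ_anti; auto; lia. }
    assert (Iz : (0 < / Cmod z)%R) by (apply Rinv_0_lt_compat; auto).
    assert (Qz1 : (1 <= / Cmod q)%R).
    { rewrite <- (Rinv_r (Cmod q)) by lra. rewrite <- (Rmult_1_l (/ Cmod q)) at 2.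
      apply Rmult_le_compat_r; destruct Hq; lra. }
    unfold zstep. destruct (Z_le_dec 0 l); destruct (Z_le_dec 0 (-1 - l)); try lia.
    + replace (1 * Czpow (Czpow q n * z) l - 0 * Czpow (Czpow q n * / z) (-1 - l) * / z) with
        (Czpow (Czpow q n * z) l) by ring.
      rewrite Z.abs_eq by auto.
      apply Rle_trans with (1 * powerRZ r l)%R.
      * rewrite Rmult_1_l. apply Bg; auto; [apply Cmult_neq_0; auto using Czpow_nz|].
        rewrite Cmod_mult. eapply Rle_trans; [|exact R1].
        apply Rmult_le_compat_r; auto; lra.
      * apply Rmult_le_compat_r; auto. apply powerRZ_le; lra.
    + replace (0 * Czpow (Czpow q n * z) l - 1 * Czpow (Czpow q n * / z) (-1 - l) * / z) with
        (- (Czpow (Czpow q n * / z) (-1 - l) * / z)) by ring.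
      rewrite Cmod_opp, Cmod_mult, Cmod_inv by auto. rewrite Z.abs_neq by auto with zarith.
      apply Rle_trans with (powerRZ r (-1 - l) * / Cmod z)%R.
      * apply Rmult_le_compat_r; [lra|]. apply Bg; auto.
        -- apply Cmult_neq_0; auto using Czpow_nz, Cinv_nz.
        -- rewrite Cmod_mult, Cmod_inv by auto. eapply Rle_trans; [|exact R2].
           apply Rmult_le_compat_r; auto; lra.
      * replace (- l)%Z with ((-1 - l) + 1)%Z by lia. rewrite powerRZ_add, powerRZ_1 by lra.
        rewrite (Rmult_comm (powerRZ r (-1 - l))), (Rmult_comm (powerRZ r (-1 - l)) r).
        rewrite <- Rmult_assoc. apply Rmult_le_compat_r; [apply powerRZ_le; lra|].
        apply (Rmult_le_reg_l (Cmod q)); auto. rewrite <- Rmult_assoc, Rinv_r by lra. lra.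
  - intros n. unfold G. unfold zstep at 1 4. destruct (Z_le_dec 0 (- n)).
    { apply (sums_ext (fun _ => 0)); [intros; ring|].
      eapply sums_eq; [apply sums_zero; auto|ring]. }
    assert (Nx : Czpow q n * z <> 0) by (apply Cmult_neq_0; auto using Czpow_nz).
    assert (Ny : Czpow q n * / z <> 0) by (apply Cmult_neq_0; auto using Czpow_nz, Cinv_nz).
    assert (Qn : (Cmod (Czpow q n) <= Cmod q)%R).
    { rewrite Cmod_Czpow by auto. rewrite <- (powerRZ_1 (Cmod q)) at 2.
      apply powerRZ_anti; auto; lia. }
    assert (Bx : (Cmod (Czpow q n * z) < 1)%R).
    { rewrite Cmod_mult. apply Rle_lt_trans with (Cmod q * Cmod z)%R; [|lra].
      apply Rmult_le_compat_r; auto. apply Cmod_ge_0. }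
    assert (By : (Cmod (Czpow q n * / z) < 1)%R).
    { rewrite Cmod_mult, Cmod_inv by auto. apply Rle_lt_trans with (Cmod q * / Cmod z)%R; [|lra].
      apply Rmult_le_compat_r; auto. left; apply Rinv_0_lt_compat, Cmod_gt_0; auto. }
    assert (S1 := geom_half_sums _ Nx Bx).
    assert (S2 := sums_scal (/ z) _ _ (sums_refl _ _ (-1) (geom_half_sums _ Ny By))).
    assert (S3 := sums_scal (sgz n * Czpow q (tri (n + 1))) _ _ (sums_minus _ _ _ _ S1 S2)).
    eapply sums_eq; [eapply sums_ext; [|exact S3]; intros l; cbv beta; ring|].
    unfold pf_lim_term. rewrite sgz_opp.
    replace (tri (n + 1)) with (tri (- n + 1) + n)%Z
      by (pose proof (tri_spec (n + 1)); pose proof (tri_spec (- n + 1)); lia).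
    rewrite Czpow_add, Czpow_opp by auto.
    assert (P1 := one_minus_nz _ Bx). assert (P2 := one_minus_nz _ By).
    assert (Nn := Czpow_nz q n Hq0). set (x := Czpow q n) in *. clearbody x.
    rewrite Cmult_comm in P1.
    assert (P3 : z - x <> 0).
    { intros E. apply P2. replace (1 - x * / z) with ((z - x) * / z) by (field; auto). rewrite E; ring. }
    assert (P4 : x - z <> 0).
    { intros E. apply P3. replace (z - x) with (- (x - z)) by ring. rewrite E; ring. }
    assert (P5 : 1 - x * z <> 0) by (rewrite Cmult_comm; auto).
    field. repeat split; auto.
  - intros l. unfold G.
    assert (Hcol : forall k, (0 <= k)%Z ->
      sums (fun n => (1 - zstep (- n)) * (sgz n * Czpow q (tri (n + 1))) * Czpow q (n * k)) (alpha q k - 1)).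
    { intros k Hk. assert (H0 := sums_delta 0%Z 1).
      eapply sums_ext; [|apply (sums_minus _ _ _ _ (alpha_sums q k Hq Hk) H0)].
      intros n. cbv beta. unfold alpha_term, zstep. destruct (Z.eq_dec n 0) as [->|Hn].
      - destruct (Z_lt_dec 0 0); [lia|]. destruct (Z_le_dec 0 (- 0)); [|lia].
        replace (tri (0 + 1) + 0 * k)%Z with 0%Z by reflexivity. unfold sgz. simpl. ring.
      - destruct (Z_lt_dec n 0); destruct (Z_le_dec 0 (- n)); try lia; [ring|].
        rewrite Czpow_add by auto. ring. }
    unfold jinv_coef_reg, jinv_coef. unfold zstep at 2 3 4.
    destruct (Z_le_dec 0 l); destruct (Z_le_dec 0 (-1 - l)); try lia.
    + eapply sums_eq; [eapply sums_ext; [|apply (sums_scal (Czpow z l) _ _ (Hcol l ltac:(lia)))]|ring].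
      intros i. cbv beta. rewrite (Czpow_base_mul (Czpow q i) z) by (auto using Czpow_nz).
      rewrite Czpow_mult by auto. ring.
    + eapply sums_eq; [eapply sums_ext; [|apply (sums_scal (- Czpow z l) _ _ (Hcol (-1 - l)%Z ltac:(lia)))]|].
      * intros i. cbv beta.
        rewrite (Czpow_base_mul (Czpow q i) (/ z)) by (auto using Czpow_nz, Cinv_nz).
        rewrite Czpow_mult, Czpow_inv_base by auto.
        replace (-1 - l)%Z with (- (l + 1))%Z by lia. rewrite (Czpow_opp z), Czpow_succ by auto.
        assert (Nl := Czpow_nz z l Hz0). field. auto.
      * rewrite (alpha_rec q (-1 - l)) by (auto; lia). replace (-1 - l + 1)%Z with (- l)%Z by lia. ring.
  - replace (P - 1 / (1 - z)) with W; auto.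
    apply (sums_unique _ _ _ W1).
    eapply sums_eq; [apply (sums_pairs _ _ HP)|].
    unfold pf_lim_term. replace (tri (0 + 1)) with 0%Z by reflexivity. unfold sgz. rewrite !Czpow_0.
    f_equal. replace (1 - z * 1) with (1 - z) by ring. field.
    apply one_minus_neq; auto.
Qed.

(** * The Laurent coefficients of the character *)

(* The numerator of the character of spin 2s is [charnum q s z], up to a monomial. *)
Definition num_exp (s t : Z) : Z := (21 * t * t + 3 * (2 * s + 1) * t)%Z.
Definition num_weight (q : C) (s t : Z) : C := Czpow q (num_exp s t).
Definition num_shift (s t : Z) : Z := (s + 7 * t)%Z.

Definition charnum (q : C) (s : Z) (z : C) : C :=
  tsum (fun t => num_weight q s t * (Czpow z (- num_shift s t) - Czpow z (num_shift s t + 1))).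

(** With g(z) the sum of w_t z^(s+7t), num(z) = g(1/z) - z g(z); this is g(q^i). *)
Definition theta21 (q : C) (s i : Z) : C := tsum (fun t => num_weight q s t * Czpow q (i * num_shift s t)).
Definition char_coef_l (q : C) (s k : Z) : C := tsum (fun t => num_weight q s t * jinv_coef q (k + num_shift s t)).
Definition char_coef_r (q : C) (s k : Z) : C := tsum (fun t => num_weight q s t * jinv_coef q (k - num_shift s t - 1)).
Definition char_coef (q : C) (s k : Z) : C := char_coef_l q s k - char_coef_r q s k.

Lemma num_exp_lb s B : (0 <= B)%Z -> exists K, forall t,
  (num_exp s t - B * Z.abs (num_shift s t) >= Z.abs t - K)%Z.
Proof.
  intros HB. set (B' := (1 + Z.abs (3 * (2 * s + 1)) + 7 * B)%Z).
  exists (B' * B' + B * Z.abs s)%Z. intros t.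
  unfold num_exp, num_shift.
  pose proof (sq_lb B' t ltac:(unfold B'; lia)) as H.
  assert (0 <= t * t)%Z by apply Z.square_nonneg.
  assert (H1 : (- (Z.abs (3 * (2 * s + 1)) * Z.abs t) <= 3 * (2 * s + 1) * t)%Z)
    by (rewrite <- Z.abs_mul; lia).
  assert (H2 : (B * Z.abs (s + 7 * t) <= B * (Z.abs s + 7 * Z.abs t))%Z)
    by (apply Z.mul_le_mono_nonneg_l; lia).
  unfold B' in *. lia.
Qed.

Lemma num_weight_sums (q : C) s (B : Z) (M : R) (f : Z -> C) : nome q -> (0 <= B)%Z -> (0 <= M)%R ->
  (forall t, Cmod (f t) <= M * powerRZ (Cmod q) (- (B * Z.abs (num_shift s t))))%R ->
  sums (fun t => num_weight q s t * f t) (tsum (fun t => num_weight q s t * f t)).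
Proof.
  intros Hq HB HM Hf. destruct (num_exp_lb s B HB) as (K & HK).
  apply (sums_quad q _ M K); auto. intros t. unfold num_weight.
  rewrite Cmod_mult, Cmod_Czpow by (apply nome_nz; auto).
  eapply Rle_trans; [apply Rmult_le_compat_l; [apply powerRZ_le, Hq|apply Hf]|].
  rewrite (Rmult_comm M), <- Rmult_assoc, <- powerRZ_add, Rmult_comm by (destruct Hq; lra).
  apply Rmult_le_compat_l; auto. apply powerRZ_anti; auto. specialize (HK t). lia.
Qed.

Lemma charnum_sums (q : C) s (z : C) : nome q -> z <> 0 ->
  sums (fun t => num_weight q s t * (Czpow z (- num_shift s t) - Czpow z (num_shift s t + 1))) (charnum q s z).
Proof.
  intros Hq Hz. destruct (Czpow_bound q z Hq Hz) as (B & HB & H).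
  apply (num_weight_sums q s B (1 + Cmod z)); auto.
  { pose proof (Cmod_ge_0 z); lra. }
  intros t. unfold Cminus. eapply Rle_trans; [apply Cmod_triangle|].
  rewrite Cmod_opp, Czpow_succ, Cmod_mult by auto.
  pose proof (H (num_shift s t)) as H1. pose proof (H (- num_shift s t)%Z) as H2. rewrite Z.abs_opp in H2.
  pose proof (Cmod_ge_0 z). set (x := powerRZ (Cmod q) (- (B * Z.abs (num_shift s t)))) in *.
  assert (Cmod (Czpow z (num_shift s t)) * Cmod z <= x * Cmod z)%R by (apply Rmult_le_compat_r; auto).
  lra.
Qed.

Lemma theta21_sums (q : C) s i : nome q ->
  sums (fun t => num_weight q s t * Czpow q (i * num_shift s t)) (theta21 q s i).
Proof.
  intros Hq. apply (num_weight_sums q s (Z.abs i) 1); auto; [lia|lra|].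
  intros t. rewrite Cmod_Czpow, Rmult_1_l by (apply nome_nz; auto).
  apply powerRZ_anti; auto. rewrite <- Z.abs_mul. lia.
Qed.

Lemma jinv_coef_num_sums (q : C) s (g : Z -> Z) : nome q ->
  sums (fun t => num_weight q s t * jinv_coef q (g t)) (tsum (fun t => num_weight q s t * jinv_coef q (g t))).
Proof.
  intros Hq. destruct (jinv_coef_bound q Hq) as (M & HM & H).
  apply (num_weight_sums q s 0 M); auto; [lia|].
  intros t. simpl. rewrite Rmult_1_r. apply H.
Qed.

Lemma char_coef_l_sums (q : C) s k : nome q -> sums (fun t => num_weight q s t * jinv_coef q (k + num_shift s t)) (char_coef_l q s k).
Proof. intros Hq. apply (jinv_coef_num_sums q s (fun t => k + num_shift s t)%Z Hq). Qed.

Lemma char_coef_r_sums (q : C) s k : nome q -> sums (fun t => num_weight q s t * jinv_coef q (k - num_shift s t - 1)) (char_coef_r q s k).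
Proof. intros Hq. apply (jinv_coef_num_sums q s (fun t => k - num_shift s t - 1)%Z Hq). Qed.

Lemma char_coef_sums (q : C) s k : nome q ->
  sums (fun t => num_weight q s t * (jinv_coef q (k + num_shift s t) - jinv_coef q (k - num_shift s t - 1))) (char_coef q s k).
Proof.
  intros Hq. eapply sums_ext; [|apply (sums_minus _ _ _ _ (char_coef_l_sums q s k Hq) (char_coef_r_sums q s k Hq))].
  intros t; cbv beta; ring.
Qed.

(** Replacing t by t + 1 raises the exponent by 42 t + 24 + 6s, which is 6 times the shift s + 7t
    plus 24. This is the origin of the period 6 and of the six steps below. *)
Lemma theta21_period (q : C) s i : nome q -> theta21 q s i = Czpow q (7 * i + 24) * theta21 q s (i + 6).
Proof.
  intros Hq. assert (Hq0 := nome_nz q Hq).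
  apply (sums_congr _ _ _ _ (sums_shift _ _ 1 (theta21_sums q s i Hq))
    (sums_scal (Czpow q (7 * i + 24)) _ _ (theta21_sums q s (i + 6) Hq))).
  intros t. cbv beta. unfold num_weight. rewrite <- !Czpow_add by auto. f_equal. unfold num_exp, num_shift. lia.
Qed.

Lemma charnum_theta21 (q : C) s i : nome q ->
  charnum q s (Czpow q i) = theta21 q s (- i) - Czpow q i * theta21 q s i.
Proof.
  intros Hq. assert (Hq0 := nome_nz q Hq).
  apply (sums_congr _ _ _ _ (charnum_sums q s (Czpow q i) Hq (Czpow_nz q i Hq0))
    (sums_minus _ _ _ _ (theta21_sums q s (- i) Hq) (sums_scal (Czpow q i) _ _ (theta21_sums q s i Hq)))).
  intros t. cbv beta. rewrite !Czpow_mult by auto.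
  replace (i * (num_shift s t + 1))%Z with (i + i * num_shift s t)%Z by lia.
  replace (i * - num_shift s t)%Z with (- i * num_shift s t)%Z by lia.
  rewrite (Czpow_add q i) by auto. ring.
Qed.

Lemma jinv_coef_rec6 q l : nome q -> jinv_coef q l =
  1 - Czpow q (l + 1) + Czpow q (2 * l + 3) - Czpow q (3 * l + 6) + Czpow q (4 * l + 10)
  - Czpow q (5 * l + 15) + Czpow q (6 * l + 21) * jinv_coef q (l + 6).
Proof.
  intros Hq. assert (Hq0 := nome_nz q Hq).
  rewrite (jinv_coef_rec q l), (jinv_coef_rec q (l + 1)), (jinv_coef_rec q (l + 1 + 1)), (jinv_coef_rec q (l + 1 + 1 + 1)),
    (jinv_coef_rec q (l + 1 + 1 + 1 + 1)), (jinv_coef_rec q (l + 1 + 1 + 1 + 1 + 1)) by auto.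
  replace (l + 1 + 1 + 1 + 1 + 1 + 1)%Z with (l + 6)%Z by lia.
  set (a := jinv_coef q (l + 6)). clearbody a.
  replace (2 * l + 3)%Z with (l + 1 + (l + 1 + 1))%Z by lia.
  replace (3 * l + 6)%Z with (l + 1 + (l + 1 + 1) + (l + 1 + 1 + 1))%Z by lia.
  replace (4 * l + 10)%Z with (l + 1 + (l + 1 + 1) + (l + 1 + 1 + 1) + (l + 1 + 1 + 1 + 1))%Z by lia.
  replace (5 * l + 15)%Z with (l + 1 + (l + 1 + 1) + (l + 1 + 1 + 1) + (l + 1 + 1 + 1 + 1)
    + (l + 1 + 1 + 1 + 1 + 1))%Z by lia.
  replace (6 * l + 21)%Z with (l + 1 + (l + 1 + 1) + (l + 1 + 1 + 1) + (l + 1 + 1 + 1 + 1)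
    + (l + 1 + 1 + 1 + 1 + 1) + (l + 6))%Z by lia.
  replace (l + 6)%Z with (l + 1 + 1 + 1 + 1 + 1 + 1)%Z by lia.
  rewrite !Czpow_add, !Czpow_1 by auto. ring.
Qed.

(** After six steps the index k + u has become k + u + 6 = (k - 1) + (u + 7), the index belonging to
    k - 1 and t + 1; the accumulated power of q is exactly the change of weight from t to t + 1. *)
Lemma char_coef_l_rec q s k : nome q -> char_coef_l q s k =
  theta21 q s 0 - Czpow q (k + 1) * theta21 q s 1 + Czpow q (2 * k + 3) * theta21 q s 2
  - Czpow q (3 * k + 6) * theta21 q s 3 + Czpow q (4 * k + 10) * theta21 q s 4
  - Czpow q (5 * k + 15) * theta21 q s 5 + Czpow q (6 * k - 3) * char_coef_l q s (k - 1).
Proof.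
  intros Hq. assert (Hq0 := nome_nz q Hq).
  assert (T := theta21_sums q s).
  assert (H := sums_plus _ _ _ _ (sums_minus _ _ _ _ (sums_plus _ _ _ _ (sums_minus _ _ _ _ (sums_plus _ _ _ _
    (sums_minus _ _ _ _ (T 0%Z Hq) (sums_scal (Czpow q (k + 1)) _ _ (T 1%Z Hq)))
    (sums_scal (Czpow q (2 * k + 3)) _ _ (T 2%Z Hq)))
    (sums_scal (Czpow q (3 * k + 6)) _ _ (T 3%Z Hq)))
    (sums_scal (Czpow q (4 * k + 10)) _ _ (T 4%Z Hq)))
    (sums_scal (Czpow q (5 * k + 15)) _ _ (T 5%Z Hq)))
    (sums_scal (Czpow q (6 * k - 3)) _ _ (sums_shift _ _ 1 (char_coef_l_sums q s (k - 1) Hq)))).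
  apply (sums_congr _ _ _ _ (char_coef_l_sums q s k Hq) H).
  intros t. cbv beta. rewrite (jinv_coef_rec6 q (k + num_shift s t)) by auto.
  replace (k - 1 + num_shift s (t + 1))%Z with (k + num_shift s t + 6)%Z by (unfold num_shift; lia).
  assert (E : Czpow q (6 * k - 3) * num_weight q s (t + 1) = num_weight q s t * Czpow q (6 * (k + num_shift s t) + 21)).
  { unfold num_weight. rewrite <- !Czpow_add by auto. f_equal. unfold num_exp, num_shift. lia. }
  set (a := jinv_coef q (k + num_shift s t + 6)). clearbody a.
  rewrite (Cmult_assoc (Czpow q (6 * k - 3))), E. set (u := num_shift s t).
  replace (k + u + 1)%Z with (k + 1 + 1 * u)%Z by lia.
  replace (2 * (k + u) + 3)%Z with (2 * k + 3 + 2 * u)%Z by lia.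
  replace (3 * (k + u) + 6)%Z with (3 * k + 6 + 3 * u)%Z by lia.
  replace (4 * (k + u) + 10)%Z with (4 * k + 10 + 4 * u)%Z by lia.
  replace (5 * (k + u) + 15)%Z with (5 * k + 15 + 5 * u)%Z by lia.
  rewrite !(Czpow_add q _ (_ * u)) by auto.
  replace (Czpow q (0 * u)) with (RtoC 1) by reflexivity. ring.
Qed.

(** Mirror image of the previous recurrence: k - u - 1 + 6 = (k - 1) - (u - 7) - 1 belongs to k - 1
    and t - 1. *)
Lemma char_coef_r_rec q s k : nome q -> char_coef_r q s k =
  theta21 q s 0 - Czpow q k * theta21 q s (-1) + Czpow q (2 * k + 1) * theta21 q s (-2)
  - Czpow q (3 * k + 3) * theta21 q s (-3) + Czpow q (4 * k + 6) * theta21 q s (-4)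
  - Czpow q (5 * k + 10) * theta21 q s (-5) + Czpow q (6 * k - 3) * char_coef_r q s (k - 1).
Proof.
  intros Hq. assert (Hq0 := nome_nz q Hq).
  assert (T := theta21_sums q s).
  assert (H := sums_plus _ _ _ _ (sums_minus _ _ _ _ (sums_plus _ _ _ _ (sums_minus _ _ _ _ (sums_plus _ _ _ _
    (sums_minus _ _ _ _ (T 0%Z Hq) (sums_scal (Czpow q k) _ _ (T (-1)%Z Hq)))
    (sums_scal (Czpow q (2 * k + 1)) _ _ (T (-2)%Z Hq)))
    (sums_scal (Czpow q (3 * k + 3)) _ _ (T (-3)%Z Hq)))
    (sums_scal (Czpow q (4 * k + 6)) _ _ (T (-4)%Z Hq)))
    (sums_scal (Czpow q (5 * k + 10)) _ _ (T (-5)%Z Hq)))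
    (sums_scal (Czpow q (6 * k - 3)) _ _ (sums_shift _ _ (-1) (char_coef_r_sums q s (k - 1) Hq)))).
  apply (sums_congr _ _ _ _ (char_coef_r_sums q s k Hq) H).
  intros t. cbv beta. rewrite (jinv_coef_rec6 q (k - num_shift s t - 1)) by auto.
  replace (k - 1 - num_shift s (t + -1) - 1)%Z with (k - num_shift s t - 1 + 6)%Z by (unfold num_shift; lia).
  assert (E : Czpow q (6 * k - 3) * num_weight q s (t + -1) = num_weight q s t * Czpow q (6 * (k - num_shift s t - 1) + 21)).
  { unfold num_weight. rewrite <- !Czpow_add by auto. f_equal. unfold num_exp, num_shift. lia. }
  set (a := jinv_coef q (k - num_shift s t - 1 + 6)). clearbody a.
  rewrite (Cmult_assoc (Czpow q (6 * k - 3))), E. set (u := num_shift s t).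
  replace (k - u - 1 + 1)%Z with (k + -1 * u)%Z by lia.
  replace (2 * (k - u - 1) + 3)%Z with (2 * k + 1 + -2 * u)%Z by lia.
  replace (3 * (k - u - 1) + 6)%Z with (3 * k + 3 + -3 * u)%Z by lia.
  replace (4 * (k - u - 1) + 10)%Z with (4 * k + 6 + -4 * u)%Z by lia.
  replace (5 * (k - u - 1) + 15)%Z with (5 * k + 10 + -5 * u)%Z by lia.
  rewrite !(Czpow_add q _ (_ * u)) by auto.
  replace (Czpow q (0 * u)) with (RtoC 1) by reflexivity. ring.
Qed.

(** Subtracting the halves puts num(q^i), up to sign and a power of q, in front of q^(ik). The terms
    i = 0 and 3 drop out because num(1) = num(q^3) = 0, and the period turns i = 5 and 4 into i = 1
    and 2. *)
Lemma char_coef_rec q s k : nome q -> char_coef q s k =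
  Czpow q (6 * k - 3) * char_coef q s (k - 1)
  + charnum q s (Czpow q 1) * (Czpow q k - Czpow q (5 * k - 2))
  - charnum q s (Czpow q 2) * (Czpow q (2 * k + 1) - Czpow q (4 * k)).
Proof.
  intros Hq. assert (Hq0 := nome_nz q Hq). unfold char_coef. rewrite char_coef_l_rec, char_coef_r_rec, !charnum_theta21 by auto.
  assert (E3 := theta21_period q s (-3) Hq). assert (E2 := theta21_period q s (-2) Hq).
  assert (E4 := theta21_period q s (-4) Hq). assert (E1 := theta21_period q s (-1) Hq).
  assert (E5 := theta21_period q s (-5) Hq). simpl in E1, E2, E3, E4, E5.
  simpl Z.opp. rewrite E1, E2, E3, E4, E5.
  set (T1 := theta21 q s 1) in *. set (T2 := theta21 q s 2) in *. set (T3 := theta21 q s 3) in *.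
  set (T4 := theta21 q s 4) in *. set (T5 := theta21 q s 5) in *.
  replace (2 * k + 3)%Z with (k + k + 3)%Z by lia.
  replace (2 * k + 1)%Z with (k + k + 1)%Z by lia.
  replace (3 * k + 6)%Z with (k + k + k + 6)%Z by lia.
  replace (3 * k + 3)%Z with (k + k + k + 3)%Z by lia.
  replace (4 * k + 10)%Z with (k + k + k + k + 10)%Z by lia.
  replace (4 * k + 6)%Z with (k + k + k + k + 6)%Z by lia.
  replace (4 * k)%Z with (k + k + k + k)%Z by lia.
  replace (5 * k + 15)%Z with (k + k + k + k + k + 15)%Z by lia.
  replace (5 * k + 10)%Z with (k + k + k + k + k + 10)%Z by lia.
  replace (5 * k - 2)%Z with (k + k + k + k + k + -2)%Z by lia.
  rewrite !Czpow_add by auto.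
  set (a := Czpow q k). simpl. field. auto.
Qed.

(** * The numerator against the expansion, inside the annulus and on its boundary *)

Lemma zstep_window_bound q k u : nome q ->
  (Cmod (zstep (k + u) - zstep (k - u - 1)) <= powerRZ (Cmod q) (Z.abs k - Z.abs u - 1))%R.
Proof.
  intros Hq. assert (P := powerRZ_le (Cmod q) (Z.abs k - Z.abs u - 1) (proj1 Hq)).
  unfold zstep.
  destruct (Z_le_dec 0 (k + u)); destruct (Z_le_dec 0 (k - u - 1)).
  - replace (1 - 1) with (RtoC 0) by ring. rewrite Cmod_0; auto.
  - replace (1 - 0) with (RtoC 1) by ring. rewrite Cmod_1.
    change 1%R with (powerRZ (Cmod q) 0). apply powerRZ_anti; auto; lia.
  - replace (0 - 1) with (- (1)) by ring. rewrite Cmod_opp, Cmod_1.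
    change 1%R with (powerRZ (Cmod q) 0). apply powerRZ_anti; auto; lia.
  - replace (0 - 0) with (RtoC 0) by ring. rewrite Cmod_0; auto.
Qed.

(** The coefficients tend to 1 at +infinity, so only their differences decay in k; this reflects
    that num cancels the pole at z = 1. The loss |q|^(-|u|) is later paid by the quadratic
    weight. *)
Lemma jinv_coef_window_bound q : nome q -> exists M, (0 <= M)%R /\ forall k u,
  (Cmod (jinv_coef q (k + u) - jinv_coef q (k - u - 1)) <=
    M * powerRZ (Cmod q) (Z.abs k - Z.abs u - 1))%R.
Proof.
  intros Hq. destruct (jinv_coef_bound q Hq) as (M & HM & H). exists (2 * M + 1)%R. split; [lra|].
  intros k u. destruct (H (k + u)%Z) as [H1 _]. destruct (H (k - u - 1)%Z) as [H2 _].
  unfold jinv_coef_reg in H1, H2.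
  replace (jinv_coef q (k + u) - jinv_coef q (k - u - 1)) with
    ((jinv_coef q (k + u) - zstep (k + u)) + (- (jinv_coef q (k - u - 1) - zstep (k - u - 1)) +
      (zstep (k + u) - zstep (k - u - 1)))) by ring.
  eapply Rle_trans; [apply Cmod_triangle|].
  eapply Rle_trans; [apply Rplus_le_compat_l, Cmod_triangle|]. rewrite Cmod_opp.
  assert (H3 := zstep_window_bound q k u Hq).
  set (x := powerRZ (Cmod q) (Z.abs k - Z.abs u - 1)) in *.
  assert (A1 : (powerRZ (Cmod q) (Z.abs (k + u)) <= x)%R) by (apply powerRZ_anti; auto; lia).
  assert (A2 : (powerRZ (Cmod q) (Z.abs (k - u - 1)) <= x)%R) by (apply powerRZ_anti; auto; lia).
  assert (M * powerRZ (Cmod q) (Z.abs (k + u)) <= M * x)%R by (apply Rmult_le_compat_l; auto).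
  assert (M * powerRZ (Cmod q) (Z.abs (k - u - 1)) <= M * x)%R by (apply Rmult_le_compat_l; auto).
  lra.
Qed.

(** The difference of steps is supported on a finite window, so this is a finite geometric sum,
    valid also where |z| >= 1. *)
Lemma zstep_window_sums q (z : C) u : nome q -> z <> 0 -> z <> 1 ->
  sums (fun k => Czpow z k * (zstep (k + u) - zstep (k - u - 1)))
    ((Czpow z (- u) - Czpow z (u + 1)) / (1 - z)).
Proof.
  intros Hq Hz Hz1.
  assert (N := one_minus_neq z Hz1).
  set (f := fun k => Czpow z k * (zstep (k + u) - zstep (k - u - 1))).
  destruct (Czpow_bound q z Hq Hz) as (B & HB & H).
  assert (Hf : sums f (tsum f)).
  { apply (sums_quad q f (powerRZ (Cmod q) (- (B * (Z.abs u + 1)))) (Z.abs u + 1)); auto.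
    - apply powerRZ_le, Hq.
    - intros k. unfold f. rewrite Cmod_mult.
      assert (P := powerRZ_le (Cmod q) (Z.abs k - (Z.abs u + 1)) (proj1 Hq)).
      assert (P2 := powerRZ_le (Cmod q) (- (B * (Z.abs u + 1))) (proj1 Hq)).
      destruct (Z_le_dec (Z.abs k) (Z.abs u + 1)).
      + apply Rmult_le_compat; try apply Cmod_ge_0.
        * eapply Rle_trans; [apply H|]. apply powerRZ_anti; auto. nia.
        * eapply Rle_trans; [apply (zstep_window_bound q k u Hq)|].
          apply powerRZ_anti; auto. lia.
      + replace (zstep (k + u) - zstep (k - u - 1)) with (RtoC 0).
        * rewrite Cmod_0, Rmult_0_r. apply Rmult_le_pos; auto.
        * unfold zstep. destruct (Z_le_dec 0 (k + u)); destruct (Z_le_dec 0 (k - u - 1)); try lia; ring. }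
  assert (D1 := sums_delta (- u)%Z (Czpow z (- u))).
  assert (D2 := sums_delta (u + 1)%Z (Czpow z (u + 1))).
  assert (E : tsum f - z * tsum f = Czpow z (- u) - Czpow z (u + 1)).
  { apply (sums_congr _ _ _ _ (sums_minus _ _ _ _ Hf (sums_scal z _ _ (sums_shift _ _ (-1) Hf)))
      (sums_minus _ _ _ _ D1 D2)).
    intros k. unfold f.
    assert (F : z * Czpow z (k + -1) = Czpow z k).
    { rewrite Cmult_comm, <- Czpow_succ by auto. f_equal. lia. }
    rewrite Cmult_assoc, F. unfold zstep.
    destruct (Z.eq_dec k (- u)) as [e1|e1]; destruct (Z.eq_dec k (u + 1)) as [e2|e2]; try lia;
    repeat match goal with |- context [Z_le_dec 0 ?x] => destruct (Z_le_dec 0 x) end;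
    try lia; try ring; (rewrite e1 || rewrite e2); ring. }
  eapply sums_eq; [exact Hf|]. rewrite <- E. field. exact N.
Qed.

(** Splitting off the step makes the identity hold on the whole annulus, including |z| >= 1, where
    the series of the unsplit coefficients diverges. *)
Lemma jinv_coef_window_sums q (z P : C) u : nome q -> annulus q z -> z <> 1 -> sums (pf_lim_term q z) P ->
  sums (fun k => Czpow z k * (jinv_coef q (k + u) - jinv_coef q (k - u - 1)))
    ((Czpow z (- u) - Czpow z (u + 1)) * P).
Proof.
  intros Hq Hz Hz1 HP. assert (Hz0 := annulus_nz q z Hq Hz).
  assert (HL := pf_laurent q z P Hq Hz Hz1 HP).
  assert (N := one_minus_neq z Hz1).
  assert (H1 := sums_scal (Czpow z (- u)) _ _ (sums_shift _ _ u HL)).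
  assert (H2 := sums_scal (Czpow z (u + 1)) _ _ (sums_shift _ _ (- (u + 1)) HL)).
  assert (H3 := sums_plus _ _ _ _ (sums_minus _ _ _ _ H1 H2) (zstep_window_sums q z u Hq Hz0 Hz1)).
  eapply sums_eq; [|instantiate (1 := Czpow z (- u) * (P - 1 / (1 - z)) -
    Czpow z (u + 1) * (P - 1 / (1 - z)) + (Czpow z (- u) - Czpow z (u + 1)) / (1 - z)); field; auto].
  eapply sums_ext; [|exact H3]. intros k. cbv beta. unfold jinv_coef_reg.
  replace (k + - (u + 1))%Z with (k - u - 1)%Z by lia.
  assert (F1 : Czpow z (- u) * Czpow z (k + u) = Czpow z k)
    by (rewrite <- Czpow_add by auto; f_equal; lia).
  assert (F2 : Czpow z (u + 1) * Czpow z (k - u - 1) = Czpow z k)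
    by (rewrite <- Czpow_add by auto; f_equal; lia).
  set (x := jinv_coef q (k + u)). set (y := jinv_coef q (k - u - 1)).
  transitivity ((Czpow z (- u) * Czpow z (k + u)) * (x - zstep (k + u))
    - (Czpow z (u + 1) * Czpow z (k - u - 1)) * (y - zstep (k - u - 1))
    + Czpow z k * (zstep (k + u) - zstep (k - u - 1))); [ring|].
  rewrite F1, F2. ring.
Qed.

Lemma char_coef_laurent q s (z P : C) : nome q -> annulus q z -> z <> 1 -> sums (pf_lim_term q z) P ->
  sums (fun k => char_coef q s k * Czpow z k) (charnum q s z * P).
Proof.
  intros Hq Hz Hz1 HP. assert (Hz0 := annulus_nz q z Hq Hz).
  destruct (annulus_ratio q z Hq Hz) as (r & Hr & R0 & R1 & R2).
  destruct (jinv_coef_window_bound q Hq) as (M & HM & HB).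
  destruct (num_exp_lb s 1 ltac:(lia)) as (K & HK).
  destruct (sums_exchange (fun p : Z * Z => num_weight q s (fst p) *
      (Czpow z (snd p) * (jinv_coef q (snd p + num_shift s (fst p)) - jinv_coef q (snd p - num_shift s (fst p) - 1))))
    (fun t => num_weight q s t * ((Czpow z (- num_shift s t) - Czpow z (num_shift s t + 1)) * P))
    (fun k => char_coef q s k * Czpow z k)) as (W & W1 & W2).
  - apply (abs_quad2 q r M (K + 1) (fun k => k)); auto. intros t k. simpl. unfold num_weight.
    rewrite !Cmod_mult, Cmod_Czpow by (apply nome_nz; auto).
    assert (A := annulus_pow q z r k Hq Hz0 (proj1 Hr) R1 R2).
    apply Rle_trans with (powerRZ (Cmod q) (num_exp s t) * (Cmod (Czpow z k) *
      (M * (powerRZ (Cmod q) (- Z.abs (num_shift s t) - 1) * powerRZ (Cmod q) (Z.abs k)))))%R.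
    + apply Rmult_le_compat_l; [apply powerRZ_le, Hq|].
      apply Rmult_le_compat_l; [apply Cmod_ge_0|].
      eapply Rle_trans; [apply HB|]. rewrite <- powerRZ_add by (destruct Hq; lra).
      right; f_equal; f_equal; lia.
    + apply Rle_trans with (M * ((powerRZ (Cmod q) (num_exp s t) * powerRZ (Cmod q) (- Z.abs (num_shift s t) - 1)) *
        (powerRZ (Cmod q) (Z.abs k) * Cmod (Czpow z k))))%R; [right; ring|].
      apply Rmult_le_compat_l; auto. rewrite <- powerRZ_add by (destruct Hq; lra).
      apply Rmult_le_compat; auto.
      * apply powerRZ_le, Hq.
      * apply Rmult_le_pos; [apply powerRZ_le, Hq|apply Cmod_ge_0].
      * apply powerRZ_anti; auto. specialize (HK t). lia.
  - intros t. simpl. apply sums_scal, jinv_coef_window_sums; auto.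
  - intros k. simpl.
    eapply sums_eq; [eapply sums_ext; [|apply (sums_scal (Czpow z k) _ _ (char_coef_sums q s k Hq))]|apply Cmult_comm].
    intros t; cbv beta; ring.
  - replace (charnum q s z * P) with W; auto. apply (sums_unique _ _ _ W1).
    eapply sums_eq; [eapply sums_ext; [|apply (sums_scal P _ _ (charnum_sums q s z Hq Hz0))]|apply Cmult_comm].
    intros t; cbv beta; ring.
Qed.

Lemma annulus_m1 q : nome q -> annulus q (-1).
Proof.
  intros Hq. unfold annulus. rewrite Cmod_R, Rabs_left by lra. destruct Hq as [H1 H2].
  split; [lra|]. replace (- -1)%R with (/ 1)%R by field. apply Rinv_lt_contravar; lra.
Qed.

Lemma m1_neq_1 : RtoC (-1) <> 1.
Proof. intros E; inversion E; lra. Qed.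

(* Here |z| = |q|, the circle carrying the pole z = q; the factor 1 - q/z restores convergence. *)
Lemma jinv_coef_circle_sums q P : nome q -> sums (pf_lim_term q (-1)) P ->
  sums (fun l => Czpow (- q) l * (jinv_coef q l - q * jinv_coef q (l + 1))) (2 * P) /\
  exists M, (0 <= M)%R /\ forall l,
    (Cmod (Czpow (- q) l * (jinv_coef q l - q * jinv_coef q (l + 1))) <= M * powerRZ (Cmod q) (Z.abs l - 1))%R.
Proof.
  intros Hq HP. assert (Hq0 := nome_nz q Hq).
  (* Since q^l a_l = 1 - a_(l-1), the summand is (-1)^l (a_l - a_(l-1)): the evaluation on |z| = |q|
     becomes one at z = -1, inside the annulus. The regular parts give P - 1/2 twice, and the step
     gives the missing 1 at l = 0. *)
  assert (E : forall l, Czpow (- q) l * (jinv_coef q l - q * jinv_coef q (l + 1)) =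
     sgz l * (jinv_coef_reg q l - jinv_coef_reg q (l + -1)) + (if Z.eq_dec l 0 then 1 else 0)).
  { intros l. rewrite Czpow_neg by auto.
    assert (E1 := jinv_coef_rec q (l + -1) Hq). replace (l + -1 + 1)%Z with l in E1 by lia.
    assert (E2 := jinv_coef_rec q l Hq). rewrite Czpow_succ in E2 by auto.
    assert (F : sgz l * (zstep l - zstep (l + -1)) = if Z.eq_dec l 0 then 1 else 0).
    { unfold zstep. destruct (Z.eq_dec l 0) as [->|].
      - destruct (Z_le_dec 0 0); destruct (Z_le_dec 0 (0 + -1)); try lia. unfold sgz; simpl; ring.
      - destruct (Z_le_dec 0 l); destruct (Z_le_dec 0 (l + -1)); try lia; ring. }
    rewrite <- F. unfold jinv_coef_reg.
    transitivity (sgz l * (Czpow q l * jinv_coef q l - Czpow q l * q * jinv_coef q (l + 1))); [ring|].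
    replace (Czpow q l * jinv_coef q l) with (1 - jinv_coef q (l + -1)) by (rewrite E1; ring).
    replace (Czpow q l * q * jinv_coef q (l + 1)) with (1 - jinv_coef q l) by (rewrite E2; ring). ring. }
  split.
  - assert (HL := pf_laurent q (-1) P Hq (annulus_m1 q Hq) m1_neq_1 HP).

    assert (D := sums_delta 0%Z 1).
    assert (H := sums_plus _ _ _ _ (sums_plus _ _ _ _ HL (sums_shift _ _ (-1) HL)) D).
    eapply sums_eq; [eapply sums_ext; [|exact H]|].
    + intros l. cbv beta. rewrite E. fold (sgz l). fold (sgz (l + -1)).
      assert (Es : sgz (l + -1) = - sgz l) by exact (sgz_pred l). rewrite Es. ring.
    + field.
  - destruct (jinv_coef_bound q Hq) as (M & HM & H). exists (2 * M + 1)%R. split; [lra|].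
    intros l. rewrite E. destruct (H l) as [H1 _]. destruct (H (l + -1)%Z) as [H2 _].
    set (x := powerRZ (Cmod q) (Z.abs l - 1)).
    assert (A1 : (powerRZ (Cmod q) (Z.abs l) <= x)%R) by (apply powerRZ_anti; auto; lia).
    assert (A2 : (powerRZ (Cmod q) (Z.abs (l + -1)) <= x)%R) by (apply powerRZ_anti; auto; lia).
    assert (A3 : (Cmod (if Z.eq_dec l 0 then 1 else 0) <= x)%R).
    { destruct (Z.eq_dec l 0) as [->|].
      - rewrite Cmod_1. change 1%R with (powerRZ (Cmod q) 0). apply powerRZ_anti; auto; lia.
      - rewrite Cmod_0. apply powerRZ_le, Hq. }
    eapply Rle_trans; [apply Cmod_triangle|]. rewrite Cmod_mult, Cmod_sgz, Rmult_1_l.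
    assert (A4 := Cmod_triangle (jinv_coef_reg q l) (- jinv_coef_reg q (l + -1))). rewrite Cmod_opp in A4.
    change (jinv_coef_reg q l + - jinv_coef_reg q (l + -1)) with (jinv_coef_reg q l - jinv_coef_reg q (l + -1)) in A4.
    assert (M * powerRZ (Cmod q) (Z.abs l) <= M * x)%R by (apply Rmult_le_compat_l; auto).
    assert (M * powerRZ (Cmod q) (Z.abs (l + -1)) <= M * x)%R by (apply Rmult_le_compat_l; auto).
    lra.
Qed.

(** Formally the value of (1 - q/z) num(z) P(z) at z = -q, with P(-q) = P(-1) from the
    quasi-periodicity of j. *)
Lemma char_coef_eval q s P : nome q -> sums (pf_lim_term q (-1)) P ->
  sums (fun k => Czpow (- q) k * (char_coef q s k - q * char_coef q s (k + 1))) (charnum q s (- q) * (2 * P)).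
Proof.
  intros Hq HP. assert (Hq0 := nome_nz q Hq). assert (Hn0 := Copp_nz q Hq0).
  destruct (jinv_coef_circle_sums q P Hq HP) as (HS & M & HM & HB).
  (* Slope 2 is required: one |u| for the factor (-q)^(-u) or (-q)^(u+1), another for the shift of k
     by u. *)
  destruct (num_exp_lb s 2 ltac:(lia)) as (K & HK).
  set (b := fun l => Czpow (- q) l * (jinv_coef q l - q * jinv_coef q (l + 1))) in *.
  assert (Nb : forall l, (Cmod (Czpow (- q) l) = powerRZ (Cmod q) l)%R)
    by (intros l; rewrite Cmod_Czpow, Cmod_opp by auto; auto).
  set (G := fun p : Z * Z => let (t, k) := p in num_weight q s t *
      (Czpow (- q) (- num_shift s t) * b (k + num_shift s t)%Z - Czpow (- q) (num_shift s t + 1) * b (k + - (num_shift s t + 1))%Z)).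
  assert (HG : forall t k, G (t, k) = Czpow (- q) k * (num_weight q s t * (jinv_coef q (k + num_shift s t) - jinv_coef q (k - num_shift s t - 1))
      - q * (num_weight q s t * (jinv_coef q (k + 1 + num_shift s t) - jinv_coef q (k + 1 - num_shift s t - 1))))).
  { intros t k. unfold G, b. set (u := num_shift s t).
    rewrite !Cmult_assoc, <- !Czpow_add by auto.
    replace (- u + (k + u))%Z with k by lia. replace (u + 1 + (k + - (u + 1)))%Z with k by lia.
    replace (k + - (u + 1))%Z with (k - u - 1)%Z by lia.
    replace (k + u + 1)%Z with (k + 1 + u)%Z by lia.
    replace (k - u - 1 + 1)%Z with (k + 1 - u - 1)%Z by lia. ring. }
  destruct (sums_exchange G
    (fun t => num_weight q s t * ((Czpow (- q) (- num_shift s t) - Czpow (- q) (num_shift s t + 1)) * (2 * P)))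
    (fun k => Czpow (- q) k * (char_coef q s k - q * char_coef q s (k + 1)))) as (W & W1 & W2).
  - apply (abs_quad2 q (Cmod q) (2 * M) (K + 3) (fun k => k)); auto; [lra|].
    intros t k. unfold G. rewrite Cmod_mult. unfold num_weight. rewrite Cmod_Czpow by auto.
    set (u := num_shift s t).
    assert (B1 : (Cmod (Czpow (- q) (- u) * b (k + u)%Z) <=
       M * powerRZ (Cmod q) (- 2 * Z.abs u - 3 + Z.abs k))%R).
    { rewrite Cmod_mult, Nb. eapply Rle_trans; [apply Rmult_le_compat_l; [apply powerRZ_le, Hq|apply HB]|].
      rewrite (Rmult_comm M), <- Rmult_assoc, <- powerRZ_add, Rmult_comm by (destruct Hq; lra).
      apply Rmult_le_compat_l; auto. apply powerRZ_anti; auto. lia. }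
    assert (B2 : (Cmod (Czpow (- q) (u + 1) * b (k + - (u + 1))%Z) <=
       M * powerRZ (Cmod q) (- 2 * Z.abs u - 3 + Z.abs k))%R).
    { rewrite Cmod_mult, Nb. eapply Rle_trans; [apply Rmult_le_compat_l; [apply powerRZ_le, Hq|apply HB]|].
      rewrite (Rmult_comm M), <- Rmult_assoc, <- powerRZ_add, Rmult_comm by (destruct Hq; lra).
      apply Rmult_le_compat_l; auto. apply powerRZ_anti; auto. lia. }
    apply Rle_trans with (powerRZ (Cmod q) (num_exp s t) *
       (2 * M * powerRZ (Cmod q) (- 2 * Z.abs u - 3 + Z.abs k)))%R.
    + apply Rmult_le_compat_l; [apply powerRZ_le, Hq|]. unfold Cminus.
      eapply Rle_trans; [apply Cmod_triangle|]. rewrite Cmod_opp. lra.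
    + rewrite (Rmult_comm (2 * M)), <- Rmult_assoc, <- !powerRZ_add, Rmult_comm by (destruct Hq; lra).
      apply Rmult_le_compat_l; [lra|]. apply powerRZ_anti; auto.
      specialize (HK t). fold u in HK. lia.
  - intros t. unfold G. apply sums_scal.
    eapply sums_eq; [apply (sums_minus _ _ _ _
      (sums_scal (Czpow (- q) (- num_shift s t)) _ _ (sums_shift _ _ (num_shift s t) HS))
      (sums_scal (Czpow (- q) (num_shift s t + 1)) _ _ (sums_shift _ _ (- (num_shift s t + 1)) HS)))|ring].
  - intros k. eapply sums_ext; [intros t; symmetry; apply HG|].
    apply sums_scal, sums_minus; [apply char_coef_sums; auto|]. apply sums_scal, char_coef_sums; auto.
  - replace (charnum q s (- q) * (2 * P)) with W; auto. apply (sums_unique _ _ _ W1).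
    eapply sums_eq; [eapply sums_ext; [|apply (sums_scal (2 * P) _ _ (charnum_sums q s (- q) Hq Hn0))]|apply Cmult_comm].
    intros t; cbv beta; ring.
Qed.

(** * The constant term *)

Lemma first_order_rec q (D : Z -> C) : nome q ->
  (forall k, D k = Czpow q (6 * k - 3) * D (k - 1)%Z) ->
  forall k, D k = Czpow q (3 * k * k) * D 0%Z.
Proof.
  intros Hq H. assert (Hq0 := nome_nz q Hq). apply Z.peano_ind.
  - rewrite Z.mul_0_r, Czpow_0. ring.
  - intros k IH. rewrite H. replace (Z.succ k - 1)%Z with k by lia. rewrite IH, Cmult_assoc, <- Czpow_add by auto.
    f_equal. f_equal. lia.
  - intros k IH. rewrite H in IH. replace (k - 1)%Z with (Z.pred k) in IH by lia.
    assert (N := Czpow_nz q (6 * k - 3) Hq0).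
    replace (D (Z.pred k)) with (/ Czpow q (6 * k - 3) * (Czpow q (6 * k - 3) * D (Z.pred k)))
      by (field; auto).
    rewrite IH, <- Czpow_opp, Cmult_assoc, <- Czpow_add by auto. f_equal. f_equal. lia.
Qed.

Lemma constant_term q s P : nome q -> sums (pf_lim_term q (-1)) P ->
  qinf (q ^ 2) * char_coef q s 0 = charnum q s (- q) * P
    + charnum q s q * (qinf (q ^ 2) * f3 (q ^ 2) / 2)
    - q ^ 2 * charnum q s (q ^ 2) * (qinf (q ^ 2) * omega3 (- q)).
Proof.
  intros Hq HP. assert (Hq0 := nome_nz q Hq).
  assert (J2 := qinf_nz (q ^ 2) (nome_pow q 1 Hq)).
  set (n1 := charnum q s q). set (n2 := charnum q s (q ^ 2)). set (J := qinf (q ^ 2)) in *.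
  set (D := fun k => J * char_coef q s k - n1 * f3_seq q k + q ^ 2 * n2 * omega3_seq q k).
  assert (HD : forall k, D k = Czpow q (6 * k - 3) * D (k - 1)%Z).
  { intros k. unfold D. rewrite char_coef_rec, f3_seq_rec, omega3_seq_rec by auto.
    replace (charnum q s (Czpow q 1)) with n1 by (rewrite Czpow_1; auto).
    replace (charnum q s (Czpow q 2)) with n2 by auto. fold J.
    (* The source of Y is q^(-2) times the one attached to num(q^2); the factor q^2 in [D]
       compensates. *)
    replace (2 * k - 1)%Z with (2 * k + 1 + -2)%Z by lia.
    replace (4 * k - 2)%Z with (4 * k + -2)%Z by lia.
    rewrite (Czpow_add q (2 * k + 1)), (Czpow_add q (4 * k)) by auto.
    change (Czpow q (-2)) with (/ q ^ 2). set (a := Czpow q (6 * k - 3)).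
    field. auto. }
  assert (F := first_order_rec q D Hq HD).
  assert (H1 := sums_plus _ _ _ _ (sums_minus _ _ _ _ (sums_scal J _ _ (char_coef_eval q s P Hq HP))
     (sums_scal n1 _ _ (f3_seq_eval q Hq))) (sums_scal (q ^ 2 * n2) _ _ (omega3_seq_eval q Hq))).
  assert (T1 := theta3_1 q Hq). fold J in T1.
  (* For D_k = q^(3k^2) D_0 the summand (-q)^k (D_k - q D_(k+1)) is D_0 times two consecutive terms
     of the pentagonal series with b = 1, so the total is 2 J_2 D_0. *)
  assert (H2 := sums_scal (D 0%Z) _ _ (sums_plus _ _ _ _ T1 (sums_shift _ _ 1 T1))).
  assert (E : J * (charnum q s (- q) * (2 * P)) - n1 * 0 + q ^ 2 * n2 * 0 = D 0%Z * (J + J)).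
  { apply (sums_congr _ _ _ _ H1 H2). intros k. cbv beta.
    transitivity (Czpow (- q) k * (D k - q * D (k + 1)%Z)); [unfold D; ring|].
    rewrite (F k), (F (k + 1)%Z), Czpow_neg by auto. unfold theta3. rewrite sgz_succ.
    replace (3 * k * k + 1 * k)%Z with (k + 3 * k * k)%Z by lia.
    replace (3 * (k + 1) * (k + 1) + 1 * (k + 1))%Z with (1 + (k + 3 * (k + 1) * (k + 1)))%Z by lia.
    rewrite !(Czpow_add q 1), !(Czpow_add q k), Czpow_1 by auto. ring. }
  assert (E2 : D 0%Z = charnum q s (- q) * P).
  { assert (H2' := C2_nz).
    replace (D 0%Z) with (D 0%Z * (J + J) / (2 * J)) by (field; auto). rewrite <- E. field; auto. }
  unfold D in E2. rewrite f3_seq_0, omega3_seq_0 in E2 by auto. fold J in E2.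
  rewrite <- E2. ring.
Qed.

(** * The quintuple product identity *)

Lemma sums_finite {T} (g : T -> C) (l : list T) :
  NoDup l -> (forall t, In t l) -> sums g (lsum g l).
Proof.
  intros Nl Hl. split.
  - exists (rsum (fun t => Cmod (g t)) l). intros L NL. apply rsum_incl; auto.
    + intros; apply Cmod_ge_0.
    + intros t _; auto.
  - intros eps He. exists l. intros L NL IL.
    rewrite (lsum_perm g L l).
    + replace (lsum g l - lsum g l) with (RtoC 0) by ring. rewrite Cmod_0; auto.
    + apply NoDup_Permutation; auto. intros x; split; auto.
Qed.

Lemma sums_parity (f : Z -> C) S :
  sums f S -> sums (fun n => f (2 * n)%Z + f (2 * n + 1)%Z) S.
Proof.
  intros H.
  apply (sums_iterated (fun p : Z * bool => f (2 * fst p + if snd p then 1 else 0)%Z)).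
  - apply (sums_reindex (fun p : Z * bool => (2 * fst p + if snd p then 1 else 0)%Z)
      (fun k => (k / 2, Z.eqb (k mod 2) 1)%Z) f); auto.
    + intros [n b]. cbn [fst snd].
      assert (E : ((2 * n + (if b then 1 else 0)) / 2 = n)%Z).
      { symmetry. apply (Z.div_unique _ 2 n (if b then 1 else 0)); [destruct b; lia|lia]. }
      assert (E' : ((2 * n + (if b then 1 else 0)) mod 2 = if b then 1 else 0)%Z).
      { symmetry. apply (Z.mod_unique _ 2 n); [destruct b; lia|lia]. }
      rewrite E, E'. destruct b; auto.
    + intros k. cbn [fst snd]. pose proof (Z.div_mod k 2 ltac:(lia)).
      pose proof (Z.mod_pos_bound k 2 ltac:(lia)).
      destruct (Z.eqb_spec (k mod 2) 1); lia.
  - intros n. cbn [fst snd].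
    eapply sums_eq; [apply (sums_finite _ (false :: true :: nil))|].
    + repeat constructor; simpl; intuition discriminate.
    + intros []; simpl; auto.
    + cbn [lsum fst snd]. replace (2 * n + 0)%Z with (2 * n)%Z by lia. ring.
Qed.

Lemma sums_mod3 (f : Z -> C) S :
  sums f S -> sums (fun n => f (3 * n)%Z + f (3 * n + 1)%Z + f (3 * n + 2)%Z) S.
Proof.
  (* [option bool] serves as a three-element type of residues. *)
  intros H. set (v := fun b : option bool => match b with None => 0 | Some false => 1 | Some true => 2 end%Z).
  apply (sums_iterated (fun p : Z * option bool => f (3 * fst p + v (snd p))%Z)).
  - apply (sums_reindex (fun p : Z * option bool => (3 * fst p + v (snd p))%Z)
      (fun k => (k / 3, if Z.eqb (k mod 3) 0 then None else Some (Z.eqb (k mod 3) 2))%Z) f); auto.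
    + intros [n b]. cbn [fst snd].
      assert (Hv : (0 <= v b < 3)%Z) by (unfold v; destruct b as [[]|]; lia).
      assert (E : ((3 * n + v b) / 3 = n)%Z).
      { symmetry. apply (Z.div_unique _ 3 n (v b)); lia. }
      assert (E' : ((3 * n + v b) mod 3 = v b)%Z).
      { symmetry. apply (Z.mod_unique _ 3 n); lia. }
      rewrite E, E'. destruct b as [[]|]; auto.
    + intros k. cbn [fst snd]. pose proof (Z.div_mod k 3 ltac:(lia)).
      pose proof (Z.mod_pos_bound k 3 ltac:(lia)).
      destruct (Z.eqb_spec (k mod 3) 0); [change (v None) with 0%Z; lia|].
      destruct (Z.eqb_spec (k mod 3) 2);
      [change (v (Some true)) with 2%Z|change (v (Some false)) with 1%Z]; lia.
  - intros n. cbn [fst snd].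
    eapply sums_eq; [apply (sums_finite _ (None :: Some false :: Some true :: nil))|].
    + repeat constructor; simpl; intuition discriminate.
    + intros [[]|]; simpl; auto.
    + cbn [lsum fst snd v]. replace (3 * n + 0)%Z with (3 * n)%Z by lia. ring.
Qed.

Lemma tsum_eq {T} (f : T -> C) S : sums f S -> tsum f = S.
Proof. intros H. apply (sums_unique f); auto. apply tsum_spec, H. Qed.

Lemma tri_nonneg n : (0 <= tri n)%Z.
Proof.
  pose proof (tri_spec n). destruct (Z_le_dec n 0); [|assert (0 <= n - 1)%Z by lia]; nia.
Qed.

(** Multiply the two theta series and collect x^k. Writing k = 3n + c and shifting the inner index
    by n completes the square: the inner sum is a power of p times the theta constant with b = 1 -
    2c. For c = 0 and 1 this is J_2 in base p, for c = 2 it is 0, which leaves the two series of the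
    identity. *)
Lemma quintuple (p x : C) : nome p -> x <> 0 ->
  sums (fun n => sgz n * Czpow p (tri n + n * n) * Czpow x (3 * n) * (1 + x * Czpow p n))
    (j (- x) p * j (p * x ^ 2) (p ^ 2) / qinf (p ^ 2)).
Proof.
  intros Hp Hx. assert (Hp0 := nome_nz p Hp). assert (Hp2 : nome (p ^ 2)) by (apply nome_pow; auto).
  assert (Hx2 : p * x ^ 2 <> 0) by (apply Cmult_neq_0; auto; apply Cpow_nz; auto).
  assert (H1 := j_sums p (- x) Hp (Copp_nz x Hx)).
  assert (H2 := j_sums (p ^ 2) (p * x ^ 2) Hp2 Hx2).
  assert (JN := qinf_nz _ Hp2).
  set (L := fun k => tsum (fun l => sgz l * Czpow p (tri (k - 2 * l) + l * l))).
  assert (EF : forall k l, j_term p (- x) (k - 2 * l) * j_term (p ^ 2) (p * x ^ 2) l =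
    Czpow x k * (sgz l * Czpow p (tri (k - 2 * l) + l * l))).
  { intros k l. unfold j_term. rewrite Czpow_neg, Czpow_base_mul by (auto; apply Cpow_nz; auto).
    rewrite !Czpow_pow by auto. change (Z.of_nat 2) with 2%Z.
    assert (E := sgz_sq (k - 2 * l)).
    replace (tri (k - 2 * l) + l * l)%Z with (tri (k - 2 * l) + 2 * tri l + l)%Z
      by (pose proof (tri_spec l); lia).
    assert (Ek : Czpow x k = Czpow x (k - 2 * l) * Czpow x (2 * l))
      by (rewrite <- Czpow_add by auto; f_equal; lia).
    rewrite Ek, !(Czpow_add p) by auto.
    set (a := (k - 2 * l)%Z) in *.
    transitivity ((sgz a * sgz a) * (Czpow p (tri a) * Czpow x a * (sgz l * Czpow p (2 * tri l) *
      (Czpow p l * Czpow x (2 * l))))); [ring|rewrite E; ring]. }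
  assert (HL : exists V, sums (fun k => Czpow x k * L k) V /\ V = j (- x) p * j (p * x ^ 2) (p ^ 2)).
  { set (F := fun q : Z * Z => j_term p (- x) (fst q - 2 * snd q) * j_term (p ^ 2) (p * x ^ 2) (snd q)).
    destruct (sums_exchange F (fun k => Czpow x k * L k)
      (fun l => j (- x) p * j_term (p ^ 2) (p * x ^ 2) l)) as (V & V1 & V2).
    - apply (bounded_sums_inj (fun q : Z * Z => (fst q - 2 * snd q, snd q)%Z)
        (fun q => Cmod (j_term p (- x) (fst q) * j_term (p ^ 2) (p * x ^ 2) (snd q)))).
      + intros [a b] [c d] E. apply pair_equal_spec in E. cbn [fst snd] in E. destruct E as [E ->].
        apply Z.sub_cancel_r in E. congruence.
      + eapply bounded_sums_le; [|apply (bounded_sums_prod _ _ (fun t => Cmod_ge_0 (j_term p (- x) t))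
          (fun t => Cmod_ge_0 (j_term (p ^ 2) (p * x ^ 2) t)) (proj1 H1) (proj1 H2))].
        intros [a b]; simpl; rewrite Cmod_mult; lra.
    - intros k. unfold F. cbn [fst snd].
      eapply sums_ext; [intros l; symmetry; apply EF|]. apply sums_scal. apply tsum_spec.
      apply (abs_quad p 1 1); auto; [lra|].
      intros l. rewrite Cmod_mult, Cmod_sgz, Cmod_Czpow by auto.
      apply Rmult_le_compat_l; [lra|]. apply powerRZ_anti; auto.
      pose proof (tri_nonneg (k - 2 * l)). pose proof (sq_lb 1 l ltac:(lia)). lia.
    - intros l. unfold F. cbn [fst snd]. eapply sums_eq; [|apply Cmult_comm].
      eapply sums_ext; [|apply (sums_scal (j_term (p ^ 2) (p * x ^ 2) l) _ _ (sums_shift _ _ (- (2 * l)) H1))].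
      intros k. cbv beta. replace (k + - (2 * l))%Z with (k - 2 * l)%Z by lia. apply Cmult_comm.
    - exists V; split; auto. apply (sums_unique _ _ _ V2). apply sums_scal; auto. }
  destruct HL as (V & HV & ->).
  assert (T0 := theta3_1 p Hp). assert (T1 := theta3_m1 p Hp).
  assert (T2 := theta3_neg p 3 _ (theta3_3 p Hp)).
  set (J := qinf (p ^ 2)) in *.
  assert (Hc : forall n b c d S, sums (theta3 p b) S ->
     (forall l, (tri (3 * n + c - 2 * (l + n)) + (l + n) * (l + n) = d + (3 * l * l + b * l))%Z) ->
     L (3 * n + c)%Z = sgz n * Czpow p d * S).
  { intros n b c d S HS Hd. apply tsum_eq.
    eapply sums_ext; [|apply (sums_shift _ _ (- n) (sums_scal (sgz n * Czpow p d) _ _ HS))].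
    intros l. cbv beta. specialize (Hd (l + - n)%Z).
    replace (l + - n + n)%Z with l in Hd by lia. rewrite Hd. unfold theta3.
    rewrite sgz_add, sgz_opp, (Czpow_add p d) by auto.
    assert (E := sgz_sq n).
    set (y := Czpow p (3 * (l + - n) * (l + - n) + b * (l + - n))).
    transitivity ((sgz n * sgz n) * (sgz l * Czpow p d * y)); [ring|rewrite E; ring]. }
  unfold Cdiv. rewrite Cmult_comm.
  eapply sums_ext; [|apply (sums_scal (/ J) _ _ (sums_mod3 _ _ HV))].
  intros n. cbv beta.
  replace (L (3 * n)%Z) with (L (3 * n + 0)%Z) by (f_equal; lia).
  rewrite (Hc n 1%Z 0%Z (tri n + n * n)%Z J T0), (Hc n (-1)%Z 1%Z (n + (tri n + n * n))%Z J T1),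
    (Hc n (- (3))%Z 2%Z (3 * n + 1 + (tri n + n * n) - n)%Z 0 T2).
  - rewrite (Czpow_succ x), (Czpow_add p n) by auto. field. auto.
  - intros l. pose proof (tri_spec n). pose proof (tri_spec (3 * n + 2 - 2 * (l + n))). lia.
  - intros l. pose proof (tri_spec n). pose proof (tri_spec (3 * n + 1 - 2 * (l + n))). lia.
  - intros l. pose proof (tri_spec n). pose proof (tri_spec (3 * n + 0 - 2 * (l + n))). lia.
Qed.

Section Products.

Context (q : C) (s : Z) (Hq : nome q).

Let p14 : nome (q ^ 14) := nome_pow q 13 Hq.

(** Base q^14 because 21 n^2 - 7n = 14 (n(n-1)/2 + n^2). The two forms are the identity at x = q^a
    and at -x, where the signs (-1)^n and (-1)^(3n) cancel. *)
Lemma quintuple14 a : let x := Czpow q a in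
  sums (fun n => sgz n * Czpow q (21 * n * n - 7 * n + 3 * a * n) * (1 + Czpow q (a + 14 * n)))
    (j (- Czpow q a) (q ^ 14) * j (Czpow q (14 + 2 * a)) (q ^ 28) / J 28 q) /\
  sums (fun n => Czpow q (21 * n * n - 7 * n + 3 * a * n) * (1 - Czpow q (a + 14 * n)))
    (j (Czpow q a) (q ^ 14) * j (Czpow q (14 + 2 * a)) (q ^ 28) / J 28 q).
Proof.
  intros x. assert (Hq0 := nome_nz q Hq). assert (Hx : x <> 0) by (apply Czpow_nz; auto).
  assert (E28 : (q ^ 14) ^ 2 = q ^ 28) by (rewrite <- Cpow_mult_r; reflexivity).
  assert (Ex : q ^ 14 * x ^ 2 = Czpow q (14 + 2 * a)).
  { rewrite Czpow_add by auto. change (Czpow q 14) with (q ^ 14). f_equal.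
    unfold x. rewrite <- Czpow_nat, Czpow_mult by auto. f_equal. lia. }
  assert (Ex' : q ^ 14 * (- x) ^ 2 = Czpow q (14 + 2 * a)) by (rewrite <- Ex; ring).
  assert (Ee : forall n, Czpow q (21 * n * n - 7 * n + 3 * a * n) =
     Czpow (q ^ 14) (tri n + n * n) * Czpow x (3 * n)).
  { intros n. unfold x. rewrite Czpow_pow, Czpow_mult, <- Czpow_add by auto. f_equal.
    change (Z.of_nat 14) with 14%Z. pose proof (tri_spec n). lia. }
  assert (En : forall n, Czpow q (a + 14 * n) = x * Czpow (q ^ 14) n).
  { intros n. rewrite Czpow_add, Czpow_pow by auto. reflexivity. }
  split.
  - assert (H := quintuple (q ^ 14) x p14 Hx). rewrite E28, Ex in H.
    eapply sums_ext; [|exact H]. intros n. cbv beta. rewrite Ee, En. ring.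
  - assert (H := quintuple (q ^ 14) (- x) p14 (Copp_nz x Hx)).
    rewrite E28, Ex' in H. replace (- - x) with x in H by ring.
    eapply sums_ext; [|exact H]. intros n. cbv beta. rewrite Ee, En.
    rewrite Czpow_neg by auto.
    assert (E3 : sgz (3 * n) = sgz n).
    { replace (3 * n)%Z with (2 * n + n)%Z by lia. rewrite sgz_add, sgz_double. ring. }
    rewrite E3. assert (E := sgz_sq n).
    transitivity ((sgz n * sgz n) * (Czpow (q ^ 14) (tri n + n * n) * Czpow x (3 * n) *
       (1 - x * Czpow (q ^ 14) n))); [ring|rewrite E; ring].
Qed.

(** With u = s + 7t, z^(-u) - z^(u+1) = z^(-u) (1 - z^(2u+1)) and 2u + 1 = 1 + 2s + 14t: this is the
    quintuple shape for a = 1 + 2s, and the odd exponent turns the minus sign into a plus at z =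
    -q. *)
Lemma charnum_neg : charnum q s (- q) = Czpow (- q) (- s) *
  (j (- Czpow q (1 + 2 * s)) (q ^ 14) * j (Czpow q (16 + 4 * s)) (q ^ 28) / J 28 q).
Proof.
  assert (Hq0 := nome_nz q Hq). destruct (quintuple14 (1 + 2 * s)) as [H _].
  replace (14 + 2 * (1 + 2 * s))%Z with (16 + 4 * s)%Z in H by lia.
  apply (sums_congr _ _ _ _ (charnum_sums q s (- q) Hq (Copp_nz q Hq0)) (sums_scal (Czpow (- q) (- s)) _ _ H)).
  intros t. cbv beta. rewrite !Czpow_neg by auto. unfold num_weight.
  rewrite sgz_succ, !sgz_opp.
  replace (sgz (num_shift s t)) with (sgz s * sgz t).
  2:{ unfold num_shift. replace (s + 7 * t)%Z with (2 * (3 * t) + (s + t))%Z by lia.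
      rewrite (sgz_add (2 * (3 * t))), sgz_double, sgz_add. ring. }
  replace (num_shift s t + 1)%Z with (- num_shift s t + (1 + 2 * s + 14 * t))%Z by (unfold num_shift; lia).
  rewrite (Czpow_add q (- num_shift s t)) by auto. set (y := Czpow q (1 + 2 * s + 14 * t)).
  assert (E : Czpow q (num_exp s t) * Czpow q (- num_shift s t) =
    Czpow q (- s) * Czpow q (21 * t * t - 7 * t + 3 * (1 + 2 * s) * t)).
  { rewrite <- !Czpow_add by auto. f_equal. unfold num_exp, num_shift. lia. }
  transitivity (sgz s * sgz t * (Czpow q (num_exp s t) * Czpow q (- num_shift s t)) * (1 + y)); [ring|].
  rewrite E. ring.
Qed.

Lemma charnum_1 : charnum q s q = Czpow q (- s) *
  (j (Czpow q (1 + 2 * s)) (q ^ 14) * j (Czpow q (16 + 4 * s)) (q ^ 28) / J 28 q).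
Proof.
  assert (Hq0 := nome_nz q Hq). destruct (quintuple14 (1 + 2 * s)) as [_ H].
  replace (14 + 2 * (1 + 2 * s))%Z with (16 + 4 * s)%Z in H by lia.
  apply (sums_congr _ _ _ _ (charnum_sums q s q Hq Hq0) (sums_scal (Czpow q (- s)) _ _ H)).
  intros t. cbv beta. unfold num_weight.
  replace (num_shift s t + 1)%Z with (- num_shift s t + (1 + 2 * s + 14 * t))%Z by (unfold num_shift; lia).
  rewrite (Czpow_add q (- num_shift s t)) by auto. set (y := Czpow q (1 + 2 * s + 14 * t)).
  assert (E : Czpow q (num_exp s t) * Czpow q (- num_shift s t) =
    Czpow q (- s) * Czpow q (21 * t * t - 7 * t + 3 * (1 + 2 * s) * t)).
  { rewrite <- !Czpow_add by auto. f_equal. unfold num_exp, num_shift. lia. }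
  transitivity ((Czpow q (num_exp s t) * Czpow q (- num_shift s t)) * (1 - y)); [ring|].
  rewrite E. ring.
Qed.

(** At z = q^2 the two summands of equal t do not have the quintuple shape. Reflecting t -> -t in
    one theta value and t -> -1 - t in the other pairs them correctly, with a = 6 - 2s. *)
Lemma charnum_2 : charnum q s (q ^ 2) = Czpow q (- (2 * s)) *
  (j (Czpow q (6 - 2 * s)) (q ^ 14) * j (Czpow q (26 - 4 * s)) (q ^ 28) / J 28 q).
Proof.
  assert (Hq0 := nome_nz q Hq). destruct (quintuple14 (6 - 2 * s)) as [_ H].
  replace (14 + 2 * (6 - 2 * s))%Z with (26 - 4 * s)%Z in H by lia.
  change (q ^ 2) with (Czpow q 2). rewrite charnum_theta21 by auto.
  apply (sums_congr _ _ _ _ (sums_minus _ _ _ _ (sums_neg _ _ (theta21_sums q s (- (2)) Hq))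
     (sums_scal (Czpow q 2) _ _ (sums_refl _ _ (-1) (theta21_sums q s 2 Hq))))
     (sums_scal (Czpow q (- (2 * s))) _ _ H)).
  intros t. cbv beta. unfold num_weight.
  set (y := Czpow q (21 * t * t - 7 * t + 3 * (6 - 2 * s) * t)).
  replace (Czpow q (- (2 * s)) * (y * (1 - Czpow q (6 - 2 * s + 14 * t)))) with
   (Czpow q (- (2 * s)) * y - Czpow q (- (2 * s)) * y * Czpow q (6 - 2 * s + 14 * t)) by ring.
  unfold y. rewrite <- !Czpow_add by auto.
  f_equal; apply (f_equal (Czpow q)); unfold num_exp, num_shift; lia.
Qed.

End Products.

(** * The exponential e *)

Lemma e_add a b : e (a + b) = e a * e b.
Proof.
  unfold e, Cexp. replace (2 * PI * Ci * (a + b)) with (2 * PI * Ci * a + 2 * PI * Ci * b) by ring.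
  set (x := 2 * PI * Ci * a). set (y := 2 * PI * Ci * b).
  destruct x as [x1 x2], y as [y1 y2]. unfold Cmult, Cplus, Re, Im; simpl.
  rewrite exp_plus, cos_plus, sin_plus. f_equal; ring.
Qed.

Lemma e_0 : e 0 = 1.
Proof.
  unfold e, Cexp. replace (2 * PI * Ci * 0) with (RtoC 0) by ring. simpl.
  rewrite exp_0, cos_0, sin_0. unfold RtoC. f_equal; ring.
Qed.

Lemma e_nz a : e a <> 0.
Proof.
  intros E. apply C1_nz. rewrite <- e_0. replace (RtoC 0) with (a + - a) at 1 by ring.
  rewrite e_add, E. ring.
Qed.

Lemma e_Z n a : e (RtoC (IZR n) * a) = Czpow (e a) n.
Proof.
  revert n. apply Z.peano_ind.
  - replace (RtoC (IZR 0) * a) with (RtoC 0) by (simpl; ring). apply e_0.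
  - intros n IH. unfold Z.succ. rewrite plus_IZR, RtoC_plus.
    replace ((RtoC (IZR n) + RtoC 1) * a) with (RtoC (IZR n) * a + a) by ring.
    rewrite e_add, IH, Czpow_succ by apply e_nz. reflexivity.
  - intros n IH. assert (E := Czpow_succ (e a) (Z.pred n) (e_nz a)).
    replace (Z.pred n + 1)%Z with n in E by lia. rewrite <- IH in E.
    replace (RtoC (IZR n) * a) with (RtoC (IZR (Z.pred n)) * a + a) in E.
    + rewrite e_add in E.
      transitivity (e (RtoC (IZR (Z.pred n)) * a) * e a * / e a); [field; apply e_nz|].
      rewrite E. field. apply e_nz.
    + unfold Z.pred. rewrite plus_IZR, RtoC_plus. simpl. ring.
Qed.

Lemma Cmod_e a : Cmod (e a) = exp (- (2 * PI * Im a)).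
Proof.
  unfold e, Cexp, Cmod. destruct a as [x y]. simpl.
  match goal with |- sqrt (?u * cos ?v * _ + _) = _ => set (A := u); set (B := v) end.
  replace (A * cos B * (A * cos B * 1) + A * sin B * (A * sin B * 1))%R with
    ((A * A) * (Rsqr (sin B) + Rsqr (cos B)))%R by (unfold Rsqr; ring).
  rewrite sin2_cos2, Rmult_1_r, sqrt_square.
  - unfold A. f_equal. ring.
  - left; apply exp_pos.
Qed.

Lemma nome_e tau : (0 < Im tau)%R -> nome (e tau).
Proof.
  intros H. unfold nome. rewrite Cmod_e. split; [apply exp_pos|].
  rewrite <- exp_0. apply exp_increasing.
  assert (0 < PI)%R by apply PI_RGT_0. assert (0 < PI * Im tau)%R by (apply Rmult_lt_0_compat; auto). lra.
Qed.

(** * Numerator and denominator of the character *)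

(** The two theta functions of the denominator are the even and the odd terms of j(z;q); i -> -i is
    needed because [Theta] carries z^(-mk). The sign of the odd terms accounts for the
    difference. *)
Lemma chi_den_eq tau w : (0 < Im tau)%R ->
  chi_den w tau = e (RtoC (1 / 8) * tau) * e (RtoC (- (1 / 2)) * w) * j (e w) (e tau).
Proof.
  intros Ht. assert (Hq := nome_e tau Ht). set (q := e tau) in *. set (z := e w).
  assert (Hz : z <> 0) by apply e_nz.
  assert (HJ := j_sums q z Hq Hz).
  set (c := e (RtoC (1 / 8) * tau) * e (RtoC (- (1 / 2)) * w)).
  assert (Hodd : forall f : Z -> C, abs_summable f -> forall (h : Z -> Z), (forall u v, h u = h v -> u = v) ->
    sums (fun n => f (h n)) (tsum (fun n => f (h n)))).
  { intros f Hf h Hh. apply tsum_spec. apply (bounded_sums_inj h (fun t => Cmod (f t))); auto. }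
  assert (H0 := Hodd _ (proj1 HJ) (fun n => 2 * n)%Z ltac:(cbv beta; intros; lia)).
  assert (H1 := Hodd _ (proj1 HJ) (fun n => 2 * n + 1)%Z ltac:(cbv beta; intros; lia)).
  assert (EJ : j z q = tsum (fun n => j_term q z (2 * n)) + tsum (fun n => j_term q z (2 * n + 1))).
  { apply (sums_unique _ _ _ (sums_parity _ _ HJ)). apply sums_plus; auto. }
  unfold chi_den.
  assert (T1 : Theta 1 2 w tau =
    c * tsum (fun n => j_term q z (2 * n))).
  { apply sums_ZSeries. eapply sums_ext; [|apply (sums_scal c _ _ (sums_neg _ _ H0))].
    intros i. cbv beta zeta. unfold j_term, c.
    replace (2 * - i)%Z with (2 * (- i))%Z by lia. rewrite sgz_double.
    replace (tri (2 * - i)) with (2 * i * i + i)%Z by (pose proof (tri_spec (2 * - i)); lia).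
    unfold q, z. rewrite <- !e_Z.
    transitivity ((e (RtoC (1 / 8) * tau) * e (IZR (2 * i * i + i) * tau)) *
      (e (RtoC (- (1 / 2)) * w) * e (IZR (2 * - i) * w))); [ring|].
    rewrite <- !e_add. f_equal; f_equal; rewrite <- Cmult_plus_distr_r, <- RtoC_plus; f_equal; f_equal.
    - rewrite plus_IZR, !mult_IZR. field.
    - rewrite mult_IZR, opp_IZR. field. }
  assert (T2 : Theta (-1) 2 w tau =
    - c * tsum (fun n => j_term q z (2 * n + 1))).
  { apply sums_ZSeries. eapply sums_ext; [|apply (sums_scal (- c) _ _ (sums_neg _ _ H1))].
    intros i. cbv beta zeta. unfold j_term, c.
    rewrite sgz_succ, sgz_double.
    replace (tri (2 * - i + 1)) with (2 * i * i - i)%Z by (pose proof (tri_spec (2 * - i + 1)); lia).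
    unfold q, z. rewrite <- !e_Z.
    transitivity ((e (RtoC (1 / 8) * tau) * e (IZR (2 * i * i - i) * tau)) *
      (e (RtoC (- (1 / 2)) * w) * e (IZR (2 * - i + 1) * w))); [ring|].
    rewrite <- !e_add. f_equal; f_equal; rewrite <- Cmult_plus_distr_r, <- RtoC_plus; f_equal; f_equal.
    - rewrite minus_IZR, !mult_IZR. field.
    - rewrite plus_IZR, mult_IZR, opp_IZR. field. }
  rewrite T1, T2, EJ. ring.
Qed.

(** Completing the square: 21 (i + (2s+1)/14)^2 = 21 i^2 + 3 (2s+1) i + 3 (2s+1)^2/28. The second
    theta function gives the same weights after i -> -i. *)
Lemma chi_num_eq tau w s : (0 < Im tau)%R ->
  chi_num 3 7 (2 * s) w tau =
  e (RtoC (3 * (2 * IZR s + 1) ^ 2 / 28) * tau) * e (RtoC (- (1 / 2)) * w) * charnum (e tau) s (e w).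
Proof.
  intros Ht. assert (Hq := nome_e tau Ht). set (q := e tau) in *. set (z := e w).
  assert (Hz : z <> 0) by apply e_nz.
  set (c := e (RtoC (3 * (2 * IZR s + 1) ^ 2 / 28) * tau) * e (RtoC (- (1 / 2)) * w)).
  destruct (Czpow_bound q z Hq Hz) as (B & HB & H).
  assert (H0 := num_weight_sums q s B 1 (fun t => Czpow z (- num_shift s t)) Hq HB ltac:(lra)
    ltac:(intros t; rewrite Rmult_1_l; rewrite <- Z.abs_opp; apply H)).
  assert (H1 := num_weight_sums q s B (Cmod z) (fun t => Czpow z (num_shift s t + 1)) Hq HB (Cmod_ge_0 z)
    ltac:(intros t; cbv beta; rewrite Czpow_succ, Cmod_mult, Rmult_comm by auto;
          apply Rmult_le_compat_l; [apply Cmod_ge_0|apply H])).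
  assert (EN : charnum q s z = tsum (fun t => num_weight q s t * Czpow z (- num_shift s t))
     - tsum (fun t => num_weight q s t * Czpow z (num_shift s t + 1))).
  { apply (sums_congr _ _ _ _ (charnum_sums q s z Hq Hz) (sums_minus _ _ _ _ H0 H1)).
    intros t; cbv beta; ring. }
  unfold chi_num.
  assert (T1 : Theta (2 * s + 1) 7 w (RtoC (IZR 3) * tau) =
    c * tsum (fun t => num_weight q s t * Czpow z (- num_shift s t))).
  { apply sums_ZSeries. eapply sums_ext; [|apply (sums_scal c _ _ H0)].
    intros i. cbv beta zeta. unfold num_weight, c, q, z. rewrite <- !e_Z.
    transitivity ((e (RtoC (3 * (2 * IZR s + 1) ^ 2 / 28) * tau) * e (IZR (num_exp s i) * tau)) *
      (e (RtoC (- (1 / 2)) * w) * e (IZR (- num_shift s i) * w))); [ring|].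
    rewrite <- !e_add, Cmult_assoc, <- RtoC_mult.
    f_equal; f_equal; rewrite <- Cmult_plus_distr_r, <- RtoC_plus; f_equal; f_equal;
      unfold num_exp, num_shift; rewrite ?opp_IZR, ?plus_IZR, ?mult_IZR, ?plus_IZR, ?mult_IZR; field. }
  assert (T2 : Theta (- (2 * s + 1)) 7 w (RtoC (IZR 3) * tau) =
    c * tsum (fun t => num_weight q s t * Czpow z (num_shift s t + 1))).
  { apply sums_ZSeries. eapply sums_ext; [|apply (sums_scal c _ _ (sums_neg _ _ H1))].
    intros i. cbv beta zeta. unfold num_weight, c, q, z. rewrite <- !e_Z.
    transitivity ((e (RtoC (3 * (2 * IZR s + 1) ^ 2 / 28) * tau) * e (IZR (num_exp s (- i)) * tau)) *
      (e (RtoC (- (1 / 2)) * w) * e (IZR (num_shift s (- i) + 1) * w))); [ring|].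
    rewrite <- !e_add, Cmult_assoc, <- RtoC_mult.
    f_equal; f_equal; rewrite <- Cmult_plus_distr_r, <- RtoC_plus; f_equal; f_equal;
      unfold num_exp, num_shift; rewrite ?plus_IZR, ?mult_IZR, ?opp_IZR, ?plus_IZR, ?mult_IZR, ?opp_IZR; field. }
  rewrite T1, T2, EN. ring.
Qed.

(** * Uniqueness of Laurent coefficients *)

Lemma series_terms_bounded (f : nat -> C) l : is_series f l -> exists M : R, forall n, (Cmod (f n) <= M)%R.
Proof.
  intros H. assert (L := is_series_Clim _ _ H). destruct (L 1%R Rlt_0_1) as (N & HN).
  set (M0 := rsum (fun n => Cmod (f n)) (seq 0 (S N))).
  exists (M0 + 2)%R. intros n.
  assert (P : (0 <= M0)%R) by (apply rsum_nonneg; intros; apply Cmod_ge_0).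
  destruct (le_lt_dec n N) as [h|h].
  - assert (A := rsum_incl (fun n => Cmod (f n)) (n :: nil) (seq 0 (S N)) (fun t => Cmod_ge_0 _)
      ltac:(constructor; [simpl; tauto|constructor]) (seq_NoDup _ _)
      ltac:(intros x [->|[]]; apply in_seq; lia)).
    simpl rsum at 1 in A. fold M0 in A. lra.
  - destruct n as [|n]; [lia|].
    replace (f (S n)) with ((sum_n f (S n) - l) - (sum_n f n - l)).
    + assert (A1 := HN (S n) ltac:(lia)). assert (A2 := HN n ltac:(lia)). unfold Cminus at 1.
      eapply Rle_trans; [apply Cmod_triangle|]. rewrite Cmod_opp. lra.
    + rewrite sum_Sn. change plus with Cplus. ring.
Qed.

Lemma is_Zseries_minus (f g : Z -> C) a b :
  is_Zseries f a -> is_Zseries g b -> is_Zseries (fun k => f k - g k) (a - b).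
Proof.
  intros (a1 & a2 & A1 & A2 & ->) (b1 & b2 & B1 & B2 & ->).
  exists (a1 - b1), (a2 - b2). split; [|split].
  - apply (is_series_minus _ _ _ _ A1 B1).
  - apply (is_series_minus _ _ _ _ A2 B2).
  - ring.
Qed.

(** * Averages over roots of unity and uniqueness of coefficients *)

Definition root_arg (N : nat) (t : nat) : C := RtoC (INR t / INR N).

(** A discrete Cauchy integral: the mean of the m-th powers of the N-th roots of unity, which
    detects m = 0 among |m| < N. *)
Definition root_avg (N : nat) (m : Z) : C :=
  / RtoC (INR N) * lsum (fun t => e (RtoC (IZR m) * root_arg N t)) (seq 0 N).

Lemma Cmod_e_real (x : R) : Cmod (e x) = 1.
Proof. rewrite Cmod_e. simpl. rewrite Rmult_0_r, Ropp_0. apply exp_0. Qed.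

Lemma root_avg_bound N m : (0 < N)%nat -> (Cmod (root_avg N m) <= 1)%R.
Proof.
  intros HN. assert (P : (0 < INR N)%R) by (apply lt_0_INR; auto).
  unfold root_avg. rewrite Cmod_mult, Cmod_inv, Cmod_R, Rabs_pos_eq
    by (try lra; intros E; apply (f_equal fst) in E; simpl in E; lra).
  apply (Rmult_le_reg_l (INR N)); auto. rewrite <- Rmult_assoc, Rinv_r, Rmult_1_l, Rmult_1_r by lra.
  eapply Rle_trans; [apply Cmod_lsum|].
  apply Rle_trans with (rsum (fun _ => 1%R) (seq 0 N)).
  - apply rsum_le. intros t _. unfold root_arg. rewrite <- RtoC_mult, Cmod_e_real. lra.
  - right. clear. generalize 0%nat. induction N as [|N IH]; intros k; simpl seq; [reflexivity|].
    cbn [rsum]. rewrite IH, S_INR. ring.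
Qed.

Lemma e_neq_1 (x : R) : (0 < Rabs x < 1)%R -> e x <> 1.
Proof.
  intros Hx E.
  assert (C1 : (cos (2 * (PI * x)) = 1)%R).
  { unfold e, Cexp in E. apply (f_equal fst) in E. simpl in E.
    match type of E with (exp ?a * cos ?b = _)%R => replace a with 0%R in E by ring;
      replace b with (2 * (PI * x))%R in E by ring end.
    rewrite exp_0, Rmult_1_l in E. exact E. }
  rewrite cos_2a_sin in C1.
  assert (S0 : sin (PI * x) = 0%R) by nra.
  assert (HP := PI_RGT_0).
  destruct (Rle_dec 0 x).
  - rewrite Rabs_pos_eq in Hx by auto. assert (0 < sin (PI * x))%R; [|lra]. apply sin_gt_0; nra.
  - rewrite Rabs_left in Hx by lra. assert (0 < sin (- (PI * x)))%R.
    + apply sin_gt_0; nra.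
    + rewrite sin_neg in H. lra.
Qed.

Lemma root_avg_vanish N m : (0 < Z.abs m < Z.of_nat N)%Z -> root_avg N m = 0.
Proof.
  intros Hm. assert (P : (0 < INR N)%R) by (apply lt_0_INR; lia).
  set (x := (IZR m / INR N)%R).
  assert (E : forall t, e (RtoC (IZR m) * root_arg N t) = e x ^ t).
  { intros t. rewrite <- Czpow_nat, <- e_Z, <- INR_IZR_INZ. unfold root_arg, x.
    rewrite <- !RtoC_mult. f_equal. f_equal. field. lra. }
  assert (X1 : e x <> 1).
  { apply e_neq_1. unfold x, Rdiv. rewrite Rabs_mult, <- abs_IZR, Rabs_inv, (Rabs_pos_eq (INR N)) by lra.
    split.
    - apply Rmult_lt_0_compat; [apply IZR_lt; lia|apply Rinv_0_lt_compat; auto].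
    - apply (Rmult_lt_reg_r (INR N)); auto. rewrite Rmult_assoc, Rinv_l, Rmult_1_r, Rmult_1_l by lra.
      rewrite INR_IZR_INZ. apply IZR_lt; lia. }
  assert (XN : e x ^ N = 1).
  { rewrite <- Czpow_nat, <- e_Z, <- INR_IZR_INZ, <- RtoC_mult. unfold x.
    replace (INR N * (IZR m / INR N))%R with (IZR m * 1)%R by (field; lra).
    rewrite RtoC_mult, e_Z. replace (e 1) with (RtoC 1); [apply Czpow_1_l|].
    unfold e, Cexp. simpl.
    match goal with |- _ = (exp ?a * cos ?b, _)%R => replace a with 0%R by ring;
      replace b with (2 * PI)%R by ring end.
    rewrite exp_0, cos_2PI, sin_2PI. unfold RtoC. f_equal; ring. }
  assert (G : forall n, lsum (fun t => e x ^ t) (seq 0 n) * (1 - e x) = 1 - e x ^ n).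
  { induction n as [|n IH]; [simpl; ring|]. rewrite seq_S, lsum_app. simpl lsum at 2.
    rewrite Cmult_plus_distr_r, IH. simpl. ring. }
  unfold root_avg. rewrite (lsum_ext _ (fun t => e x ^ t)) by (intros; apply E).
  specialize (G N). rewrite XN in G.
  replace (lsum (fun t => e x ^ t) (seq 0 N)) with
    (lsum (fun t => e x ^ t) (seq 0 N) * (1 - e x) * / (1 - e x)).
  - rewrite G. ring.
  - field. intros F. apply X1. replace (e x) with (1 - (1 - e x)) by ring. rewrite F; ring.
Qed.

Lemma root_avg_0 N : (0 < N)%nat -> root_avg N 0 = 1.
Proof.
  intros HN. unfold root_avg.
  assert (E : lsum (fun t => e (RtoC 0 * root_arg N t)) (seq 0 N) = RtoC (INR N)).
  { rewrite (lsum_ext _ (fun _ => 1)).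
    - clear. generalize 0%nat at 1. induction N as [|N IH]; intros k; [reflexivity|].
      cbn [seq lsum]. rewrite IH, S_INR, RtoC_plus. ring.
    - intros t _. rewrite Cmult_0_l. apply e_0. }
  rewrite E. field. intros F. apply (f_equal fst) in F. simpl in F.
  assert (0 < INR N)%R by (apply lt_0_INR; auto). lra.
Qed.

Lemma sums_lsum {T U} (f : U -> T -> C) (S : U -> C) (L : list U) :
  (forall u, sums (f u) (S u)) -> sums (fun t => lsum (fun u => f u t) L) (lsum S L).
Proof.
  intros H. induction L as [|u L IH]; simpl; [apply sums_zero; auto|].
  apply sums_plus; auto.
Qed.

(** The hypothesis gives only ordered convergence of the two halves. Convergence on an inner and an
    outer circle bounds the terms and makes the series absolutely summable on a circle between them.
    Averaging over N-th roots of unity there and letting N grow isolates the coefficient of z^0. *)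
Lemma laurent_unique (d : Z -> C) (s : Z) (tau : C) : (0 < Im tau)%R ->
  (forall w, (Cmod (e tau) < Cmod (e w) < 1)%R ->
     is_Zseries (fun k => d k * e (RtoC (IZR (- (k + s))) * w)) 0) ->
  d (- s)%Z = 0.
Proof.
  intros Ht H. assert (Hpi := PI_RGT_0).
  (* With th = |e(a)| one has |q| = th^4, so the circles of radius th, th^2, th^3 lie strictly
     between |q| and 1. *)
  set (a := Ci * RtoC (Im tau / 4)).
  assert (Ia : Im a = (Im tau / 4)%R) by (unfold a; simpl; ring).
  assert (Hth : nome (e a)) by (apply nome_e; rewrite Ia; lra).
  assert (Hmod : forall (n : nat) (x : R), (0 < n < 4)%nat ->
     (Cmod (e tau) < Cmod (e (RtoC (INR n) * a + RtoC x)) < 1)%R).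
  { intros n x Hn. rewrite !Cmod_e. rewrite <- exp_0.
    assert (E : Im (RtoC (INR n) * a + RtoC x) = (INR n * (Im tau / 4))%R) by (unfold a; simpl; ring).
    rewrite E. assert (1 <= INR n)%R by (apply (le_INR 1); lia).
    assert (INR n <= 3)%R by (replace 3%R with (INR 3) by (simpl; ring); apply le_INR; lia).
    assert (0 < PI * Im tau)%R by (apply Rmult_lt_0_compat; auto).
    split; apply exp_increasing; nra. }
  set (th := Cmod (e a)).
  assert (Cn : forall (n : nat) (x : R) (m : Z), Cmod (e (RtoC (IZR m) * (RtoC (INR n) * a + RtoC x))) =
     powerRZ th (Z.of_nat n * m)).
  { intros n x m.
    replace (RtoC (IZR m) * (RtoC (INR n) * a + RtoC x)) with
      (RtoC (IZR (Z.of_nat n * m)) * a + RtoC (IZR m * x)).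
    - rewrite e_add, Cmod_mult, Cmod_e_real, Rmult_1_r, e_Z, Cmod_Czpow by apply e_nz. reflexivity.
    - rewrite mult_IZR, <- INR_IZR_INZ, !RtoC_mult. ring. }
  assert (B : exists M, (0 <= M)%R /\ forall (x : R) k,
     (Cmod (d k * e (RtoC (IZR (- (k + s))) * (RtoC (INR 2) * a + RtoC x))) <=
       M * powerRZ th (Z.abs k - Z.abs s))%R).
  (* The power of z is -(k + s). Terms with k >= 0 are controlled by the smaller circle th^3, terms
     with k < 0 by the larger circle th. *)
  { destruct (H _ (Hmod 3%nat 0%R ltac:(lia))) as (l1 & _ & S1 & _ & _).
    destruct (H _ (Hmod 1%nat 0%R ltac:(lia))) as (_ & l2 & _ & S2 & _).
    destruct (series_terms_bounded _ _ S1) as (M1 & B1).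
    destruct (series_terms_bounded _ _ S2) as (M2 & B2).
    assert (P1 : (0 <= M1)%R) by (eapply Rle_trans; [apply Cmod_ge_0|apply (B1 O)]).
    assert (P2 : (0 <= M2)%R) by (eapply Rle_trans; [apply Cmod_ge_0|apply (B2 O)]).
    exists (M1 + M2)%R. split; [lra|]. intros x k. rewrite Cmod_mult, Cn.
    assert (Pk := powerRZ_le th (Z.abs k - Z.abs s) (proj1 Hth)).
    destruct (Z_le_dec 0 k).
    - specialize (B1 (Z.to_nat k)). rewrite Z2Nat.id in B1 by auto.
      rewrite Cmod_mult, Cn in B1.
      replace (Z.of_nat 2 * - (k + s))%Z with (Z.of_nat 3 * - (k + s) + (k + s))%Z by lia.
      rewrite powerRZ_add, <- Rmult_assoc by (destruct Hth; unfold th; lra).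
      apply Rle_trans with (M1 * powerRZ th (Z.abs k - Z.abs s))%R.
      + apply Rmult_le_compat; auto.
        * apply Rmult_le_pos; [apply Cmod_ge_0|apply powerRZ_le, Hth].
        * apply powerRZ_le, Hth.
        * apply powerRZ_anti; auto. lia.
      + apply Rmult_le_compat_r; lra.
    - specialize (B2 (Z.to_nat (- k - 1))). replace (- Z.of_nat (Z.to_nat (- k - 1)) - 1)%Z with k in B2 by lia.
      rewrite Cmod_mult, Cn in B2.
      replace (Z.of_nat 2 * - (k + s))%Z with (Z.of_nat 1 * - (k + s) + - (k + s))%Z by lia.
      rewrite powerRZ_add, <- Rmult_assoc by (destruct Hth; unfold th; lra).
      apply Rle_trans with (M2 * powerRZ th (Z.abs k - Z.abs s))%R.
      + apply Rmult_le_compat; auto.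
        * apply Rmult_le_pos; [apply Cmod_ge_0|apply powerRZ_le, Hth].
        * apply powerRZ_le, Hth.
        * apply powerRZ_anti; auto. lia.
      + apply Rmult_le_compat_r; lra. }
  destruct B as (M & HM & B).
  assert (HS : forall x : R, sums (fun k => d k * e (RtoC (IZR (- (k + s))) * (RtoC (INR 2) * a + RtoC x))) 0).
  { intros x. apply is_Zseries_sums.
    - apply (abs_quad (e a) M (Z.abs s)); auto.
    - apply H, Hmod; lia. }
  set (u := fun k => d k * e (RtoC (IZR (- (k + s))) * (RtoC (INR 2) * a))).
  assert (Bu : forall k, (Cmod (u k) <= M * powerRZ th (Z.abs k - Z.abs s))%R).
  { intros k. unfold u. specialize (B 0%R k). rewrite Cplus_0_r in B. exact B. }
  assert (HA : forall N, sums (fun k => u k * root_avg (S N) (- (k + s))) 0).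
  { intros N.
    assert (L := sums_scal (/ RtoC (INR (S N))) _ _ (sums_lsum _ (fun _ => 0) (seq 0 (S N))
      (fun t => HS (INR t / INR (S N))%R))).
    assert (Z0 : forall l : list nat, lsum (fun _ : nat => RtoC 0) l = 0).
    { induction l as [|y l IH]; simpl; [auto|rewrite IH; ring]. }
    rewrite Z0, Cmult_0_r in L. eapply sums_ext; [|exact L].
    intros k. cbv beta. unfold root_avg, u.
    transitivity (/ RtoC (INR (S N)) * (u k * lsum (fun t => e (RtoC (IZR (- (k + s))) * root_arg (S N) t)) (seq 0 (S N))));
      [|unfold u; ring].
    f_equal. rewrite <- lsum_scal. apply lsum_ext. intros t _. unfold u.
    rewrite <- Cmult_assoc, <- e_add. f_equal. f_equal. unfold root_arg. ring. }
  destruct (sums_dominated (fun N k => u k * root_avg (S N) (- (k + s))) (fun _ => 0)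
    (fun k => if Z.eq_dec k (- s) then u k else 0)
    (fun k => M * powerRZ th (Z.abs k - Z.abs s))%R) as (V & HV & LV).
  - exact HA.
  - intros N k. rewrite Cmod_mult. rewrite <- (Rmult_1_r (M * _)).
    apply Rmult_le_compat; try apply Cmod_ge_0; auto. apply root_avg_bound; lia.
  - apply bounded_sums_quad; auto.
  - intros k. destruct (Z.eq_dec k (- s)) as [->|Hk].
    + apply (Clim_ext (fun _ => u (- s)%Z)); [|apply Clim_const].
      intros N. replace (- (- s + s))%Z with 0%Z by lia. rewrite root_avg_0 by lia. ring.
    + intros eps He. exists (Z.to_nat (Z.abs (k + s))). intros N HN.
      rewrite root_avg_vanish by lia.
      match goal with |- (Cmod ?x < _)%R => replace x with (RtoC 0) by ring end. rewrite Cmod_0; auto.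
  - assert (V0 : V = 0) by (eapply Clim_unique; [exact LV|apply Clim_const]).
    assert (V1 := sums_single (- s)%Z (fun k => if Z.eq_dec k (- s) then u k else 0)
      ltac:(intros t Hn; simpl; destruct (Z.eq_dec t (- s)); [contradiction|reflexivity])).
    cbv beta in V1. destruct (Z.eq_dec (- s) (- s)); [|contradiction].
    assert (U : u (- s)%Z = 0) by (rewrite <- V0; apply (sums_unique _ _ _ V1 HV)).
    unfold u in U. replace (- (- s + s))%Z with 0%Z in U by lia.
    rewrite Cmult_0_l, e_0, Cmult_1_r in U. exact U.
Qed.

(** * The string function *)

Lemma j_1 q : nome q -> j 1 q = 0.
Proof.
  intros Hq. assert (H := j_sums q 1 Hq C1_nz).
  apply (sums_antisymm (fun n => j_term q 1 (n + 1)) _ (sums_shift _ _ 1 H)).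
  intros m. unfold j_term. rewrite !Czpow_1_l.
  replace (-1 - m + 1)%Z with (- m)%Z by lia. rewrite sgz_opp, sgz_succ.
  replace (tri (- m)) with (tri (m + 1)) by (pose proof (tri_spec (- m)); pose proof (tri_spec (m + 1)); lia).
  ring.
Qed.

(** The factors z^(-1/2) cancel, and the quotient of the two theta prefactors has exponent
    3(2s+1)^2/28 - 1/8, the value of s_(lambda,mu) at m = 0. The index is reflected and shifted
    because the definition expands in z^(-m/2) with m = 2k + 2s. *)
Lemma character_expansion tau s w : (0 < Im tau)%R -> annulus (e tau) (e w) -> chi_den w tau <> 0 ->
  sums (fun k => e (RtoC (s_exponent 3 7 0 (2 * s)) * tau) / qinf (e tau) ^ 3 *
      char_coef (e tau) s (- (k + s)) * e (RtoC (IZR (- (k + s))) * w))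
    (chi 3 7 (2 * s) w tau).
Proof.
  intros Ht Ha Hd. assert (Hq := nome_e tau Ht). set (q := e tau) in *. set (z := e w) in *.
  assert (J0 := qinf_nz q Hq).
  assert (Hz1 : z <> 1).
  { intros E. apply Hd. rewrite chi_den_eq by auto. fold q z. rewrite E, j_1 by auto. ring. }
  assert (Hz0 := annulus_nz q z Hq Ha).
  destruct (pf_j q z Hq Hz0 (annulus_pole q z Hq Ha Hz1)) as (P & HP & EP).
  assert (HA := char_coef_laurent q s z P Hq Ha Hz1 HP).
  assert (H := sums_shift _ _ s (sums_neg _ _ HA)).
  assert (J3 : qinf q ^ 3 <> 0) by (apply Cpow_nz; auto).
  assert (Pnz : P <> 0) by (intros E; apply J3; rewrite <- EP, E; ring).
  assert (jnz : j z q <> 0) by (intros E; apply J3; rewrite <- EP, E; ring).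
  eapply sums_eq;
    [eapply sums_ext; [|apply (sums_scal (e (RtoC (s_exponent 3 7 0 (2 * s)) * tau) / qinf q ^ 3) _ _ H)]|].
  - intros k. cbv beta. rewrite e_Z. unfold z. ring.
  - unfold chi. rewrite chi_num_eq, chi_den_eq by auto. fold q z. rewrite <- EP.
    replace (RtoC (3 * (2 * IZR s + 1) ^ 2 / 28) * tau) with
      (RtoC (s_exponent 3 7 0 (2 * s)) * tau + RtoC (1 / 8) * tau).
    + rewrite e_add. field. repeat split; auto; apply e_nz.
    + rewrite <- Cmult_plus_distr_r, <- RtoC_plus. f_equal. f_equal.
      unfold s_exponent, level. rewrite mult_IZR. field.
Qed.

(** At level 1/3 the exponent m^2/(4N) is 3 (m/2)^2, an integer for even m. *)
Lemma Zseries_shift_term (tau w : C) (s k : Z) :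
  e (RtoC (IZR (2 * k + 2 * s) ^ 2 / (4 * level 3 7)) * tau) = Czpow (e tau) (3 * (k + s) * (k + s)) /\
  e (RtoC (- (IZR (2 * k + 2 * s) / 2)) * w) = e (RtoC (IZR (- (k + s))) * w).
Proof.
  split.
  - rewrite <- e_Z. f_equal. f_equal. f_equal. unfold level.
    rewrite !plus_IZR, !mult_IZR, !plus_IZR. field.
  - f_equal. f_equal. f_equal. rewrite opp_IZR, !plus_IZR, !mult_IZR. field.
Qed.

Lemma string_function_0 tau s : (0 < Im tau)%R ->
  string_function 3 7 0 (2 * s) tau =
  e (RtoC (s_exponent 3 7 0 (2 * s)) * tau) / qinf (e tau) ^ 3 * char_coef (e tau) s 0.
Proof.
  intros Ht. assert (Hq := nome_e tau Ht). assert (Hq0 := nome_nz _ Hq).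
  (* The witness divides the computed coefficients by q^(3(m/2)^2); m/2 is exact at the even m that
     enter the expansion. *)
  set (c0 := fun m => e (RtoC (s_exponent 3 7 0 (2 * s)) * tau) / qinf (e tau) ^ 3 *
     char_coef (e tau) s (- (m / 2)) * Czpow (e tau) (- (3 * (m / 2) * (m / 2)))).
  assert (E0 : is_string_expansion 3 7 (2 * s) tau c0).
  { intros w Hw Hd. apply sums_is_Zseries.
    eapply sums_ext; [|apply (character_expansion tau s w Ht Hw Hd)].
    intros k. cbv beta zeta.
    destruct (Zseries_shift_term tau w s k) as [-> ->]. unfold c0.
    replace ((2 * k + 2 * s) / 2)%Z with (k + s)%Z
      by (apply (Z.div_unique _ 2 _ 0); lia).
    rewrite Czpow_opp by auto.
    assert (N := Czpow_nz (e tau) (3 * (k + s) * (k + s)) Hq0). assert (N' := qinf_nz _ Hq).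
    field; auto. }
  unfold string_function. set (c := epsilon _ _).
  assert (E1 : is_string_expansion 3 7 (2 * s) tau c).
  { apply epsilon_spec. exists c0; auto. }
  (* The function chosen by [epsilon] and the witness expand the same character, so their difference
     expands 0. The comparison runs over |q| < |z| < 1, where the denominator of the character has
     no zero; k = -s is the index of m = 0. *)
  assert (D : (c 0%Z - c0 0%Z) * Czpow (e tau) 0 = 0).
  { assert (L := laurent_unique (fun k => (c (2 * k + 2 * s)%Z - c0 (2 * k + 2 * s)%Z) *
      Czpow (e tau) (3 * (k + s) * (k + s))) s tau Ht).
    cbv beta in L. replace (2 * - s + 2 * s)%Z with 0%Z in L by lia.
    replace (3 * (- s + s) * (- s + s))%Z with 0%Z in L by lia. apply L.
    intros w Hw.
    assert (Ha : annulus (e tau) (e w)).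
    { split; [apply Hw|]. apply Rlt_trans with 1%R; [apply Hw|].
      rewrite <- Rinv_1. apply Rinv_lt_contravar; destruct Hq; lra. }
    assert (Hz1 : e w <> 1).
    { intros F. rewrite F, Cmod_1 in Hw. lra. }
    assert (Hd : chi_den w tau <> 0).
    { rewrite chi_den_eq by auto.
      destruct (pf_j _ _ Hq (e_nz w) (annulus_pole _ _ Hq Ha Hz1)) as (P & _ & EP).
      repeat apply Cmult_neq_0; try apply e_nz.
      intros F. apply (Cpow_nz (qinf (e tau)) 3); [apply qinf_nz; auto|]. rewrite <- EP, F. ring. }
    assert (Z1 := is_Zseries_minus _ _ _ _ (E1 w Ha Hd) (E0 w Ha Hd)).
    replace (chi 3 7 (2 * s) w tau - chi 3 7 (2 * s) w tau) with (RtoC 0) in Z1 by ring.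
    match type of Z1 with is_Zseries ?f _ => match goal with |- is_Zseries ?g _ =>
      replace g with f; [exact Z1|] end end.
    apply functional_extensionality. intros k. cbv beta zeta.
    destruct (Zseries_shift_term tau w s k) as [-> ->]. ring. }
  rewrite Czpow_0, Cmult_1_r in D.
  assert (E : c 0%Z = c0 0%Z) by (replace (c 0%Z) with (c 0%Z - c0 0%Z + c0 0%Z) by ring; rewrite D; ring).
  rewrite E. unfold c0. change (0 / 2)%Z with 0%Z. change (- (3 * 0 * 0))%Z with 0%Z.
  change (- 0)%Z with 0%Z. rewrite Czpow_0. ring.
Qed.

Theorem theorem2p6 :
  forall (tau : C) (r : Z),
    (0 < Im tau)%R ->
    (r = 0 \/ r = 1 \/ r = 2)%Z ->
    let q := e tau in
    (qinf q) ^ 3 * normalized_string_function 3 7 0 (2 * r) tau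
    = Czpow (- q) (- r) * ((qinf q) ^ 3 / J 2 q)
        * (j (- Czpow q (1 + 2 * r)) (q ^ 14) * j (Czpow q (16 + 4 * r)) (q ^ 28)
           / (j (-1) q * J 28 q))
      - Czpow q (2 - 2 * r)
        * (j (Czpow q (6 - 2 * r)) (q ^ 14) * j (Czpow q (26 - 4 * r)) (q ^ 28)
           / J 28 q)
        * omega3 (- q)
      + Czpow q (- r) / 2
        * (j (Czpow q (1 + 2 * r)) (q ^ 14) * j (Czpow q (16 + 4 * r)) (q ^ 28)
           / J 28 q)
        * f3 (q ^ 2).
Proof.
  intros tau r Ht _ q. assert (Hq : nome q) by (apply nome_e; auto). assert (Hq0 := nome_nz q Hq).
  assert (QN := qinf_nz q Hq).
  assert (N2 : J 2 q <> 0) by (apply qinf_nz, (nome_pow q 1); auto).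
  assert (N28 : J 28 q <> 0) by (apply qinf_nz, (nome_pow q 27); auto).
  assert (E : qinf q ^ 3 * normalized_string_function 3 7 0 (2 * r) tau = char_coef q r 0).
  { unfold normalized_string_function. rewrite string_function_0 by auto. fold q.
    transitivity ((e (RtoC (- s_exponent 3 7 0 (2 * r)) * tau) * e (RtoC (s_exponent 3 7 0 (2 * r)) * tau)) * char_coef q r 0).
    - field. auto.
    - rewrite <- e_add, <- Cmult_plus_distr_r, <- RtoC_plus, Rplus_opp_l, Cmult_0_l, e_0. ring. }
  rewrite E. clear E.
  (* At z = -1 this identifies P with (q)_inf^3 / j(-1;q), the quotient in the first term of the
     statement. *)
  destruct (pf_j q (-1) Hq m1_nz (annulus_pole q _ Hq (annulus_m1 q Hq) m1_neq_1)) as (P & HP & EP).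
  assert (jnz : j (-1) q <> 0).
  { intros F. apply (Cpow_nz (qinf q) 3 QN). rewrite <- EP, F. ring. }
  assert (H := constant_term q r P Hq HP).
  rewrite (charnum_neg q r Hq), (charnum_1 q r Hq), (charnum_2 q r Hq) in H.
  change (qinf (q ^ 2)) with (J 2 q) in H. rewrite <- EP.
  replace (Czpow q (2 - 2 * r)) with (q ^ 2 * Czpow q (- (2 * r)))
    by (change (q ^ 2) with (Czpow q 2); rewrite <- Czpow_add by auto; f_equal; lia).
  transitivity (J 2 q * char_coef q r 0 / J 2 q); [field; auto|]. rewrite H.
  field. auto.
Qed.
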